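(* Let $A$ be a finite-dimensional real alternative $*$-algebra with quadratic cone $Q_A$, and let $\Omega_G$ be the axially symmetric domain in $Q_A$ associated to a symmetric domain $G$ in $\mathbb{C}$. Then there exists a slice regular function $f$ on $\Omega_G$, with stem function $F:G\to A_{\mathbb{C}}$, such that: (i) $D=\{q\in\Omega_G: f(q)=0\}$ is discrete in $\Omega_G$; (ii) $D\cup\partial\Omega_G$ is the closure of $D$ in $Q_A$, i.e. every boundary point of $\Omega_G$ (boundary taken in $Q_A$) is an accumulation point of $D$; (iii) there is a point $z\in G$ such that $F(z)\in A_{\mathbb{C}}^*$.
   Context: A finite-dimensional alternative real $*$-algebra $A$ is a finite-dimensional unital real algebra ($\mathbb{R}=\mathbb{R}\cdot 1\subset A$) with $x(xy)=(xx)y$ and $x(yy)=(xy)y$ for all $x,y\in A$, equipped with a real-linear involution $x\mapsto x^c$ satisfying $(xy)^c=y^cx^c$ and fixing $\mathbb{R}$ pointwise. The pseudosphere is $\mathbb{S}_A=\{w\in A: w+w^c=0,\ ww^c=1\}$ (so $w^2=-1$ for $w\in\mathbb{S}_A$); the quadratic cone is $Q_A=\mathbb{R}\cup\{w\in A: w+w^c\in\mathbb{R},\ ww^c\in\mathbb{R},\ 4ww^c>(w+w^c)^2\}$, equivalently $Q_A=\mathbb{R}\cup\{x+yI:x,y\in\mathbb{R},I\in\mathbb{S}_A\}$, with the subspace topology from the finite-dimensional vector space $A$. A symmetric domain in $\mathbb{C}$ is a (non-empty) open subset $G$ with $z\in G\iff\bar z\in G$ whose quotient by the relation $z\sim w\iff(z=w\text{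 or }z=\bar w)$ is connected. Its associated axially symmetric domain is $\Omega_G=\{x+yI: x+yi\in G,\ x,y\in\mathbb{R},\ I\in\mathbb{S}_A\}\subset Q_A$. A subset of $\Omega_G$ is discrete in $\Omega_G$ if it has no accumulation point in $\Omega_G$. Let $A_{\mathbb{C}}=A\otimes_{\mathbb{R}}\mathbb{C}$, whose elements are written $a+ib$ with $a,b\in A$ ($i$ central), with complex conjugation $\overline{a+ib}=a-ib$; $A_{\mathbb{C}}^*$ denotes its set of invertible elements (left and right invertibility coincide). A stem function is a holomorphic map $F:G\to A_{\mathbb{C}}$ with $F(\bar z)=\overline{F(z)}$. A slice regular function on $\Omega_G$ is a function $f:\Omega_G\to A$ induced by a stem function $F=F'+iF''$ ($F',F'':G\to A$) via $f(x+yI)=F'(x+yi)+I\,F''(x+yi)$ for $x+yi\in G$, $I\in\mathbb{S}_A$. *)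

(* Defs.v *)
(* MathComp-Analysis, with the complex plane R[i] of mathcomp-real-closed. *)
From HB Require Import structures.
From mathcomp Require Import all_boot all_order all_algebra.
From mathcomp Require Import all_classical all_reals all_analysis.
From mathcomp Require Import complex.

Set Implicit Arguments.
Unset Strict Implicit.
Unset Printing Implicit Defensive.

Import Order.TTheory GRing.Theory Num.Theory.
Import numFieldNormedType.Exports.

Local Open Scope classical_set_scope.
Local Open Scope ring_scope.
Local Open Scope complex_scope.
Local Open Scope quotient_scope.

HB.instance Definition _ (R : realType) := NormedModule.copy R[i] R[i]^o.

(* The norm only serves to name the canonical topology: all norms on a
   finite-dimensional real vector space are equivalent, and no compatibility
   with the algebra structure below is required. *)
#[short(type="finNormedModType")]
HB.structure Definition FinNormedModule (R : realType) :=
  {V of NormedModule R V & Vector R V}.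

HB.mixin Record isAltStarAlgebra (R : realType) A & FinNormedModule R A := {
  amul : A -> A -> A;
  aone : A;
  star : A -> A;
  amulDl : left_distributive amul +%R;
  amulDr : right_distributive amul +%R;
  amulZl : forall (a : R) (x y : A), amul (a *: x) y = a *: amul x y;
  amulZr : forall (a : R) (x y : A), amul x (a *: y) = a *: amul x y;
  amul1l : left_id aone amul;
  amul1r : right_id aone amul;
  aone_neq0 : aone != 0;
  alternative_left : forall x y : A, amul x (amul x y) = amul (amul x x) y;
  alternative_right : forall x y : A, amul x (amul y y) = amul (amul x y) y;
  starD : forall x y : A, star (x + y) = star x + star y;
  starZ : forall (a : R) (x : A), star (a *: x) = a *: star x;
  starK : involutive star;
  starM : forall x y : A, star (amul x y) = amul (star y) (star x);
  star_real : forall a : R, star (a *: aone) = a *: aone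
}.

#[short(type="altStarAlgType")]
HB.structure Definition AltStarAlgebra (R : realType) :=
  {A of isAltStarAlgebra R A & FinNormedModule R A}.

Notation "x ** y" := (amul x y) (at level 40, left associativity) : ring_scope.

Section QuadraticCone.
Variables (R : realType) (A : altStarAlgType R).

Definition areal (a : R) : A := a *: aone.

Definition pseudosphere : set A :=
  [set w | w + star w = 0 /\ w ** star w = aone].

Definition quadratic_cone : set A :=
  range areal `|`
  [set w | exists t n : R,
    [/\ w + star w = areal t, w ** star w = areal n & 4 * n > t ^+ 2]].

(* The topology of [subspace quadratic_cone] agrees on the cone with the
   topology induced by A, and makes the points off the cone isolated; so for
   subsets of the cone, closure, interior and limit points computed in it are
   those of the topological space Q_A. *)
Definition cone_space := subspace quadratic_cone.

Definition slice_point (x y : R) (I : A) : A := areal x + y *: I.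

End QuadraticCone.

Arguments pseudosphere {R} A _.
Arguments quadratic_cone {R} A _.

Definition boundary (T : topologicalType) (E : set T) : set T :=
  closure E `\` E°.

Section SymmetricDomain.
Variable R : realType.

Section ConjQuotient.
Variable G : set R[i].

Definition conj_rel (z w : G) : bool :=
  (val z == val w) || (val z == (val w)^*).

Lemma conj_rel_refl : reflexive conj_rel.
Proof. by move=> z; rewrite /conj_rel eqxx. Qed.

Lemma conj_rel_sym : symmetric conj_rel.
Proof.
by move=> z w; apply/idP/idP => /orP[]/eqP zw;
  rewrite /conj_rel zw ?conjcK eqxx ?orbT.
Qed.

Lemma conj_rel_trans : transitive conj_rel.
Proof.
move=> w z v; rewrite /conj_rel => /orP[]/eqP -> // /orP[]/eqP ->;
by rewrite ?conjcK eqxx ?orbT.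
Qed.

Definition conj_equiv : equiv_rel G :=
  EquivRel conj_rel conj_rel_refl conj_rel_sym conj_rel_trans.

Definition conj_quotient := quotient_topology {eq_quot conj_equiv}.

End ConjQuotient.

Definition symmetric_domain (G : set R[i]) : Prop :=
  [/\ G !=set0, open G, (forall z, G z <-> G z^*)
    & connected [set: conj_quotient G]].

End SymmetricDomain.

Section SliceFunctions.
Variables (R : realType) (A : altStarAlgType R).

(* The complexification of A is the real normed module A * A, the pair (a, b)
   standing for a + i b. *)
Definition ACscale (c : R[i]) (w : A * A) : A * A :=
  (complex.Re c *: w.1 - complex.Im c *: w.2,
   complex.Re c *: w.2 + complex.Im c *: w.1).

Definition ACmul (v w : A * A) : A * A :=
  (v.1 ** w.1 - v.2 ** w.2, v.1 ** w.2 + v.2 ** w.1).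

Definition ACconj (w : A * A) : A * A := (w.1, - w.2).

Definition ACinvertible (v : A * A) : Prop :=
  exists w, ACmul v w = (aone, 0) /\ ACmul w v = (aone, 0).

Definition complex_derivable (F : R[i] -> A * A) (z : R[i]) : Prop :=
  exists L : A * A,
    (fun h : R[i] => ACscale h^-1 (F (z + h) - F z)) @ 0^' --> L.

Variable G : set R[i].

(* Functions on G or on the axially symmetric domain are represented by total
   functions of which only the values on that set matter. *)
Definition stem_function (F : R[i] -> A * A) : Prop :=
  (forall z, G z -> complex_derivable F z) /\
  (forall z, G z -> F z^* = ACconj (F z)).

Definition axially_symmetric_domain : set A :=
  [set q | exists x y I,
    [/\ G (x +i* y), pseudosphere A I & q = slice_point x y I]].

Definition induced_by (f : A -> A) (F : R[i] -> A * A) : Prop :=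
  forall x y I, G (x +i* y) -> pseudosphere A I ->
    f (slice_point x y I) = (F (x +i* y)).1 + I ** (F (x +i* y)).2.

End SliceFunctions.

Arguments axially_symmetric_domain {R} A G _.

(* Main.v *)
From HB Require Import structures.
Require Import Defs.
From mathcomp Require Import all_boot all_order all_algebra.
From mathcomp Require Import all_classical all_reals all_analysis.
From mathcomp Require Import complex.
From mathcomp Require Import ring lra.

(** The slice function induced by F vanishes at x + y I if and only if
    (I + i) F (x + i y) = 0 in the complexification A_C ([plus_i_mul_eq0]). What
    has to be built is thus a holomorphic F on G, compatible with conjugation, for
    which the pairs (z, I) with (I + i) F z = 0 are isolated and yet occur near
    every boundary point of Omega. A scalar function will not do, since at a
    zero it is annihilated for all units at once; and the units may form an
    unbounded set.

    If Omega has no boundary, f = 1 will do. Otherwise let the pairs (b_n, J_n) be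
    dense in the set of pairs of a point outside G, approached by G from the open
    upper half plane, and an imaginary unit, every ball being visited infinitely
    often ([dense_sequence]). Choose p_n in G, in the upper half plane and extremely
    close to b_n ([approximating_sequence]), and put
      F = psi (1 + sum_n (m_n + m_n^c)),
      m_n = 3 i s J_0 + s^2 + tau_n s^3 (1 + i J_n)  at  s = sigma_n / (z - p_n),
    where m_n^c is the conjugate of m_n at the conjugate point, and psi is the
    product of the third powers of (z - p_n) / (z - b_n) and of their conjugates,
    which cancels the poles. The partial stems F_n are rational, and around each
    point of G they differ by functions that are bounded and Lipschitz with
    constants O(2^-n); so the limit is holomorphic ([cderivable_limit],
    [stem_limit_exists]).

    At p_n only the cubic term survives: F (p_n) is a nonzero multiple of
    1 + i J_n, which I + i annihilates for I = J_n only ([zero_at_root]). Hence f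
    vanishes at the point over p_n in the plane of J_n, and these points accumulate
    at every boundary point.

    It remains to see that the zeros are isolated. For tiny sigma_n the sum is small
    outside small disjoint discs about the p_n and their mirror images, so that
    there F / psi is close to 1 and neither (I + i) F nor F w with w <> 0 can vanish
    ([off_no_zero], [off_left_regular]). The second fact shows that left
    multiplication by F z is injective for such z, and F z is invertible
    ([left_regular_invertible]). In the n-th disc F / psi is 1 + m_n + eta with a
    small Lipschitz error eta. Its dominant part is of the form a + b J with a unit
    J. Right multiplication by J splits A_C into two eigenspaces, on which a + b J
    acts as a + i b and a - i b; if a + i b is bounded away from 0, a zero forces
    a - i b to be small, and comparing two zeros shows that they have the same
    a - i b and the same unit ([perturbed_zero_unique]). For moderate s this applies
    to 1 + s^2 + 3 i s J_0, with eigenvalues 1 + s^2 - 3 s and 1 + s^2 + 3 s, whose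
    roots are simple and distinct ([spike_inner_unique]). For large s, after
    division by s^2, it applies to 1 + tau_n s (1 + i J_n), with eigenvalues 1 and
    1 + 2 tau_n s ([spike_outer_unique]). The intermediate quadratic scale is needed
    because the error admitted by the second case depends on J_n: by the time
    tau_n s is of order one, division by s^2 has made everything else as small as
    desired, while eta itself is bounded uniformly in n.

    Finally, trace and norm give the point x + y I of the cone the continuous
    coordinates x and |y|. They carry an accumulation of zeros of f inside Omega to
    an accumulation of pairs (z, I) at a point of G, and a boundary point of Omega
    to a boundary point of G ([slice_coordinates_continuous],
    [boundary_points]). *)

Set Implicit Arguments.
Unset Strict Implicit.
Unset Printing Implicit Defensive.

Import Order.TTheory GRing.Theory Num.Theory.
Import numFieldNormedType.Exports.

Local Open Scope classical_set_scope.
Local Open Scope ring_scope.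
Local Open Scope complex_scope.

Local Notation normc := Normc.normc.

(** * The modulus of a complex number *)

Section Modulus.
Variable R : realType.
Implicit Types x y z : R[i].

Lemma normc_ge0 x : 0 <= normc x.
Proof. by case: x => a b; rewrite sqrtr_ge0. Qed.

Lemma normcD_le x y : normc (x + y) <= normc x + normc y.
Proof. exact: le_normcD. Qed.

Lemma normc_opp x : normc (- x) = normc x.
Proof. exact: normcN. Qed.

Lemma normcB_le x y : normc (x - y) <= normc x + normc y.
Proof. by rewrite -(normc_opp y) normcD_le. Qed.

Lemma normc_sub x y : normc (x - y) = normc (y - x).
Proof. by rewrite -normc_opp opprB. Qed.

Lemma normcB_ge x y : normc x - normc y <= normc (x - y).
Proof. by have := normcD_le (x - y) y; rewrite subrK; lra. Qed.

Lemma normc_dist_le x y z : normc (x - z) <= normc (x - y) + normc (y - z).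
Proof. by have := normcD_le (x - y) (y - z); rewrite addrA subrK. Qed.

Lemma normc_eq0 x : (normc x == 0) = (x == 0).
Proof.
apply/eqP/eqP => [/Normc.eq0_normc //|->]; exact: Normc.normc0.
Qed.

Lemma normc_gt0 x : (0 < normc x) = (x != 0).
Proof. by rewrite lt0r normc_eq0 normc_ge0 andbT. Qed.

Lemma normcX x n : normc (x ^+ n) = normc x ^+ n.
Proof.
by elim: n => [|n IH]; rewrite ?expr0 ?Normc.normc1 // !exprS Normc.normcM IH.
Qed.

Lemma normc_conj x : normc (x^*) = normc x.
Proof. by case: x => a b /=; rewrite sqrrN. Qed.

Lemma normc_real (a : R) : normc (a%:C) = `|a|.
Proof. by rewrite /= expr0n addr0 sqrtr_sqr. Qed.

Lemma normc_nat n : normc (n%:R : R[i]) = n%:R.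
Proof. by rewrite -(rmorph_nat (@real_complex R)) normc_real ger0_norm. Qed.

Lemma normc_i : normc ('i%C : R[i]) = 1.
Proof. by rewrite /= expr0n expr1n add0r sqrtr1. Qed.

Lemma Re_le_normc x : `|complex.Re x| <= normc x.
Proof.
case: x => a b /=; rewrite -sqrtr_sqr ler_wsqrtr // lerDl; exact: sqr_ge0.
Qed.

Lemma Im_le_normc x : `|complex.Im x| <= normc x.
Proof.
case: x => a b /=; rewrite -sqrtr_sqr ler_wsqrtr // lerDr; exact: sqr_ge0.
Qed.

Lemma normc_le_ReIm x : normc x <= `|complex.Re x| + `|complex.Im x|.
Proof.
case: x => a b.
have -> : a +i* b = a%:C + b%:C * 'i%C by simpc.
rewrite (le_trans (normcD_le _ _)) // Normc.normcM normc_i mulr1 !normc_real.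
by simpc.
Qed.

Lemma cnormE x : `|x| = (normc x)%:C.
Proof. by case: x => a b; rewrite normc_def. Qed.

Lemma complex_eqE x y :
  complex.Re x = complex.Re y -> complex.Im x = complex.Im y -> x = y.
Proof. by case: x => a b; case: y => c d /= -> ->. Qed.

End Modulus.

(** * The complexified algebra and its norm *)

Section Complexification.
Variables (R : realType) (A : altStarAlgType R).
Implicit Types (x y : A) (v w : A * A) (c d : R[i]).

Definition coordA (i : 'I_(\dim (@fullv R A))) (x : A) : R := coord (vbasis fullv) i x.

Definition creal (x : A) : A * A := (x, 0).

Lemma coord_ext x y : (forall i, coordA i x = coordA i y) -> x = y.
Proof.
move=> xy; rewrite (coord_vbasis (memvf x)) (coord_vbasis (memvf y)).
by apply: eq_bigr => i _; rewrite [coord _ _ _]xy.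
Qed.

Lemma coordA_D i x y : coordA i (x + y) = coordA i x + coordA i y.
Proof. by rewrite /coordA linearD. Qed.

Lemma coordA_N i x : coordA i (- x) = - coordA i x.
Proof. by rewrite /coordA linearN. Qed.

Lemma coordA_Z i a x : coordA i (a *: x) = a * coordA i x.
Proof. by rewrite /coordA linearZ. Qed.

Lemma coordA_0 i : coordA i (0 : A) = 0.
Proof. by rewrite /coordA linear0. Qed.

Ltac amod := apply: coord_ext => ?;
  rewrite ?(coordA_D, coordA_N, coordA_Z, coordA_0); ring.

Lemma AC_eqE v w : v.1 = w.1 -> v.2 = w.2 -> v = w.
Proof. by case: v => a b; case: w => c d /= -> ->. Qed.

Lemma amul0l x : (0 : A) ** x = 0.
Proof. by apply: (addrI (0 ** x)); rewrite -amulDl !addr0. Qed.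

Lemma amul0r x : x ** (0 : A) = 0.
Proof. by apply: (addrI (x ** 0)); rewrite -amulDr !addr0. Qed.

Lemma amulNl x y : (- x) ** y = - (x ** y).
Proof. by rewrite -scaleN1r amulZl scaleN1r. Qed.

Lemma amulNr x y : x ** (- y) = - (x ** y).
Proof. by rewrite -scaleN1r amulZr scaleN1r. Qed.

Lemma amulBl x y z : (x - y) ** z = x ** z - y ** z.
Proof. by rewrite amulDl amulNl. Qed.

Lemma amulBr x y z : z ** (x - y) = z ** x - z ** y.
Proof. by rewrite amulDr amulNr. Qed.

Lemma star0 : star (0 : A) = 0.
Proof. by rewrite -(scale0r (0 : A)) starZ !scale0r. Qed.

Lemma starN x : star (- x) = - star x.
Proof. by rewrite -scaleN1r starZ scaleN1r. Qed.

Lemma ACscaleDr c v w : ACscale c (v + w) = ACscale c v + ACscale c w.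
Proof. by apply: AC_eqE => /=; amod. Qed.

Lemma ACscaleDl c d v : ACscale (c + d) v = ACscale c v + ACscale d v.
Proof. by case: c => a b; case: d => a' b'; apply: AC_eqE => /=; amod. Qed.

Lemma ACscaleA c d v : ACscale c (ACscale d v) = ACscale (c * d) v.
Proof. by case: c => a b; case: d => a' b'; apply: AC_eqE => /=; amod. Qed.

Lemma ACscale1 v : ACscale 1 v = v.
Proof. by apply: AC_eqE => /=; rewrite !scale1r !scale0r ?subr0 ?addr0. Qed.

Lemma ACscale0 v : ACscale 0 v = 0.
Proof. by apply: AC_eqE => /=; rewrite !scale0r ?subr0 ?addr0. Qed.

Lemma ACscalev0 c : ACscale c (0 : A * A) = 0.
Proof. by apply: AC_eqE => /=; rewrite !scaler0 ?subr0 ?addr0. Qed.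

Lemma ACscaleN c v : ACscale (- c) v = - ACscale c v.
Proof. by apply: (addrI (ACscale c v)); rewrite -ACscaleDl !subrr ACscale0. Qed.

Lemma ACscalevN c v : ACscale c (- v) = - ACscale c v.
Proof. by apply: (addrI (ACscale c v)); rewrite -ACscaleDr !subrr ACscalev0. Qed.

Lemma ACscaleBl c d v : ACscale (c - d) v = ACscale c v - ACscale d v.
Proof. by rewrite ACscaleDl ACscaleN. Qed.

Lemma ACscaleBr c v w : ACscale c (v - w) = ACscale c v - ACscale c w.
Proof. by rewrite ACscaleDr ACscalevN. Qed.

Lemma ACmulDl u v w : ACmul (u + v) w = ACmul u w + ACmul v w.
Proof. by apply: AC_eqE => /=; rewrite !amulDl ?opprD addrACA. Qed.

Lemma ACmulDr u v w : ACmul w (u + v) = ACmul w u + ACmul w v.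
Proof. by apply: AC_eqE => /=; rewrite !amulDr ?opprD addrACA. Qed.

Lemma ACmulZl c v w : ACmul (ACscale c v) w = ACscale c (ACmul v w).
Proof.
by apply: AC_eqE => /=; rewrite ?amulBl ?amulDl !amulZl; amod.
Qed.

Lemma ACmulZr c v w : ACmul v (ACscale c w) = ACscale c (ACmul v w).
Proof.
by apply: AC_eqE => /=; rewrite ?amulBr ?amulDr !amulZr; amod.
Qed.

Lemma ACmul0l v : ACmul 0 v = 0.
Proof. by apply: AC_eqE; rewrite /= !amul0l ?subr0 ?addr0. Qed.

Lemma ACmul0r v : ACmul v 0 = 0.
Proof. by apply: AC_eqE; rewrite /= !amul0r ?subr0 ?addr0. Qed.

Lemma ACmulNr v w : ACmul v (- w) = - ACmul v w.
Proof. by apply: (addrI (ACmul v w)); rewrite -ACmulDr !subrr ACmul0r. Qed.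

Lemma ACmulBr u v w : ACmul w (u - v) = ACmul w u - ACmul w v.
Proof. by rewrite ACmulDr ACmulNr. Qed.

Lemma ACmul1l v : ACmul (creal aone) v = v.
Proof. by apply: AC_eqE; rewrite /= !amul1l amul0l ?subr0 ?addr0. Qed.

Lemma ACmul1r v : ACmul v (creal aone) = v.
Proof. by apply: AC_eqE; rewrite /= !amul1r amul0r ?subr0 ?add0r. Qed.

Lemma ACconjZ c v : ACconj (ACscale c v) = ACscale c^* (ACconj v).
Proof.
case: c => a b.
by apply: AC_eqE; rewrite /= ?scaleNr ?scalerN ?opprK // opprD.
Qed.

Lemma ACconjD v w : ACconj (v + w) = ACconj v + ACconj w.
Proof. by apply: AC_eqE; rewrite //= opprD. Qed.

Lemma ACconjK v : ACconj (ACconj v) = v.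
Proof. by apply: AC_eqE; rewrite //= opprK. Qed.

Lemma alternative_left_polarized x y z :
  x ** (y ** z) + y ** (x ** z) = (x ** y) ** z + (y ** x) ** z.
Proof.
have e := alternative_left (x + y) z.
move: e; rewrite !(amulDl, amulDr) !alternative_left => e.
apply: coord_ext => i; move: e => /(congr1 (coordA i)).
by rewrite !coordA_D; lra.
Qed.

Lemma flexible x y : x ** (y ** x) = (x ** y) ** x.
Proof.
have := alternative_left_polarized x y x.
by rewrite alternative_right => /addIr.
Qed.

Lemma flexible_polarized x y z :
  x ** (y ** z) + z ** (y ** x) = (x ** y) ** z + (z ** y) ** x.
Proof.
have := flexible (x + z) y.
rewrite !(amulDl, amulDr) !flexible => e.
apply: coord_ext => i; move: e => /(congr1 (coordA i)).
by rewrite !coordA_D; lra.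
Qed.

(** An identity that is quadratic in one variable passes to the
    complexification only in polarized form, whence the lemmas above. *)
Lemma AC_flexible v w : ACmul v (ACmul w v) = ACmul (ACmul v w) v.
Proof.
case: v => a b; case: w => c d.
have e1 := flexible_polarized a d b; have e2 := flexible_polarized a c b.
apply: AC_eqE => /=; rewrite !(amulBr, amulDr, amulBl, amulDl) !flexible;
  apply: coord_ext => i;
  move: e1 e2 => /(congr1 (coordA i)) + /(congr1 (coordA i));
  by rewrite !(coordA_D, coordA_N); lra.
Qed.

Definition ccoord i v : R[i] := coordA i v.1 +i* coordA i v.2.

Lemma ccoordD i v w : ccoord i (v + w) = ccoord i v + ccoord i w.
Proof. by rewrite /ccoord /= !coordA_D; simpc. Qed.

Lemma ccoordZ i c v : ccoord i (ACscale c v) = c * ccoord i v.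
Proof.
case: c => a b; rewrite /ccoord /= !(coordA_D, coordA_N, coordA_Z); simpc.
by congr (_ +i* _); rewrite addrC.
Qed.

(** Unlike the norm of the product space, this one is homogeneous for complex
    scalars. *)
Definition ACnorm v : R := \sum_i normc (ccoord i v).

Lemma ACnorm_ge0 v : 0 <= ACnorm v.
Proof. by apply: sumr_ge0 => i _; exact: normc_ge0. Qed.

Lemma ACnormD v w : ACnorm (v + w) <= ACnorm v + ACnorm w.
Proof.
by rewrite /ACnorm -big_split; apply: ler_sum => i _; rewrite ccoordD normcD_le.
Qed.

Lemma ACnormZ c v : ACnorm (ACscale c v) = normc c * ACnorm v.
Proof.
rewrite /ACnorm big_distrr; apply: eq_bigr => i _.
by rewrite ccoordZ Normc.normcM.
Qed.

Lemma ACnorm0 : ACnorm 0 = 0.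
Proof. by rewrite -(ACscale0 0) ACnormZ Normc.normc0 mul0r. Qed.

Lemma ACnormN v : ACnorm (- v) = ACnorm v.
Proof. by rewrite -(ACscale1 v) -ACscaleN !ACnormZ normc_opp. Qed.

Lemma ACnormB v w : ACnorm (v - w) <= ACnorm v + ACnorm w.
Proof. by rewrite -(ACnormN w) ACnormD. Qed.

Lemma ACnorm_sub v w : ACnorm (v - w) = ACnorm (w - v).
Proof. by rewrite -ACnormN opprB. Qed.

Lemma ACnorm_dist u v w : ACnorm (u - w) <= ACnorm (u - v) + ACnorm (v - w).
Proof. by have := ACnormD (u - v) (v - w); rewrite addrA subrK. Qed.

Lemma ACnorm_eq0 v : ACnorm v = 0 -> v = 0.
Proof.
move=> /eqP; rewrite psumr_eq0 => [/allP v0|i _]; last exact: normc_ge0.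
have cv0 i : ccoord i v = 0.
  by apply/eqP; rewrite -normc_eq0; apply: v0; rewrite mem_index_enum.
apply: AC_eqE; apply: coord_ext => i; move/eqP: (cv0 i);
  by rewrite eq_complex /= coordA_0 => /andP[/eqP ? /eqP ?].
Qed.

Lemma ACnorm_gt0 v : v != 0 -> 0 < ACnorm v.
Proof.
move=> v0; rewrite lt0r ACnorm_ge0 andbT.
by apply: contraNN v0 => /eqP /ACnorm_eq0 /eqP.
Qed.

Lemma ACnorm_creal1 v : ACnorm (creal v.1) <= ACnorm v.
Proof.
apply: ler_sum => i _; rewrite /ccoord /= coordA_0.
by have := Re_le_normc (ccoord i v); rewrite -normc_real.
Qed.

Lemma ACnorm_creal2 v : ACnorm (creal v.2) <= ACnorm v.
Proof.
apply: ler_sum => i _; rewrite /ccoord /= coordA_0.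
by have := Im_le_normc (ccoord i v); rewrite -normc_real.
Qed.

Lemma ACnorm_conj v : ACnorm (ACconj v) = ACnorm v.
Proof.
by apply: eq_bigr => i _; rewrite /ccoord /= coordA_N sqrrN.
Qed.

Lemma AC_sumE v :
  v = \sum_i ACscale (ccoord i v) (creal (vbasis (@fullv R A))`_i).
Proof.
apply: AC_eqE.
  rewrite [RHS](big_morph (@fst A A) (id1 := 0) (op1 := +%R)) //=.
  rewrite [LHS](coord_vbasis (memvf _)); apply: eq_bigr => i _.
  by rewrite scaler0 subr0.
rewrite [RHS](big_morph (@snd A A) (id1 := 0) (op1 := +%R)) //=.
rewrite [LHS](coord_vbasis (memvf _)); apply: eq_bigr => i _.
by rewrite scaler0 add0r.
Qed.

Lemma ACnorm_sum (I : finType) (f : I -> A * A) :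
  ACnorm (\sum_i f i) <= \sum_i ACnorm (f i).
Proof.
elim/big_rec2: _ => [|i a b _ ab]; first by rewrite ACnorm0.
by apply: le_trans (ACnormD _ _) _; rewrite lerD2l.
Qed.

Lemma ACmul_bounded :
  exists mu : R, 1 <= mu /\ forall v w, ACnorm (ACmul v w) <= mu * ACnorm v * ACnorm w.
Proof.
pose e (i : 'I_(\dim (@fullv R A))) : A * A := creal (vbasis (@fullv R A))`_i.
pose m0 : R := \sum_i \sum_j ACnorm (ACmul (e i) (e j)).
have m0_ge0 : 0 <= m0 by do 2!apply: sumr_ge0 => ? _; exact: ACnorm_ge0.
exists (1 + m0); split; first by rewrite lerDl.
move=> v w; apply: (@le_trans _ _ (m0 * ACnorm v * ACnorm w)); last first.
  by rewrite -!mulrA ler_wpM2r ?lerDr // mulr_ge0 ?ACnorm_ge0.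
have cn u i : normc (ccoord i u) <= ACnorm u.
  by rewrite /ACnorm (bigD1 i) //= lerDl sumr_ge0 // => ? _; exact: normc_ge0.
rewrite {1}(AC_sumE v) {1}(AC_sumE w).
rewrite (big_morph (fun x : A * A => ACmul x _) (id1 := 0) (op1 := +%R)); last 2 first.
- by move=> x y; rewrite ACmulDl.
- by rewrite ACmul0l.
apply: le_trans (ACnorm_sum _) _; rewrite /m0 -mulrA big_distrl /=.
apply: ler_sum => i _.
rewrite (big_morph (fun x : A * A => ACmul _ x) (id1 := 0) (op1 := +%R)); last 2 first.
- by move=> x y; rewrite ACmulDr.
- by rewrite ACmul0r.
apply: le_trans (ACnorm_sum _) _; rewrite big_distrl /=; apply: ler_sum => j _.
rewrite ACmulZl ACmulZr !ACnormZ mulrA mulrC ler_wpM2l ?ACnorm_ge0 //.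
by rewrite ler_pM ?normc_ge0.
Qed.

Lemma crealD x y : creal (x + y) = creal x + creal y.
Proof. by apply: AC_eqE; rewrite //= addr0. Qed.

Lemma ACnorm_crealD x y : ACnorm (creal (x + y)) <= ACnorm (creal x) + ACnorm (creal y).
Proof. by rewrite crealD ACnormD. Qed.

Lemma ACnorm_crealZ a x : ACnorm (creal (a *: x)) = `|a| * ACnorm (creal x).
Proof.
rewrite -normc_real -ACnormZ; congr ACnorm.
by apply: AC_eqE; rewrite /= ?scale0r ?scaler0 ?subr0 ?addr0.
Qed.

Lemma ACnorm_one_gt0 : 0 < ACnorm (creal (aone : A)).
Proof. by apply: ACnorm_gt0; apply/eqP => -[/eqP]; rewrite (negbTE (@aone_neq0 _ A)). Qed.

Lemma opp_of_scale (T : A * A -> A * A) v :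
  (forall c w, T (ACscale c w) = ACscale c (T w)) -> T (- v) = - T v.
Proof. by move=> TZ; rewrite -{1}(ACscale1 v) -ACscaleN TZ ACscaleN ACscale1. Qed.

Lemma bound_ge0 (T : A * A -> A * A) (B : R) :
  (forall v, ACnorm (T v) <= B * ACnorm v) -> 0 <= B.
Proof.
move=> TB; rewrite -(pmulr_lge0 _ ACnorm_one_gt0).
exact: le_trans (ACnorm_ge0 _) (TB _).
Qed.

End Complexification.

(** * Geometric convergence and equivalence of norms *)

Section Completeness.
Variable R : realType.

Lemma geometric_telescope (V : zmodType) (n : V -> R) (u : nat -> V) (C : R) :
  (forall v w, n (v + w) <= n v + n w) -> n 0 = 0 ->
  (forall k, n (u k.+1 - u k) <= C / 2 ^+ k) ->
  forall k m, (k <= m)%N -> n (u m - u k) <= 2 * C / 2 ^+ k - 2 * C / 2 ^+ m.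
Proof.
move=> nD n0 du k m /subnK <-; elim: (m - k)%N => [|j IH].
  by rewrite add0n !subrr n0.
have := nD (u (j + k).+1 - u (j + k)%N) (u (j + k)%N - u k).
rewrite addrA subrK addSn => h; apply: le_trans h _.
have := du (j + k)%N; rewrite exprS.
suff -> : 2 * C / (2 * 2 ^+ (j + k)) = C / 2 ^+ (j + k) by move: IH; lra.
by field; rewrite expf_neq0.
Qed.

(** The limit is the supremum of the lower bounds [a k - 2 C / 2 ^ k], each of
    which stays below all the upper bounds [a m + 2 C / 2 ^ m]. *)
Lemma geometric_cvg_real (a : nat -> R) (C : R) :
  (forall k, `|a k.+1 - a k| <= C / 2 ^+ k) ->
  exists l, forall k, `|l - a k| <= 2 * C / 2 ^+ k.
Proof.
move=> da; pose E := [set a k - 2 * C / 2 ^+ k | k in [set: nat]].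
have C0 : 0 <= C by have := da 0%N; rewrite expr0 divr1; apply: le_trans.
have p0 k : 0 <= 2 * C / 2 ^+ k by rewrite divr_ge0 ?exprn_ge0 ?mulr_ge0.
have tel k m : (k <= m)%N -> `|a m - a k| <= 2 * C / 2 ^+ k - 2 * C / 2 ^+ m.
  exact: (geometric_telescope (n := fun x : R => `|x|) (@ler_normD _ _) (normr0 _)).
have ub k m : a k - 2 * C / 2 ^+ k <= a m + 2 * C / 2 ^+ m.
  have [km|/ltnW mk] := leqP k m.
    by have := tel _ _ km; rewrite ler_norml => /andP[]; have := p0 m; lra.
  by have := tel _ _ mk; rewrite ler_norml => /andP[]; have := p0 k; lra.
have hE : has_sup E.
  split; first by exists (a 0%N - 2 * C / 2 ^+ 0); exists 0%N.
  by exists (a 0%N + 2 * C / 2 ^+ 0) => _ [k _ <-].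
exists (sup E) => k; rewrite ler_norml; apply/andP; split.
  have : a k - 2 * C / 2 ^+ k <= sup E by apply: sup_upper_bound => //; exists k.
  lra.
have : sup E <= a k + 2 * C / 2 ^+ k by apply: sup_le_ub => [|_ [m _ <-]]; [case: hE|].
lra.
Qed.

Lemma geometric_small (K e : R) : 0 < e -> exists k, K / 2 ^+ k < e.
Proof.
move=> e0.
have [K0|K0] := leP K 0; first by exists 0%N; rewrite expr0 divr1 (le_lt_trans K0).
exists (Num.bound (K / e)).
rewrite ltr_pdivrMr ?exprn_gt0 // mulrC -ltr_pdivrMr //.
have /ltW := archi_boundP (divr_ge0 (ltW K0) (ltW e0)).
move=> h; apply: le_lt_trans h _; rewrite -natrX ltr_nat; exact: ltn_expl.
Qed.

End Completeness.

Section FiniteDimension.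
Variables (R : realType) (A : altStarAlgType R).
Implicit Types (x y : A).

Let n := \dim (@fullv R A).
Let e (i : 'I_n) : A := (vbasis (@fullv R A))`_i.

Lemma coordA_sumE x : x = \sum_i coordA i x *: e i.
Proof. exact: coord_vbasis (memvf x). Qed.

Lemma ACnorm_creal x : ACnorm (creal x) = \sum_i `|coordA i x|.
Proof. by apply: eq_bigr => i _; rewrite /ccoord /= coordA_0 [LHS]normc_real. Qed.

Lemma norm_le_ACnorm : exists C : R, 0 < C /\
  forall x, `|x| <= C * ACnorm (creal x).
Proof.
exists (1 + \sum_i `|e i|); split; first by rewrite ltr_wpDr ?sumr_ge0.
move=> x; rewrite {1}(coordA_sumE x) (le_trans (ler_norm_sum _ _ _)) //.
rewrite ACnorm_creal mulr_sumr ler_sum // => i _; rewrite normrZ mulrC.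
rewrite ler_wpM2r // ler_wpDl // (bigD1 i) //= lerDl sumr_ge0 //.
Qed.

(** The given norm, read in coordinates, is continuous and has a positive
    minimum on the compact unit sphere. *)
Lemma ACnorm_le_norm : exists C : R, 0 < C /\
  forall x, ACnorm (creal x) <= C * `|x|.
Proof.
pose phi (u : 'rV[R]_n) : A := \sum_i u ord0 i *: e i.
have cphi : continuous phi.
  rewrite /phi; elim: (index_enum _) => [|i s IH].
    have -> : (fun u : 'rV[R]_n => \sum_(j <- [::]) u ord0 j *: e j) = cst 0.
      by apply/funext => u; rewrite big_nil.
    exact: cst_continuous.
  have -> : (fun u : 'rV[R]_n => \sum_(j <- i :: s) u ord0 j *: e j) =
      (fun u => u ord0 i *: e i) + (fun u => \sum_(j <- s) u ord0 j *: e j).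
    by apply/funext => u; rewrite big_cons.
  move=> u.
  have ci : {for u, continuous (fun u : 'rV[R]_n => u ord0 i *: e i)}.
    refine (@cvgZr_tmp R A _ (nbhs u) _ (fun u : 'rV[R]_n => u ord0 i) _ _ _).
    exact (@coord_continuous R 1 n ord0 i u).
  exact: (continuousD ci (IH u)).
have cnphi : continuous (fun u => `|phi u|).
  by move=> u; apply: (@cvg_norm R A _ _ _ phi _ (cphi u)).
pose S := [set u : 'rV[R]_n | `|u| = 1].
have cS : compact S.
  apply: bounded_closed_compact.
    by exists 1; split => // x x1 u; rewrite /S /= => ->; exact: ltW.
  apply: (@preimage_closed _ _ (fun u : 'rV[R]_n => `|u|) [set 1]).
    by move=> ? _; exact: norm_continuous.
  exact: closed_eq.
pose co x : 'rV[R]_n := \row_i coordA i x.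
have phico x : phi (co x) = x.
  by rewrite [RHS]coordA_sumE; apply: eq_bigr => i _; rewrite mxE.
have coZ a x : co (a *: x) = a *: co x.
  by apply/rowP => i; rewrite !mxE coordA_Z.
have co_neq0 x : x != 0 -> 0 < `|co x|.
  move=> x0; rewrite normr_gt0; apply: contraNneq x0 => cx.
  by rewrite -(phico x) cx /phi big1 // => i _; rewrite mxE scale0r.
have phiZ a u : phi (a *: u) = a *: phi u.
  by rewrite /phi scaler_sumr; apply: eq_bigr => i _; rewrite mxE scalerA.
have Sco x : x != 0 -> S (`|co x|^-1 *: co x).
  move=> x0; rewrite /S /= normrZ normfV normr_id mulVf //.
  by rewrite gt_eqF // co_neq0.
have [u] := EVT_min_rV (ex_intro _ _ (Sco _ (aone_neq0 (s := A)))) cS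
  (continuous_subspaceT cnphi).
rewrite inE => Su umin.
have m0 : 0 < `|phi u|.
  rewrite normr_gt0; apply/eqP => pu0.
  have : co (phi u) = u.
    apply/rowP => i; rewrite mxE /coordA /phi.
    by rewrite coord_sum_free // (basis_free (vbasisP _)).
  rewrite pu0 -(scale0r (0 : A)) coZ scale0r => u0.
  by move: Su; rewrite /S /= -u0 normr0 => /eqP; rewrite eq_sym oner_eq0.
have main x : `|co x| <= `|phi u|^-1 * `|x|.
  have [->|x0] := eqVneq x 0.
    by rewrite -(scale0r (0 : A)) coZ scale0r scale0r !normr0 mulr0.
  have := umin _ (mem_set (Sco x x0)).
  rewrite phiZ phico normrZ normfV normr_id => h.
  rewrite mulrC ler_pdivlMr ?co_neq0 // mulrC in h.
  by rewrite mulrC ler_pdivlMr.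
exists (1 + n%:R * `|phi u|^-1); split.
  by rewrite ltr_wpDr ?mulr_ge0 ?invr_ge0.
move=> x; rewrite ACnorm_creal.
apply: (@le_trans _ _ (\sum_(i < n) (`|phi u|^-1 * `|x|))).
  apply: ler_sum => i _; apply: le_trans (main x).
  have -> : coordA i x = co x ord0 i by rewrite mxE.
  rewrite [leRHS]/Num.Def.normr /= mx_normrE; apply/bigmax_geP; right => /=.
  by exists (ord0, i).
rewrite sumr_const card_ord -[leLHS]mulr_natl mulrDl mul1r mulrA.
by rewrite ler_wpDl.
Qed.

(** Every coordinate converges geometrically, which gives a limit with a
    constant that depends on the dimension; the telescoping bound then restores
    the constant [2 C]. *)
Lemma geometric_cvg (u : nat -> A * A) (C : R) :
  (forall k, ACnorm (u k.+1 - u k) <= C / 2 ^+ k) ->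
  exists l, forall k, ACnorm (l - u k) <= 2 * C / 2 ^+ k.
Proof.
move=> du.
have cc i (w : A * A) : normc (ccoord i w) <= ACnorm w.
  by rewrite /ACnorm (bigD1 i) //= lerDl sumr_ge0 // => ? _; exact: normc_ge0.
have c1 i (w : A * A) : `|coordA i w.1| <= ACnorm w.
  by have := le_trans (Re_le_normc (ccoord i w)) (cc i w).
have c2 i (w : A * A) : `|coordA i w.2| <= ACnorm w.
  by have := le_trans (Im_le_normc (ccoord i w)) (cc i w).
have l1 i : exists l, forall k, `|l - coordA i (u k).1| <= 2 * C / 2 ^+ k.
  apply: geometric_cvg_real => k; apply: le_trans (du k).
  by rewrite -coordA_N -coordA_D; exact: (c1 i (u k.+1 - u k)).
have l2 i : exists l, forall k, `|l - coordA i (u k).2| <= 2 * C / 2 ^+ k.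
  apply: geometric_cvg_real => k; apply: le_trans (du k).
  by rewrite -coordA_N -coordA_D; exact: (c2 i (u k.+1 - u k)).
have [f1 f1P] := choice l1; have [f2 f2P] := choice l2.
pose l : A * A := (\sum_i f1 i *: e i, \sum_i f2 i *: e i).
have cl1 i : coordA i l.1 = f1 i.
  by rewrite /coordA /= coord_sum_free // (basis_free (vbasisP _)).
have cl2 i : coordA i l.2 = f2 i.
  by rewrite /coordA /= coord_sum_free // (basis_free (vbasisP _)).
pose K := n%:R * (4 * C).
have lK k : ACnorm (l - u k) <= K / 2 ^+ k.
  apply: (@le_trans _ _ (\sum_(i < n) (4 * C / 2 ^+ k))); last first.
    by rewrite sumr_const card_ord -[leLHS]mulr_natl /K mulrA.
  apply: ler_sum => i _; apply: le_trans (normc_le_ReIm _) _.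
  rewrite /ccoord /= !coordA_D !coordA_N cl1 cl2.
  by have := f1P i k; have := f2P i k; lra.
exists l => k; rewrite leNgt; apply/negP => h.
have [m mP] := geometric_small K (e := ACnorm (l - u k) - 2 * C / 2 ^+ k)
  ltac:(by rewrite subr_gt0).
have C0 : 0 <= C.
  by have := le_trans (ACnorm_ge0 _) (du 0%N); rewrite expr0 divr1.
have K0 : 0 <= K by rewrite !mulr_ge0.
have tel := geometric_telescope (n := @ACnorm R A) (@ACnormD R A) (@ACnorm0 R A) du.
have := tel k (k + m)%N (leq_addr _ _).
have := ACnorm_dist l (u (k + m)%N) (u k).
have := lK (k + m)%N.
have : K / 2 ^+ (k + m) <= K / 2 ^+ m.
  rewrite ler_wpM2l // lef_pV2 ?posrE ?exprn_gt0 // ler_eXn2l ?leq_addl //.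
  by rewrite ltr1n.
have : 0 <= 2 * C / 2 ^+ (k + m) by rewrite divr_ge0 ?exprn_ge0 ?mulr_ge0.
lra.
Qed.

Lemma geometric_limit_le (u : nat -> A * A) (K : R) l (B : R) (N : nat) :
  (forall k, ACnorm (l - u k) <= K / 2 ^+ k) ->
  (forall k, (N <= k)%N -> ACnorm (u k) <= B) -> ACnorm l <= B.
Proof.
move=> lu uB; rewrite leNgt; apply/negP => h.
have [m mP] := geometric_small K (e := ACnorm l - B) ltac:(by rewrite subr_gt0).
have K0 : 0 <= K by have := le_trans (ACnorm_ge0 _) (lu 0%N); rewrite expr0 divr1.
have := uB (N + m)%N (leq_addr _ _); have := lu (N + m)%N.
have := ACnormD (l - u (N + m)%N) (u (N + m)%N); rewrite subrK.
have : K / 2 ^+ (N + m) <= K / 2 ^+ m.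
  rewrite ler_wpM2l // lef_pV2 ?posrE ?exprn_gt0 // ler_eXn2l ?leq_addl //.
  by rewrite ltr1n.
lra.
Qed.

End FiniteDimension.

(** * Imaginary units and zeros of perturbed lines *)

Section ImaginaryUnits.
Variables (R : realType) (A : altStarAlgType R).
Implicit Types (x y I J : A) (v w : A * A).

Lemma pseudosphere_star I : pseudosphere A I -> star I = - I.
Proof. by case=> /eqP; rewrite addrC addr_eq0 => /eqP. Qed.

Lemma pseudosphere_sqr I : pseudosphere A I -> I ** I = - aone.
Proof.
by move=> hI; have [_] := hI; rewrite pseudosphere_star // amulNr => <-; rewrite opprK.
Qed.

Lemma pseudosphereN I : pseudosphere A I -> pseudosphere A (- I).
Proof.
move=> hI; have [h1 h2] := hI; split; first by rewrite starN -opprD h1 oppr0.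
by rewrite starN amulNr amulNl opprK.
Qed.

Lemma pseudosphere_mull I x : pseudosphere A I -> I ** (I ** x) = - x.
Proof. by move=> /pseudosphere_sqr h; rewrite alternative_left h amulNl amul1l. Qed.

Lemma pseudosphere_mulr I x : pseudosphere A I -> (x ** I) ** I = - x.
Proof. by move=> /pseudosphere_sqr h; rewrite -alternative_right h amulNr amul1r. Qed.

(** The element I + i of the complexification, whose left multiplication
    detects the zeros of a slice function in the plane of I. *)
Definition plus_i I : A * A := (I, aone).

(** The two components of (I + i) v are I (v.1 + I v.2) and v.1 + I v.2. *)
Lemma plus_i_mul_eq0 I v : pseudosphere A I ->
  (ACmul (plus_i I) v = 0) <-> (v.1 + I ** v.2 = 0).
Proof.
move=> hI; split=> [/(congr1 snd)|h] /=; first by rewrite amul1l addrC.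
have hv : v.1 = - (I ** v.2) by apply/eqP; rewrite -addr_eq0 h.
by apply: AC_eqE => /=; rewrite hv ?amulNr ?pseudosphere_mull // amul1l ?opprK ?subrr // addrC subrr.
Qed.

Lemma ccoord_ext v w : (forall i, ccoord i v = ccoord i w) -> v = w.
Proof.
move=> vw; apply: AC_eqE; apply: coord_ext => i;
  by move: (vw i); rewrite /ccoord => -[].
Qed.

Lemma ccoordN i v : ccoord i (- v) = - ccoord i v.
Proof. by rewrite -{1}(ACscale1 v) -ACscaleN ccoordZ mulN1r. Qed.

(** Right multiplication by an imaginary unit J squares to - 1, so that the
    complexification splits into its eigenspaces for i and - i; this is the
    projection onto the first of them, and that of - J is the projection onto the
    second. *)
Definition eigenproj J v : A * A :=
  ACscale 2^-1 (v - ACscale 'i%C (ACmul v (creal J))).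

Ltac acmod := apply: ccoord_ext => ?; rewrite ?(ccoordD, ccoordN, ccoordZ).

Lemma sqr_ImE : 'i%C * 'i%C = -1 :> R[i].
Proof. by rewrite -expr2 sqr_i. Qed.

Lemma ACmulJJ J v : pseudosphere A J -> ACmul (ACmul v (creal J)) (creal J) = - v.
Proof.
move=> hJ; apply: AC_eqE => /=;
  by rewrite !amul0r ?subr0 ?addr0 ?add0r pseudosphere_mulr.
Qed.

Lemma ACmulJN J v : ACmul v (creal (- J)) = - ACmul v (creal J).
Proof.
rewrite -ACmulNr; congr ACmul; apply: AC_eqE => //=; by rewrite oppr0.
Qed.

Lemma two_neq0 : 2 != 0 :> R[i]. Proof. by rewrite pnatr_eq0. Qed.

Lemma eigenproj_sum J v : eigenproj J v + eigenproj (- J) v = v.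
Proof.
by rewrite /eigenproj ACmulJN; acmod; field.
Qed.

Lemma eigenprojD J v w : eigenproj J (v + w) = eigenproj J v + eigenproj J w.
Proof. by rewrite /eigenproj ACmulDl; acmod; field. Qed.

Lemma eigenprojZ J c v : eigenproj J (ACscale c v) = ACscale c (eigenproj J v).
Proof. by rewrite /eigenproj ACmulZl; acmod; field. Qed.

Lemma eigenproj_mulJ J v : pseudosphere A J ->
  eigenproj J (ACmul v (creal J)) = ACscale 'i%C (eigenproj J v).
Proof.
move=> hJ; rewrite /eigenproj ACmulJJ // ACscaleA mulrC -ACscaleA.
congr ACscale; rewrite ACscaleBr (ACscaleA 'i%C 'i%C) sqr_ImE.
by rewrite ACscaleN ACscale1 ACscalevN !opprK addrC.
Qed.

Definition cline (a b : R[i]) J : A * A :=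
  ACscale a (creal aone) + ACscale b (creal J).

Lemma eigenproj_cline J a b v : pseudosphere A J ->
  eigenproj J (ACmul v (cline a b J)) = ACscale (a + 'i%C * b) (eigenproj J v).
Proof.
move=> hJ; rewrite /cline ACmulDr !ACmulZr ACmul1r eigenprojD !eigenprojZ.
by rewrite eigenproj_mulJ // ACscaleA ACscaleDl [b * _]mulrC.
Qed.

Lemma clineN a b J : cline a b J = cline a (- b) (- J).
Proof.
rewrite /cline; congr (_ + _); rewrite ACscaleN -ACscalevN; congr ACscale.
by apply: AC_eqE; rewrite /= ?opprK ?oppr0.
Qed.

Lemma eigenprojN_cline J a b v : pseudosphere A J ->
  eigenproj (- J) (ACmul v (cline a b J)) =
  ACscale (a - 'i%C * b) (eigenproj (- J) v).
Proof.
by move=> hJ; rewrite clineN eigenproj_cline ?mulrN //; exact: pseudosphereN.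
Qed.

(** A real element is the real part of twice its projection. The difference of
    two elements I + i is real, so that one projection controls all of it. *)
Lemma eigenproj_creal J x :
  ACnorm (creal x) <= 2 * ACnorm (eigenproj J (creal x)).
Proof.
have := ACnorm_creal1 (ACscale 2 (eigenproj J (creal x))).
rewrite ACnormZ normc_nat; apply: le_trans.
rewrite /eigenproj ACscaleA divff ?two_neq0 // ACscale1 /=.
by rewrite !(amul0l, amul0r) scale0r addr0 scaler0 !subr0.
Qed.

Lemma plus_i_neq0 I : 0 < ACnorm (plus_i I).
Proof.
apply: ACnorm_gt0; apply/eqP => -[_ /eqP]; by rewrite (negbTE (@aone_neq0 _ A)).
Qed.

Lemma plus_iB I J : plus_i I - plus_i J = creal (I - J).
Proof. by apply: AC_eqE; rewrite //= subrr. Qed.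

End ImaginaryUnits.

Section ZeroUniqueness.
Variables (R : realType) (A : altStarAlgType R) (mu : R).
Hypothesis mu_ge1 : 1 <= mu.
Hypothesis mu_mul : forall v w : A * A,
  ACnorm (ACmul v w) <= mu * ACnorm v * ACnorm w.
Implicit Types (I J : A) (v w : A * A).

Let mu_ge0 : 0 <= mu. Proof. exact: le_trans mu_ge1. Qed.

(** If X = I + i and X (1 + w) = 0, then X = - X w is smaller in norm than X. *)
Lemma near_one_no_zero I w :
  mu * ACnorm w < 1 -> ACmul (plus_i I) (creal aone + w) <> 0.
Proof.
move=> w1; rewrite ACmulDr ACmul1r => /eqP; rewrite addr_eq0 => /eqP h.
have := mu_mul (plus_i I) w; rewrite -ACnormN -h.
have := plus_i_neq0 I; nra.
Qed.

Lemma eigenproj_bounded J : exists K : R, 1 <= K /\ forall v,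
  ACnorm (eigenproj J v) <= K * ACnorm v /\
  ACnorm (eigenproj (- J) v) <= K * ACnorm v.
Proof.
exists (1 + mu * ACnorm (creal J)).
have m0 : 0 <= mu * ACnorm (creal J) by rewrite mulr_ge0 ?ACnorm_ge0 ?mu_ge0.
split=> [|v]; first by rewrite lerDl.
have n2 : normc (2^-1 : R[i]) = 2^-1 by rewrite Normc.normcV normc_nat.
have v0 := ACnorm_ge0 v; have hJ := mu_mul v (creal J).
rewrite /eigenproj !ACnormZ n2 ACmulJN; split.
  have := ACnormB v (ACscale 'i%C (ACmul v (creal J))).
  by rewrite ACnormZ normc_i; nra.
have := ACnormB v (ACscale 'i%C (- ACmul v (creal J))).
by rewrite ACnormZ normc_i ACnormN; nra.
Qed.

Section Estimates.
Variables (J : A) (K : R).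
Hypotheses (hJ : pseudosphere A J) (K_ge1 : 1 <= K).
Hypothesis K_proj : forall v, ACnorm (eigenproj J v) <= K * ACnorm v /\
  ACnorm (eigenproj (- J) v) <= K * ACnorm v.

Let K_ge0 : 0 <= K. Proof. exact: le_trans K_ge1. Qed.

Lemma zero_eigen_bounds I a b eta e :
  ACmul (plus_i I) (cline a b J + eta) = 0 -> ACnorm eta <= e ->
  normc (a + 'i%C * b) * ACnorm (eigenproj J (plus_i I)) <=
    K * mu * e * ACnorm (plus_i I) /\
  normc (a - 'i%C * b) * ACnorm (eigenproj (- J) (plus_i I)) <=
    K * mu * e * ACnorm (plus_i I).
Proof.
move=> h etae; set X := plus_i I.
have Xe : ACnorm (ACmul X eta) <= mu * e * ACnorm X.
  apply: le_trans (mu_mul _ _) _; rewrite mulrAC ler_wpM2r ?ACnorm_ge0 //.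
  by rewrite ler_wpM2l.
move: h; rewrite ACmulDr -/X => h.
have h1 := congr1 (eigenproj J) h; have h2 := congr1 (eigenproj (- J)) h.
have p0 J' : eigenproj J' (0 : A * A) = 0 by rewrite -(ACscale0 0) eigenprojZ !ACscale0.
move: h1 h2; rewrite !eigenprojD !p0 eigenproj_cline // eigenprojN_cline //.
move=> /eqP; rewrite addr_eq0 => /eqP /(congr1 (@ACnorm R A)).
rewrite ACnormN ACnormZ => ->.
move=> /eqP; rewrite addr_eq0 => /eqP /(congr1 (@ACnorm R A)).
rewrite ACnormN ACnormZ => ->.
have KXe := ler_wpM2l K_ge0 Xe; rewrite !mulrA in KXe.
have [k1 k2] := K_proj (ACmul X eta).
by split; [exact: le_trans k1 KXe | exact: le_trans k2 KXe].
Qed.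

Variables (c L e : R).
Let t := K * mu * e.
Hypotheses (c_gt0 : 0 < c) (e_ge0 : 0 <= e).
Hypotheses (tc : t <= c / 4) (t4 : t <= 1 / 4).
Hypothesis tKL : (2 * K + 1) * 4 * t * (L / c + 1) <= c.

Let t_ge0 : 0 <= t. Proof. by rewrite !mulr_ge0. Qed.

(** On the two eigenspaces, right multiplication by a + b J is multiplication
    by a + i b and by a - i b. When a + i b is not small, a zero puts I + i almost
    entirely into the second eigenspace, which forces a - i b to be small. *)
Lemma zero_eigen_small I a b eta :
  ACmul (plus_i I) (cline a b J + eta) = 0 -> ACnorm eta <= e ->
  c <= normc (a + 'i%C * b) ->
  [/\ ACnorm (eigenproj J (plus_i I)) <= t / c * ACnorm (plus_i I),
      3 / 4 * ACnorm (plus_i I) <= ACnorm (eigenproj (- J) (plus_i I)) &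
      normc (a - 'i%C * b) <= 2 * t].
Proof.
move=> h he hc; have [h1 h2] := zero_eigen_bounds h he.
have X0 := plus_i_neq0 I; rewrite -/t in h1 h2.
have p1 : ACnorm (eigenproj J (plus_i I)) <= t / c * ACnorm (plus_i I).
  rewrite mulrAC ler_pdivlMr // mulrC; apply: le_trans h1.
  by rewrite ler_wpM2r ?ACnorm_ge0.
have tc' : t / c <= 1 / 4 by rewrite ler_pdivrMr // mulrC mulrA mulr1.
have p2 : 3 / 4 * ACnorm (plus_i I) <= ACnorm (eigenproj (- J) (plus_i I)).
  have := ACnormD (eigenproj J (plus_i I)) (eigenproj (- J) (plus_i I)).
  by rewrite eigenproj_sum; nra.
split=> //.
have n0 := normc_ge0 (a - 'i%C * b).
have : normc (a - 'i%C * b) * (3 / 4 * ACnorm (plus_i I)) <= t * ACnorm (plus_i I).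
  by apply: le_trans h2; rewrite ler_wpM2l.
have t0 := t_ge0.
rewrite mulrA ler_pM2r //; lra.
Qed.

(** The difference of the two equations reads
    D (a1 + b1 J) + X2 ((a1 - a2) + (b1 - b2) J) + w = 0, where D = I1 - I2,
    X2 = I2 + i and w comes from the errors. The first projection bounds D by a
    small multiple of d, since X2 is almost in the kernel of that projection, and
    the second one bounds d by a small multiple of D. Both therefore vanish. *)
Lemma zero_unique I1 I2 a1 b1 a2 b2 eta1 eta2 :
  ACmul (plus_i I1) (cline a1 b1 J + eta1) = 0 ->
  ACmul (plus_i I2) (cline a2 b2 J + eta2) = 0 ->
  ACnorm eta1 <= e -> ACnorm eta2 <= e ->
  c <= normc (a1 + 'i%C * b1) -> c <= normc (a2 + 'i%C * b2) ->
  let d := (a1 - 'i%C * b1) - (a2 - 'i%C * b2) in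
  normc ((a1 + 'i%C * b1) - (a2 + 'i%C * b2)) <= L * normc d ->
  ACnorm (eta1 - eta2) <= e * normc d ->
  I1 = I2 /\ d = 0.
Proof.
move=> z1 z2 e1 e2 c1 c2 d dp de.
have [p1 q1 r1] := zero_eigen_small z1 e1 c1.
have [p2 q2 r2] := zero_eigen_small z2 e2 c2.
have X0 := plus_i_neq0 I2.
set X2 := plus_i I2 in p2 q2 X0 z2 *.
pose D : A * A := creal (I1 - I2).
have XD : plus_i I1 = D + X2 by rewrite /D -plus_iB subrK.
pose w := ACmul D eta1 + ACmul X2 (eta1 - eta2).
have t0 := t_ge0.
have wle : K * ACnorm w <= t * ACnorm D + t * (ACnorm X2 * normc d).
  have h1 := mu_mul D eta1; have h2 := mu_mul X2 (eta1 - eta2).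
  have : ACnorm w <= mu * e * ACnorm D + mu * e * (ACnorm X2 * normc d).
    apply: le_trans (ACnormD _ _) _; apply: lerD.
      apply: le_trans h1 _; rewrite mulrAC ler_wpM2r ?ACnorm_ge0 //.
      by rewrite ler_wpM2l.
    apply: le_trans h2 _; rewrite -!mulrA ler_wpM2l //.
    by rewrite mulrCA ler_wpM2l ?ACnorm_ge0.
  by move=> h; have := ler_wpM2l (le_trans ler01 K_ge1) h; rewrite /t mulrDr !mulrA.
have eqD : ACmul D (cline a1 b1 J) + ACmul X2 (cline (a1 - a2) (b1 - b2) J) + w = 0.
  have <- : ACmul (plus_i I1) (cline a1 b1 J + eta1) -
            ACmul X2 (cline a2 b2 J + eta2) = 0 by rewrite z1 z2 subrr.
  have -> : cline (a1 - a2) (b1 - b2) J = cline a1 b1 J - cline a2 b2 J.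
    by rewrite /cline !ACscaleBl opprD addrACA.
  rewrite XD /w !(ACmulDl, ACmulDr, ACmulNr).
  by apply: ccoord_ext => i; rewrite !(ccoordD, ccoordN); ring.
clearbody w.
have p0 J' : eigenproj J' (0 : A * A) = 0.
  by rewrite -(ACscale0 0) eigenprojZ !ACscale0.
have [Kw Kw'] := K_proj w.
have dE (x1 y1 x2 y2 : R[i]) : (x1 - x2) + 'i%C * (y1 - y2) = (x1 + 'i%C * y1) - (x2 + 'i%C * y2).
  by ring.
have dE' (x1 y1 x2 y2 : R[i]) : (x1 - x2) - 'i%C * (y1 - y2) = (x1 - 'i%C * y1) - (x2 - 'i%C * y2).
  by ring.
have [dK [dK' D2]] : ACnorm (eigenproj J D) <= K * ACnorm D /\
    ACnorm (eigenproj (- J) D) <= K * ACnorm D /\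
    ACnorm D <= 2 * ACnorm (eigenproj J D).
  by have [? ?] := K_proj D; do !split => //; exact: eigenproj_creal.
have Eplus : c * ACnorm (eigenproj J D) <=
    L * normc d * (t / c * ACnorm X2) + K * ACnorm w.
  have := congr1 (eigenproj J) eqD.
  rewrite !eigenprojD !eigenproj_cline // dE p0 -addrA => /eqP.
  rewrite addr_eq0 => /eqP /(congr1 (@ACnorm R A)); rewrite ACnormN ACnormZ => h.
  apply: (@le_trans _ _ (normc (a1 + 'i%C * b1) * ACnorm (eigenproj J D))).
    by rewrite ler_wpM2r ?ACnorm_ge0.
  rewrite h; apply: le_trans (ACnormD _ _) _; apply: lerD => //.
  by rewrite ACnormZ ler_pM ?normc_ge0 ?ACnorm_ge0.
have Eminus : normc d * (3 / 4 * ACnorm X2) <= 2 * t * (K * ACnorm D) + K * ACnorm w.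
  have := congr1 (eigenproj (- J)) eqD.
  rewrite !eigenprojD !eigenprojN_cline // dE' p0 -/d addrAC => /eqP.
  rewrite addrC addr_eq0 => /eqP /(congr1 (@ACnorm R A)); rewrite ACnormN ACnormZ => h.
  apply: (@le_trans _ _ (normc d * ACnorm (eigenproj (- J) X2))).
    by rewrite ler_wpM2l ?normc_ge0.
  rewrite h; apply: le_trans (ACnormD _ _) _; apply: lerD => //.
  by rewrite ACnormZ ler_pM ?normc_ge0 ?ACnorm_ge0.
pose p := L / c + 1.
have h1 : ACnorm D * (c / 4) <= t * p * (ACnorm X2 * normc d).
  have -> : t * p * (ACnorm X2 * normc d) =
    L * normc d * (t / c * ACnorm X2) + t * (ACnorm X2 * normc d).
    by rewrite /p; field; rewrite gt_eqF.
  have := ler_wpM2r (ltW c_gt0) D2.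
  have : t * ACnorm D <= c / 4 * ACnorm D by rewrite ler_wpM2r ?ACnorm_ge0.
  by move: Eplus wle; lra.
have h2 : 3 / 4 * (ACnorm X2 * normc d) <=
    (2 * K + 1) * t * ACnorm D + t * (ACnorm X2 * normc d).
  by move: Eminus wle; lra.
have xd0 : 0 <= ACnorm X2 * normc d by rewrite mulr_ge0 ?normc_ge0 ?ACnorm_ge0.
have h3 : (2 * K + 1) * t * ACnorm D * c <= t * c * (ACnorm X2 * normc d).
  have K1 : 0 <= (2 * K + 1) * t by rewrite mulr_ge0 // addr_ge0 // mulr_ge0.
  have := ler_wpM2l K1 h1.
  have := ler_wpM2r xd0 (ler_wpM2l t_ge0 tKL); rewrite -/p.
  by lra.
have h4 : (2 * K + 1) * t * ACnorm D <= t * (ACnorm X2 * normc d).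
  by rewrite -(ler_pM2r c_gt0); apply: le_trans h3 _; rewrite mulrAC.
have h5 : t * (ACnorm X2 * normc d) <= 1 / 4 * (ACnorm X2 * normc d) by rewrite ler_wpM2r.
have xd : ACnorm X2 * normc d = 0 by apply/eqP; rewrite eq_le xd0 andbT; lra.
have d0 : d = 0.
  by apply/eqP; move/eqP: xd; rewrite mulf_eq0 (gt_eqF X0) normc_eq0.
split=> //; move: h1; rewrite xd mulr0 => h1.
have D0 : ACnorm D = 0.
  apply/eqP; rewrite eq_le ACnorm_ge0 andbT.
  by rewrite -(pmulr_lle0 _ (_ : 0 < c / 4)) ?divr_gt0.
by have [/eqP] := ACnorm_eq0 D0; rewrite subr_eq0 => /eqP.
Qed.

End Estimates.

(** The two previous estimates with one threshold for the errors, which depends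
    on the unit J, on the lower bound c and on the Lipschitz constant L only. *)
Lemma perturbed_zero_unique J c L : pseudosphere A J -> 0 < c -> 0 <= L ->
  exists e : R, 0 < e /\ (forall I a b eta,
    ACmul (plus_i I) (cline a b J + eta) = 0 -> ACnorm eta <= e ->
    c <= normc (a + 'i%C * b) -> normc (a - 'i%C * b) <= 1 / 2) /\
  (forall I1 I2 a1 b1 a2 b2 eta1 eta2,
    ACmul (plus_i I1) (cline a1 b1 J + eta1) = 0 ->
    ACmul (plus_i I2) (cline a2 b2 J + eta2) = 0 ->
    ACnorm eta1 <= e -> ACnorm eta2 <= e ->
    c <= normc (a1 + 'i%C * b1) -> c <= normc (a2 + 'i%C * b2) ->
    let d := (a1 - 'i%C * b1) - (a2 - 'i%C * b2) in
    normc ((a1 + 'i%C * b1) - (a2 + 'i%C * b2)) <= L * normc d ->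
    ACnorm (eta1 - eta2) <= e * normc d ->
    I1 = I2 /\ d = 0).
Proof.
move=> hJ c0 L0; have [K [K1 hK]] := eigenproj_bounded J.
have K0 : 0 < K by exact: lt_le_trans K1.
have mu0 : 0 < mu by exact: lt_le_trans mu_ge1.
have p0 : 0 < L / c + 1 by rewrite ltr_wpDl // divr_ge0 // ltW.
pose t := Num.min (Num.min (c / 4) (1 / 4)) (c / ((2 * K + 1) * 4 * (L / c + 1))).
have k0 : 0 < (2 * K + 1) * 4 * (L / c + 1) by rewrite !mulr_gt0 // addr_gt0 // mulr_gt0.
have t0 : 0 < t by rewrite !lt_min !divr_gt0.
have tE : K * mu * (t / (K * mu)) = t by field; rewrite !gt_eqF.
have tc : t <= c / 4 by rewrite !ge_min lexx.
have t4 : t <= 1 / 4 by rewrite !ge_min lexx orbT.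
have tK : (2 * K + 1) * 4 * t * (L / c + 1) <= c.
  rewrite [X in X <= _](_ : _ = t * ((2 * K + 1) * 4 * (L / c + 1))); last by ring.
  by rewrite -ler_pdivlMr // !ge_min lexx orbT.
rewrite -tE in tc t4 tK; move: tc t4 tK tE; set e := t / (K * mu) => tc t4 tK tE.
have e0 : 0 < e by rewrite divr_gt0 // mulr_gt0.
exists e; split=> //; split=> [I a b eta h1 h2 h3|].
  have [_ _] := zero_eigen_small hJ K1 hK c0 (ltW e0) tc h1 h2 h3.
  by move: t4; lra.
move=> I1 I2 a1 b1 a2 b2 eta1 eta2.
exact: (zero_unique hJ K1 hK c0 (ltW e0) tc t4 tK).
Qed.

End ZeroUniqueness.

(** * Complex derivatives and Lipschitz bounds *)

(** Complex scalars and elements of the complexified algebra, under its own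
    norm, are the two instances that are used: functions of both kinds are bounded
    and differentiated by the same lemmas. *)
Record cnormed (R : realType) := CNormed {
  csort :> zmodType;
  cnorm : csort -> R;
  cact : R[i] -> csort -> csort;
  cnormD : forall v w, cnorm (v + w) <= cnorm v + cnorm w;
  cnormN : forall v, cnorm (- v) = cnorm v;
  cactDr : forall c v w, cact c (v + w) = cact c v + cact c w;
  cactDl : forall c d v, cact (c + d) v = cact c v + cact d v;
  cactA : forall c d v, cact c (cact d v) = cact (c * d) v;
  cnorm_act : forall c v, cnorm (cact c v) = normc c * cnorm v;
  cconj : csort -> csort;
  cconjD : forall v w, cconj (v + w) = cconj v + cconj w;
  cconj_act : forall c v, cconj (cact c v) = cact c^* (cconj v);
  cnorm_conj : forall v, cnorm (cconj v) = cnorm v }.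

Section CNormedTheory.
Variables (R : realType) (V : cnormed R).
Implicit Types (v w : V) (c d : R[i]).

Lemma cact0 c : cact c (0 : V) = 0.
Proof. by apply: (addrI (cact c 0)); rewrite -cactDr !addr0. Qed.

Lemma cact0l v : cact 0 v = 0.
Proof. by apply: (addrI (cact 0 v)); rewrite -cactDl !addr0. Qed.

Lemma cactNr c v : cact c (- v) = - cact c v.
Proof. by apply: (addrI (cact c v)); rewrite -cactDr !subrr cact0. Qed.

Lemma cactNl c v : cact (- c) v = - cact c v.
Proof. by apply: (addrI (cact c v)); rewrite -cactDl !subrr cact0l. Qed.

Lemma cactBr c v w : cact c (v - w) = cact c v - cact c w.
Proof. by rewrite cactDr cactNr. Qed.

Lemma cactBl c d v : cact (c - d) v = cact c v - cact d v.
Proof. by rewrite cactDl cactNl. Qed.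

Lemma cnorm0 : cnorm (0 : V) = 0.
Proof. by rewrite -(cact0l 0) cnorm_act Normc.normc0 mul0r. Qed.

Lemma cnorm_ge0 v : 0 <= cnorm v.
Proof.
have := cnormD v (- v); rewrite subrr cnorm0 cnormN.
lra.
Qed.

(** One constant serves as bound and as Lipschitz constant. A series of
    holomorphic functions whose constants decrease geometrically can be
    differentiated term by term; such estimates, which are elementary for rational
    functions, stand in for those of Cauchy. *)
Definition tame (U : set R[i]) (B : R) (h : R[i] -> V) : Prop :=
  (forall z, U z -> cnorm (h z) <= B) /\
  (forall z z', U z -> U z' -> cnorm (h z - h z') <= B * normc (z - z')).

Lemma tame_le U B B' h : B <= B' -> tame U B h -> tame U B' h.
Proof.
move=> BB' [h1 h2]; split=> [z Uz|z z' Uz Uz']; first exact: le_trans (h1 _ Uz) _.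
by apply: le_trans (h2 _ _ Uz Uz') _; rewrite ler_wpM2r ?normc_ge0.
Qed.

Lemma tame_cst U (v : V) : tame U (cnorm v) (fun=> v).
Proof.
split=> // z z' _ _; rewrite subrr cnorm0.
by rewrite mulr_ge0 ?cnorm_ge0 ?normc_ge0.
Qed.

Lemma tameD U B1 B2 h1 h2 :
  tame U B1 h1 -> tame U B2 h2 -> tame U (B1 + B2) (fun z => h1 z + h2 z).
Proof.
move=> [a1 b1] [a2 b2]; split=> [z Uz|z z' Uz Uz'].
  by apply: le_trans (cnormD _ _) _; apply: lerD; [exact: a1|exact: a2].
rewrite opprD addrACA mulrDl; apply: le_trans (cnormD _ _) _.
by apply: lerD; [exact: b1|exact: b2].
Qed.

(** The additive identity behind the product rule: p, q, r and s are the four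
    products of values of the factors at two points, and t and u the two terms of
    the derivative. *)
Lemma leibniz_split (p q r s t u : V) :
  p - s - (t + u) = (q - s - t) + (r - s - u) + ((p - q) - (r - s)).
Proof.
rewrite !opprB !opprD.
rewrite [RHS](AC ((2*1)*(2*1)*(2*2)) (((7*2)*(3*6))*((1*8)*(4*10)*(5*9)))) /=.
by rewrite !subrr addNr !addr0.
Qed.

Definition cderivable (h : R[i] -> V) (z : R[i]) (L : V) : Prop :=
  forall e : R, 0 < e -> exists2 d : R, 0 < d &
    forall k, normc k < d -> cnorm (h (z + k) - h z - cact k L) <= e * normc k.

Lemma cderivable_cst z (v : V) : cderivable (fun=> v) z 0.
Proof.
move=> e e0; exists 1 => // k _; rewrite cact0 !subrr cnorm0.
by rewrite mulr_ge0 ?normc_ge0 // ltW.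
Qed.

Lemma cderivableD h1 h2 z L1 L2 : cderivable h1 z L1 -> cderivable h2 z L2 ->
  cderivable (fun z => h1 z + h2 z) z (L1 + L2).
Proof.
move=> d1 d2 e e0; have e2 : 0 < e / 2 by rewrite divr_gt0.
have [x1 x10 h1P] := d1 _ e2; have [x2 x20 h2P] := d2 _ e2.
exists (Num.min x1 x2) => [|k]; first by rewrite lt_min x10.
rewrite lt_min => /andP[kx1 kx2].
rewrite [X in cnorm X](_ : _ = (h1 (z + k) - h1 z - cact k L1) +
  (h2 (z + k) - h2 z - cact k L2)); last first.
  by rewrite cactDr !opprD (AC (2*2*2) ((1*3*5)*(2*4*6))).
by apply: le_trans (cnormD _ _) _; have := h1P _ kx1; have := h2P _ kx2; lra.
Qed.

Lemma cconjN v : cconj (- v) = - cconj v.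
Proof.
have c0 : cconj (0 : V) = 0 by apply: (addrI (cconj 0)); rewrite -cconjD !addr0.
by apply: (addrI (cconj v)); rewrite -cconjD !subrr.
Qed.

Lemma tame_star (U : set R[i]) B (h : R[i] -> V) :
  tame [set z | U z^*] B h -> tame U B (fun z => cconj (h z^*)).
Proof.
move=> [a b]; split=> [z Uz|z z' Uz Uz'] /=.
  by rewrite cnorm_conj; apply: a; rewrite /= conjcK.
rewrite -cconjN -cconjD cnorm_conj -(normc_conj (z - z')) rmorphB.
by apply: b; rewrite /= conjcK.
Qed.

Lemma cderivable_star (h : R[i] -> V) z L :
  cderivable h z^* L -> cderivable (fun z => cconj (h z^*)) z (cconj L).
Proof.
move=> dh e e0; have [d d0 hP] := dh e e0; exists d => // k kd.
have := hP k^*; rewrite normc_conj => /(_ kd).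
by rewrite -cnorm_conj !cconjD !cconjN cconj_act conjcK rmorphD.
Qed.

End CNormedTheory.

Section Scalars.
Variable R : realType.

Definition scalars : cnormed R := @CNormed R R[i] (@Normc.normc R) *%R
  (@normcD_le R) (@normc_opp R) (@mulrDr R[i]) (fun c d v => mulrDl c d v)
  (@mulrA R[i]) (@Normc.normcM R) (@conjc R) (fun v w => rmorphD _ v w)
  (fun c v => rmorphM _ c v) (@normc_conj R).

Lemma tame_act (V : cnormed R) U B1 B2 (c : R[i] -> scalars) (h : R[i] -> V) :
  0 <= B1 -> 0 <= B2 -> tame U B1 c -> tame U B2 h ->
  tame U (2 * B1 * B2) (fun z => cact (c z) (h z)).
Proof.
move=> B10 B20 [a1 b1] [a2 b2].
have BB : 0 <= B1 * B2 by rewrite mulr_ge0.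
split=> [z Uz|z z' Uz Uz'].
  rewrite cnorm_act; have := ler_pM (normc_ge0 _) (cnorm_ge0 _) (a1 z Uz) (a2 z Uz).
  by rewrite /=; lra.
have -> : cact (c z) (h z) - cact (c z') (h z') =
    cact (c z) (h z - h z') + cact (c z - c z') (h z').
  by rewrite cactBr cactBl addrA subrK.
apply: le_trans (cnormD _ _) _; rewrite !cnorm_act.
have := ler_pM (normc_ge0 _) (cnorm_ge0 _) (a1 z Uz) (b2 z z' Uz Uz').
have := ler_pM (normc_ge0 _) (cnorm_ge0 _) (b1 z z' Uz Uz') (a2 z' Uz').
rewrite /=; lra.
Qed.

Lemma tame_inv U rho b : 0 < rho -> (forall z, U z -> rho <= normc (z - b)) ->
  @tame R scalars U (rho^-1 + rho^-1 ^+ 2) (fun z => (z - b)^-1).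
Proof.
move=> r0 Ub; have ri : 0 < rho^-1 by rewrite invr_gt0.
have inv_le z : U z -> normc ((z - b)^-1) <= rho^-1.
  move=> Uz; rewrite Normc.normcV lef_pV2 ?posrE //; first exact: Ub.
  exact: lt_le_trans r0 (Ub _ Uz).
split=> [z Uz|z z' Uz Uz'] /=.
  by apply: le_trans (inv_le _ Uz) _; rewrite lerDl sqr_ge0.
have nz x : U x -> x - b != 0.
  by move=> Ux; rewrite -normc_gt0; exact: lt_le_trans r0 (Ub _ Ux).
have -> : (z - b)^-1 - (z' - b)^-1 = - ((z - z') * ((z - b)^-1 * (z' - b)^-1)).
  by field; rewrite !nz.
rewrite normc_opp !Normc.normcM mulrC ler_wpM2r ?normc_ge0 //.
apply: (@le_trans _ _ (rho^-1 * rho^-1)).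
  by rewrite ler_pM ?normc_ge0 ?inv_le.
by rewrite expr2 lerDr ltW.
Qed.

Lemma cderivable_act (V : cnormed R) (c : R[i] -> scalars) (h : R[i] -> V) z
    (c' : scalars) (L : V) : cderivable c z c' -> cderivable h z L ->
  cderivable (fun z => cact (c z) (h z)) z (cact (c z) L + cact c' (h z)).
Proof.
move=> dc dh e e0.
pose M := 1 + normc (c z) + normc c' + cnorm (h z) + cnorm L.
have [n1 n2 n3 n4] := And4 (normc_ge0 (c z)) (normc_ge0 c') (cnorm_ge0 (h z))
  (cnorm_ge0 L).
have M0 : 1 <= M by rewrite /M; lra.
have [Mc Mc' Mh ML] : [/\ normc (c z) <= M, normc c' <= M, cnorm (h z) <= M
  & cnorm L <= M] by split; rewrite /M; lra.
have Mp : 0 < M by apply: lt_le_trans M0.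
pose f := Num.min 1 (e / (6 * M ^+ 2)).
have f0 : 0 < f by rewrite lt_min ltr01 divr_gt0 ?mulr_gt0 ?exprn_gt0.
have fe : f * (6 * M ^+ 2) <= e.
  by rewrite -ler_pdivlMr ?mulr_gt0 ?exprn_gt0 // ge_min lexx orbT.
have f1 : f <= 1 by rewrite ge_min lexx.
clearbody f.
have [x1 x10 cP] := dc _ f0; have [x2 x20 hP] := dh _ f0.
exists (Num.min (Num.min x1 x2) f) => [|k]; first by rewrite !lt_min x10 x20 f0.
rewrite !lt_min => /andP[/andP[/cP ck /hP hk] kf].
set C := c (z + k) - c z - cact k c' in ck.
set H := h (z + k) - h z - cact k L in hk.
have k0 := normc_ge0 k.
have Hn : cnorm (h (z + k) - h z) <= (f + M) * normc k.
  have -> : h (z + k) - h z = H + cact k L by rewrite subrK.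
  apply: le_trans (cnormD _ _) _; rewrite cnorm_act mulrDl; apply: lerD => //.
  by rewrite mulrC ler_wpM2r.
have Cn : normc (c (z + k) - c z) <= (f + M) * normc k.
  have -> : c (z + k) - c z = C + k * c' by rewrite subrK.
  apply: le_trans (normcD_le _ _) _; rewrite Normc.normcM mulrDl; apply: lerD => //.
  by rewrite mulrC ler_wpM2r.
have -> : cact (c (z + k)) (h (z + k)) - cact (c z) (h z) -
    cact k (cact (c z) L + cact c' (h z)) =
    cact (c z) H + cact C (h z) + cact (c (z + k) - c z) (h (z + k) - h z).
  rewrite /H /C !(cactBr, cactBl, cactDr) !cactA [k * c z]mulrC.
  rewrite (_ : cact k c' = k * c') //.
  exact: leibniz_split.
apply: le_trans (cnormD _ _) _; rewrite cnorm_act.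
apply: (@le_trans _ _ (M * (f * normc k) + (f * normc k) * M +
   ((f + M) * normc k) * ((f + M) * normc k))).
  apply: lerD.
    apply: le_trans (cnormD _ _) _; rewrite !cnorm_act.
    by apply: lerD; apply: ler_pM; rewrite ?normc_ge0 ?cnorm_ge0.
  by apply: ler_pM; rewrite ?normc_ge0 ?cnorm_ge0.
have g1 : (f + M) * normc k * ((f + M) * normc k) <= (2 * M) ^+ 2 * (f * normc k).
  have fM : 0 <= f + M by lra.
  rewrite mulrACA; apply: ler_pM; [exact: mulr_ge0 | exact: mulr_ge0 | |].
    by rewrite expr2; apply: ler_pM => //; lra.
  by rewrite ler_wpM2r // ltW.
have g2 : M * (f * normc k) <= M ^+ 2 * (f * normc k).
  have fk : 0 <= f * normc k by apply: mulr_ge0 => //; exact: ltW.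
  by apply: ler_wpM2r => //; rewrite expr2 ler_peMr // ltW.
have := ler_wpM2r k0 fe.
by rewrite exprMn in g1; move: g1 g2; lra.
Qed.

Lemma cderivable_inv (b z : R[i]) : z != b ->
  @cderivable R scalars (fun z => (z - b)^-1) z (- ((z - b)^-1 ^+ 2)).
Proof.
move=> zb e e0; have zb0 : z - b != 0 by rewrite subr_eq0.
pose m := normc (z - b); have m0 : 0 < m by rewrite normc_gt0.
exists (Num.min (m / 2) (e * m ^+ 3 / 2)) => [|k].
  by rewrite lt_min !divr_gt0 // mulr_gt0 // exprn_gt0.
rewrite lt_min => /andP[k1 k2] /=.
have zk : m / 2 <= normc (z + k - b).
  have := normcB_ge (z - b) (- k); rewrite opprK addrAC normc_opp -/m; lra.
have zk0 : z + k - b != 0 by rewrite -normc_gt0; apply: lt_le_trans zk; rewrite divr_gt0.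
rewrite [X in normc X](_ : _ = k * k * ((z - b)^-1 ^+ 2 * (z + k - b)^-1)); last first.
  by field; rewrite zk0 zb0.
rewrite !(normcX, Normc.normcM, Normc.normcV) -/m -mulrA mulrC.
rewrite ler_wpM2r ?normc_ge0 //.
apply: (@le_trans _ _ (normc k * ((m^-1) ^+ 2 * (m / 2)^-1))).
  apply: ler_wpM2l; first exact: normc_ge0.
  apply: ler_wpM2l; first by rewrite exprn_ge0 // invr_ge0 ltW.
  by rewrite lef_pV2 // posrE ?divr_gt0 // normc_gt0.
rewrite [X in _ * X](_ : _ = 2 / m ^+ 3); last by field; rewrite gt_eqF.
rewrite mulrA ler_pdivrMr ?exprn_gt0 //.
by move: k2; lra.
Qed.

End Scalars.

(** * Limits of sequences with geometric increments *)

Lemma subrACA (V : zmodType) (a b c d : V) : a - b - (c - d) = a - c - (b - d).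
Proof. by rewrite !opprB [LHS](AC (2*2) ((1*4)*(3*2))). Qed.

Section VectorInstance.
Variables (R : realType) (A : altStarAlgType R).

Definition vectors : cnormed R := @CNormed R (A * A)%type (@ACnorm R A)
  (@ACscale R A) (@ACnormD R A) (@ACnormN R A) (@ACscaleDr R A) (@ACscaleDl R A)
  (@ACscaleA R A) (@ACnormZ R A) (@ACconj R A) (@ACconjD R A) (@ACconjZ R A)
  (@ACnorm_conj R A).

Lemma tame_limit_diff U C (h : nat -> R[i] -> vectors) (l : R[i] -> vectors)
    (K : R[i] -> R) :
  (forall n, tame U (C / 2 ^+ n) (fun z => h n.+1 z - h n z)) ->
  (forall z, U z -> forall n, ACnorm (l z - h n z) <= K z / 2 ^+ n) ->
  forall n, tame U (2 * C / 2 ^+ n) (fun z => l z - h n z).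
Proof.
move=> th lh n.
have dom (a : nat -> A * A) (l1 : A * A) (K1 B : R) :
    (forall k, ACnorm (l1 - a k) <= K1 / 2 ^+ k) ->
    (forall k, ACnorm (a k.+1 - a k) <= B / 2 ^+ k) ->
    ACnorm (l1 - a n) <= 2 * B / 2 ^+ n.
  move=> la da; have B0 : 0 <= B.
    by have := le_trans (ACnorm_ge0 _) (da 0%N); rewrite expr0 divr1.
  apply: (@geometric_limit_le R A (fun k => a k - a n) K1 _ _ n).
    by move=> k; rewrite opprB addrA subrK.
  move=> k nk; apply: le_trans
    (geometric_telescope (n := @ACnorm R A) (@ACnormD R A) (@ACnorm0 R A) da nk) _.
  by rewrite lerBlDr lerDl divr_ge0 ?exprn_ge0 ?mulr_ge0.
split=> [z Uz|z z' Uz Uz'].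
  apply: (dom (fun k => h k z) _ _ _ (lh z Uz)) => k.
  by have [+ _] := th k; apply.
have -> : 2 * C / 2 ^+ n * normc (z - z') = 2 * (C * normc (z - z')) / 2 ^+ n.
  by rewrite -!mulrA [normc _ / _]mulrC.
rewrite subrACA.
have := dom (fun k => h k z - h k z') (l z - l z') (K z + K z') (C * normc (z - z')).
apply.
  move=> k; rewrite subrACA mulrDl; apply: le_trans (ACnormB _ _) _.
  by apply: lerD; exact: lh.
move=> k; rewrite subrACA mulrAC; have [_] := th k; exact.
Qed.

(** The Lipschitz constant of [h n.+1 - h n] also bounds the difference of the
    derivatives, which therefore converge; the tame bound on [l - h n] compares the
    difference quotients of [l] with those of [h n]. *)
Lemma cderivable_limit (U : set R[i]) C (h : nat -> R[i] -> vectors)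
    (l : R[i] -> vectors) (K : R[i] -> R) z r :
  0 < r -> (forall z', normc (z' - z) < r -> U z') ->
  (forall n, tame U (C / 2 ^+ n) (fun z => h n.+1 z - h n z)) ->
  (forall z, U z -> forall n, ACnorm (l z - h n z) <= K z / 2 ^+ n) ->
  (forall n, exists L, cderivable (h n) z L) ->
  exists L, cderivable l z L.
Proof.
move=> r0 zU th lh /choice[L hL].
have Uz : U z by apply: zU; rewrite subrr Normc.normc0.
have small_real e : 0 < e -> exists2 k : R[i], 0 < normc k & normc k < e.
  move=> e0; exists ((e / 2)%:C); rewrite normc_real gtr0_norm ?divr_gt0 //.
  by rewrite ltr_pdivrMr // ltr_pMr // ltr1n.
have LC n : ACnorm (L n.+1 - L n) <= C / 2 ^+ n.
  rewrite leNgt; apply/negP => lt.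
  pose e := (ACnorm (L n.+1 - L n) - C / 2 ^+ n) / 3.
  have e0 : 0 < e by rewrite divr_gt0 // subr_gt0.
  have [d1 d10 h1] := hL n.+1 _ e0; have [d2 d20 h2] := hL n _ e0.
  have [|k k0] := small_real (Num.min (Num.min d1 d2) r).
    by rewrite !lt_min d10 d20.
  rewrite !lt_min => /andP[/andP[/h1 k1 /h2 k2] kr].
  have Uzk : U (z + k) by apply: zU; rewrite addrC addKr.
  have [_ /(_ _ _ Uzk Uz)] := th n.
  rewrite [z + k - z]addrC addKr subrACA => k3.
  have : ACnorm (ACscale k (L n.+1 - L n)) <= (C / 2 ^+ n + 2 * e) * normc k.
    have -> : ACscale k (L n.+1 - L n) =
      (h n.+1 (z + k) - h n.+1 z - (h n (z + k) - h n z)) -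
      ((h n.+1 (z + k) - h n.+1 z - ACscale k (L n.+1)) -
       (h n (z + k) - h n z - ACscale k (L n))).
      by rewrite ACscaleBr [X in _ = _ - X]subrACA subKr.
    apply: le_trans (ACnormB _ _) _; have := ACnormB
      (h n.+1 (z + k) - h n.+1 z - ACscale k (L n.+1))
      (h n (z + k) - h n z - ACscale k (L n)).
    by move: k1 k2 k3 => /=; lra.
  rewrite ACnormZ mulrC ler_pM2r // /e; lra.
have [M hM] := geometric_cvg LC.
exists M => e e0; have e3 : 0 < e / 3 by rewrite divr_gt0.
have [n nP] := geometric_small (2 * C) e3.
have [d d0 hd] := hL n _ e3.
exists (Num.min d r) => [|k]; first by rewrite lt_min d0.
rewrite lt_min => /andP[/hd k1 kr].
have Uzk : U (z + k) by apply: zU; rewrite addrC addKr.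
have [_ /(_ _ _ Uzk Uz)] := tame_limit_diff th lh n.
rewrite [z + k - z]addrC addKr subrACA => k3.
have k0 := normc_ge0 k.
rewrite [X in cnorm X](_ : _ = (l (z + k) - l z - (h n (z + k) - h n z)) +
    (h n (z + k) - h n z - cact k (L n)) - ACscale k (M - L n)); last first.
  by rewrite ACscaleBr addrA subrK opprB addrA subrK.
apply: le_trans (ACnormB _ _) _; rewrite ACnormZ.
have : normc k * ACnorm (M - L n) <= normc k * (e / 3).
  by rewrite ler_wpM2l //; apply: le_trans (hM n) (ltW nP).
have := ler_wpM2r k0 (ltW nP).
have := ACnormD (l (z + k) - l z - (h n (z + k) - h n z))
  (h n (z + k) - h n z - cact k (L n)).
by move: k1 k3 => /=; lra.
Qed.

End VectorInstance.

Section Families.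
Variables (R : realType) (U : set R[i]).

Definition bounded_family (V : cnormed R) (h : nat -> R[i] -> V) :=
  exists2 C : R, 0 <= C & forall n, tame U C (h n).

Definition small_family (V : cnormed R) (h : nat -> R[i] -> V) :=
  exists2 C : R, 0 <= C & forall n, tame U (C / 2 ^+ n) (h n).

Lemma small_bounded (V : cnormed R) (h : nat -> R[i] -> V) : small_family h -> bounded_family h.
Proof.
move=> [C C0 hC]; exists C => // n; apply: tame_le (hC n).
by rewrite ler_pdivrMr ?exprn_gt0 // ler_peMr // exprn_ege1 // ler1n.
Qed.

Lemma bounded_familyD (V : cnormed R) (h1 h2 : nat -> R[i] -> V) :
  bounded_family h1 -> bounded_family h2 ->
  bounded_family (fun n z => h1 n z + h2 n z).
Proof.
move=> [C C0 h] [D D0 k]; exists (C + D) => [|n]; first exact: addr_ge0.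
exact: tameD.
Qed.

Lemma small_familyD (V : cnormed R) (h1 h2 : nat -> R[i] -> V) :
  small_family h1 -> small_family h2 ->
  small_family (fun n z => h1 n z + h2 n z).
Proof.
move=> [C C0 h] [D D0 k]; exists (C + D) => [|n]; first exact: addr_ge0.
by rewrite mulrDl; exact: tameD.
Qed.

Lemma bounded_family_act (V : cnormed R) (c : nat -> R[i] -> scalars R) (h : nat -> R[i] -> V) :
  bounded_family c -> bounded_family h ->
  bounded_family (fun n z => cact (c n z) (h n z)).
Proof.
move=> [C C0 hc] [D D0 k]; exists (2 * C * D) => [|n]; first by rewrite !mulr_ge0.
exact: tame_act.
Qed.

Lemma small_family_actl (V : cnormed R) (c : nat -> R[i] -> scalars R) (h : nat -> R[i] -> V) :
  small_family c -> bounded_family h ->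
  small_family (fun n z => cact (c n z) (h n z)).
Proof.
move=> [C C0 hc] [D D0 k]; exists (2 * C * D) => [|n]; first by rewrite !mulr_ge0.
have -> : 2 * C * D / 2 ^+ n = 2 * (C / 2 ^+ n) * D by rewrite -!mulrA [D / _]mulrC.
by apply: tame_act => //; rewrite divr_ge0 ?exprn_ge0.
Qed.

Lemma small_family_actr (V : cnormed R) (c : nat -> R[i] -> scalars R) (h : nat -> R[i] -> V) :
  bounded_family c -> small_family h ->
  small_family (fun n z => cact (c n z) (h n z)).
Proof.
move=> [C C0 hc] [D D0 k]; exists (2 * C * D) => [|n]; first by rewrite !mulr_ge0.
rewrite -!mulrA mulrA; apply: tame_act => //; by rewrite divr_ge0 ?exprn_ge0.
Qed.

Lemma bounded_family_cst (V : cnormed R) (v : V) : bounded_family (fun _ _ => v).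
Proof. by exists (cnorm v) => [|n]; [exact: cnorm_ge0|exact: tame_cst]. Qed.

Lemma small_family_cst (V : cnormed R) (v : nat -> V) (C : R) :
  (forall n, cnorm (v n) <= C / 2 ^+ n) -> small_family (fun n _ => v n).
Proof.
move=> vC; exists C => [|n].
  by have := le_trans (cnorm_ge0 _) (vC 0%N); rewrite expr0 divr1.
exact: tame_le (vC n) (tame_cst _ _).
Qed.

(** p q - 1 = (p - 1) + (q - 1) + (p - 1) (q - 1). *)
Lemma small_family_mul_near1 (p q : nat -> R[i] -> scalars R) :
  small_family (fun n z => p n z - 1) -> small_family (fun n z => q n z - 1) ->
  small_family (fun n z => (p n z * q n z - 1 : scalars R)).
Proof.
move=> sp sq.
have := small_familyD (small_familyD sp sq) (small_family_actl sp (small_bounded sq)).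
congr (small_family _); apply/funext => n; apply/funext => z; rewrite /=; ring.
Qed.

End Families.

(** * The local model of a zero *)

Section LocalModel.
Variables (R : realType) (A : altStarAlgType R) (mu : R).
Hypothesis mu_ge1 : 1 <= mu.
Hypothesis mu_mul : forall v w : A * A,
  ACnorm (ACmul v w) <= mu * ACnorm v * ACnorm w.
Implicit Types (I J : A) (v w : A * A) (s : R[i]).

(** The line 1 + s^2 + 3 i s J has the eigenvalues 1 + s^2 - 3 s and
    1 + s^2 + 3 s. Where the first is not small, a zero makes the second one small,
    hence s close to a root of 1 + s^2 + 3 s. These roots are simple, so that this
    polynomial separates the points nearby. The error need be Lipschitz only for
    1/8 <= |s|, since no root is closer to 0; the Lipschitz bounds available in s
    degenerate there. *)
Lemma quadratic_zero_unique J (S : R) : pseudosphere A J -> 0 <= S ->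
  exists e : R, 0 < e /\ forall I1 I2 s1 s2 eta1 eta2,
  ACmul (plus_i I1) (cline (1 + s1 ^+ 2) (3 * 'i%C * s1) J + eta1) = 0 ->
  ACmul (plus_i I2) (cline (1 + s2 ^+ 2) (3 * 'i%C * s2) J + eta2) = 0 ->
  ACnorm eta1 <= e -> ACnorm eta2 <= e -> normc s1 <= S -> normc s2 <= S ->
  normc (s1 - s2) <= 1 / 2 ->
  1 / 5 <= normc (1 + s1 ^+ 2 - 3 * s1) -> 1 / 5 <= normc (1 + s2 ^+ 2 - 3 * s2) ->
  (1 / 8 <= normc s1 -> 1 / 8 <= normc s2 ->
    ACnorm (eta1 - eta2) <= e * normc (s1 - s2)) ->
  I1 = I2 /\ s1 = s2.
Proof.
move=> hJ S0.
have L0 : 0 <= 2 * S + 3 by rewrite addr_ge0 // mulr_ge0.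
have c0 : 0 < 1 / 5 :> R by rewrite divr_gt0.
have [e [e0 [small uniq]]] := perturbed_zero_unique mu_ge1 mu_mul hJ c0 L0.
exists e; split=> // I1 I2 s1 s2 eta1 eta2 z1 z2 e1 e2 S1 S2 ds l1 l2 de.
have plusE s : 1 + s ^+ 2 + 'i%C * (3 * 'i%C * s) = 1 + s ^+ 2 - 3 * s :> R[i].
  rewrite (_ : 'i%C * (3 * 'i%C * s) = (3 * s) * ('i%C * 'i%C)); last by ring.
  by rewrite sqr_ImE mulrN1.
have minusE s : 1 + s ^+ 2 - 'i%C * (3 * 'i%C * s) = 1 + s ^+ 2 + 3 * s :> R[i].
  rewrite (_ : 'i%C * (3 * 'i%C * s) = (3 * s) * ('i%C * 'i%C)); last by ring.
  by rewrite sqr_ImE mulrN1 opprK.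
have n3 : normc (3 : R[i]) = 3 by rewrite normc_nat.
have h1 := small _ _ _ _ z1 e1; have h2 := small _ _ _ _ z2 e2.
rewrite plusE minusE in h1; rewrite plusE minusE in h2.
have {}h1 := h1 l1; have {}h2 := h2 l2.
have away s : normc (1 + s ^+ 2 + 3 * s) <= 1 / 2 -> 1 / 8 <= normc s.
  move=> h; rewrite leNgt; apply/negP => s8.
  have := normcB_ge 1 (- (s ^+ 2 + 3 * s)); rewrite opprK addrA Normc.normc1 normc_opp.
  have := normcD_le (s ^+ 2) (3 * s); rewrite normcX Normc.normcM n3.
  have := normc_ge0 s; nra.
have {}de := de (away _ h1) (away _ h2).
have sq5 : (2 * s1 + 3) ^+ 2 = 4 * (1 + s1 ^+ 2 + 3 * s1) + 5 by ring.
(* 5 is the discriminant of the polynomial and 2 s + 3 its derivative *)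
have q1 : 3 / 2 <= normc (2 * s1 + 3).
  rewrite leNgt; apply/negP => lt.
  have := normcB_ge 5 (- (4 * (1 + s1 ^+ 2 + 3 * s1))).
  rewrite opprK [5 + _]addrC -sq5 normcX normc_opp Normc.normcM !normc_nat.
  have := normc_ge0 (2 * s1 + 3); nra.
have q2 : 1 <= normc (s1 + s2 + 3).
  have -> : s1 + s2 + 3 = (2 * s1 + 3) - (s1 - s2) by ring.
  by have := normcB_ge (2 * s1 + 3) (s1 - s2); lra.
have dE : 1 + s1 ^+ 2 + 3 * s1 - (1 + s2 ^+ 2 + 3 * s2) = (s1 - s2) * (s1 + s2 + 3).
  by ring.
have dE' : 1 + s1 ^+ 2 - 3 * s1 - (1 + s2 ^+ 2 - 3 * s2) = (s1 - s2) * (s1 + s2 - 3).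
  by ring.
have ds0 := normc_ge0 (s1 - s2).
have d1 : normc (s1 - s2) <= normc ((s1 - s2) * (s1 + s2 + 3)).
  by rewrite Normc.normcM ler_peMr.
have := uniq _ _ _ _ _ _ _ _ z1 z2 e1 e2.
rewrite /= !plusE !minusE dE dE' => /(_ l1 l2) [||-> d0].
- rewrite Normc.normcM mulrC; apply: ler_pM; rewrite ?normc_ge0 //.
  have := normcB_le (s1 + s2) 3; have := normcD_le s1 s2; rewrite n3; lra.
- by apply: le_trans de _; rewrite ler_wpM2l // ltW.
split=> //; apply/eqP; rewrite -subr_eq0 -normc_eq0 eq_le ds0 andbT.
by rewrite d0 Normc.normc0 in d1.
Qed.

Lemma ACnorm_one_i_gt0 J : 0 < ACnorm ((aone, J) : A * A).
Proof.
apply: ACnorm_gt0; apply/eqP => -[/eqP]; by rewrite (negbTE (@aone_neq0 _ A)).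
Qed.

Lemma one_iE J : (aone, J) = cline 1 'i%C J :> A * A.
Proof.
rewrite /cline ACscale1; apply: AC_eqE => /=.
  by rewrite scale0r scaler0 subr0 addr0.
by rewrite scale0r scale1r !add0r.
Qed.

(** The line 1 + tau s (1 + i J) has the eigenvalues 1 and 1 + 2 tau s; the
    first one is never small and the second one separates points. *)
Lemma linear_zero_unique J : pseudosphere A J ->
  exists e : R, 0 < e /\ forall tau : R, 0 < tau ->
  (forall I s eta,
    ACmul (plus_i I) (cline (1 + tau%:C * s) ('i%C * (tau%:C * s)) J + eta) = 0 ->
    ACnorm eta <= e -> normc s * tau <= 1) /\
  (forall I1 I2 s1 s2 eta1 eta2,
  ACmul (plus_i I1) (cline (1 + tau%:C * s1) ('i%C * (tau%:C * s1)) J + eta1) = 0 ->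
  ACmul (plus_i I2) (cline (1 + tau%:C * s2) ('i%C * (tau%:C * s2)) J + eta2) = 0 ->
  ACnorm eta1 <= e -> ACnorm eta2 <= e ->
  ACnorm (eta1 - eta2) <= e * (tau * normc (s1 - s2)) ->
  I1 = I2 /\ s1 = s2).
Proof.
move=> hJ.
have [e [e0 [small uniq]]] := perturbed_zero_unique mu_ge1 mu_mul hJ ltr01 (lexx 0).
have plusE (x : R[i]) : 1 + x + 'i%C * ('i%C * x) = 1.
  by rewrite mulrA sqr_ImE mulN1r addrK.
have minusE (x : R[i]) : 1 + x - 'i%C * ('i%C * x) = 1 + 2 * x.
  by rewrite mulrA sqr_ImE mulN1r opprK -addrA -mulr2n mulr_natl.
exists e; split=> // tau tau0.
have nt : normc (tau%:C) = tau by rewrite normc_real gtr0_norm.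
split=> [I s eta z he|I1 I2 s1 s2 eta1 eta2 z1 z2 e1 e2 de].
  have := small _ _ _ _ z he; rewrite plusE minusE Normc.normc1 => /(_ (lexx _)).
  have := normcB_ge (2 * (tau%:C * s)) (- 1); rewrite opprK [_ + 1]addrC.
  rewrite normc_opp Normc.normc1 !Normc.normcM normc_nat nt mulrC.
  have := normc_ge0 s; nra.
have := uniq _ _ _ _ _ _ _ _ z1 z2 e1 e2.
rewrite /= !plusE !minusE Normc.normc1 subrr Normc.normc0 mul0r.
have -> : 1 + 2 * (tau%:C * s1) - (1 + 2 * (tau%:C * s2)) = 2 * (tau%:C * (s1 - s2)).
  by ring.
rewrite !Normc.normcM normc_nat nt => /(_ (lexx _) (lexx _) (lexx _)) [|-> /eqP].
  apply: le_trans de _; rewrite ler_wpM2l ?(ltW e0) // ler_peMl ?ler1n //.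
  by rewrite mulr_ge0 ?normc_ge0 ?(ltW tau0).
rewrite !mulf_eq0 pnatr_eq0 /= -normc_eq0 nt (gt_eqF tau0) /= subr_eq0 => /eqP ->.
by [].
Qed.

(** The summand that produces a zero at p with the unit J, as a function of
    s = sigma / (z - p). Its cubic term dominates near p. The threshold that an
    error must not exceed next to 1 + tau s (1 + i J) depends on J, and the units
    may be unbounded; therefore the coefficient tau is tiny, so that the cubic
    term takes over only where the quadratic one has made all errors relatively
    small. The linear term, in a unit J0 that is the same for all zeros, keeps the
    two eigenvalues from vanishing together, as they would at the roots of
    1 + s^2. *)
Definition spike (J0 J : A) (tau : R) (s : R[i]) : A * A :=
  ACscale (3 * 'i%C * s) (creal J0) + ACscale (s ^+ 2) (creal aone) +
  ACscale (s ^+ 3) (ACscale tau%:C (aone, J)).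

Lemma spike_inner J0 J tau s eta : creal aone + spike J0 J tau s + eta =
  cline (1 + s ^+ 2) (3 * 'i%C * s) J0 + (eta + ACscale (s ^+ 3) (ACscale tau%:C (aone, J))).
Proof.
rewrite /spike /cline ACscaleDl ACscale1; apply: ccoord_ext => i.
by rewrite !ccoordD; ring.
Qed.

Lemma spike_outer J0 J tau s eta : s != 0 -> creal aone + spike J0 J tau s + eta =
  ACscale (s ^+ 2) (cline (1 + tau%:C * s) ('i%C * (tau%:C * s)) J +
    (ACscale (s^-1 ^+ 2) (creal aone + eta) + ACscale s^-1 (ACscale (3 * 'i%C) (creal J0)))).
Proof.
move=> s0; rewrite /spike one_iE /cline; apply: ccoord_ext => i.
by rewrite !(ccoordD, ccoordZ); field.
Qed.

Lemma ACscale_eq0 c v : c != 0 -> ACscale c v = 0 -> v = 0.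
Proof.
move=> c0 h; rewrite -(ACscale1 v) -(mulVf c0) -ACscaleA h ACscalev0 //.
Qed.

(** The two eigenvalues differ by 6 s and are close to 1 for small s. *)
Lemma eigenvalue_dichotomy s :
  3 / 10 <= normc (1 + s ^+ 2 - 3 * s) \/ 3 / 10 <= normc (1 + s ^+ 2 + 3 * s).
Proof.
have [|h1] := leP (3 / 10) (normc (1 + s ^+ 2 - 3 * s)); first by left.
have [|h2] := leP (3 / 10) (normc (1 + s ^+ 2 + 3 * s)); first by right.
exfalso; have := normcB_le (1 + s ^+ 2 + 3 * s) (1 + s ^+ 2 - 3 * s).
rewrite (_ : _ - _ = 6 * s); last by ring.
rewrite Normc.normcM normc_nat => h3.
have h : normc s < 1 / 10 by lra.
have := normcB_ge 1 (- (s ^+ 2 + 3 * s)); rewrite opprK addrA Normc.normc1 normc_opp.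
have := normcD_le (s ^+ 2) (3 * s); rewrite normcX Normc.normcM normc_nat.
by have := normc_ge0 s; nra.
Qed.

Lemma eigenvalue_near (k s0 s : R[i]) (S r : R) : normc k = 3 ->
  normc s0 <= S -> normc (s - s0) < r -> r <= 1 / 100 -> r * (2 * S + 10) = 1 / 10 ->
  normc s <= S + 2 /\
  normc (1 + s0 ^+ 2 + k * s0) - 1 / 10 <= normc (1 + s ^+ 2 + k * s).
Proof.
move=> k3 s0S sr r100 rS.
have sS : normc s <= S + 2 by have := normcD_le (s - s0) s0; rewrite subrK; lra.
split=> //; have := normcB_ge (1 + s0 ^+ 2 + k * s0) (- ((s - s0) * (s + s0 + k))).
rewrite opprK (_ : _ + _ * (_ + _) = 1 + s ^+ 2 + k * s); last by ring.
rewrite normc_opp Normc.normcM.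
have sk : normc (s + s0 + k) <= 2 * S + 10.
  by have := normcD_le (s + s0) k; have := normcD_le s s0; rewrite k3; lra.
have := ler_pM (normc_ge0 _) (normc_ge0 _) (ltW sr) sk.
by rewrite rS; lra.
Qed.

Lemma normc_cube_diff s1 s2 (M : R) : normc s1 <= M -> normc s2 <= M ->
  normc (s1 ^+ 3 - s2 ^+ 3) <= normc (s1 - s2) * (3 * M ^+ 2).
Proof.
move=> m1 m2; have M0 : 0 <= M := le_trans (normc_ge0 _) m1.
rewrite (_ : s1 ^+ 3 - _ = (s1 - s2) * (s1 ^+ 2 + s1 * s2 + s2 ^+ 2)); last by ring.
rewrite Normc.normcM ler_wpM2l ?normc_ge0 //.
have := normcD_le (s1 ^+ 2 + s1 * s2) (s2 ^+ 2).
have := normcD_le (s1 ^+ 2) (s1 * s2); rewrite !normcX Normc.normcM.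
have x1 : normc s1 ^+ 2 <= M ^+ 2 by rewrite lerXn2r ?nnegrE ?normc_ge0.
have x2 : normc s2 ^+ 2 <= M ^+ 2 by rewrite lerXn2r ?nnegrE ?normc_ge0.
have x3 : normc s1 * normc s2 <= M ^+ 2.
  by rewrite expr2; apply: ler_pM; rewrite ?normc_ge0.
by lra.
Qed.

Lemma cubic_error_small s (eta ev : A * A) (M d e : R) : normc s <= M ->
  (1 + M ^+ 3) * d <= e -> ACnorm eta <= d -> ACnorm ev <= d ->
  ACnorm (eta + ACscale (s ^+ 3) ev) <= e.
Proof.
move=> sM de etad evd; have M0 : 0 <= M := le_trans (normc_ge0 _) sM.
apply: le_trans (ACnormD _ _) _; rewrite ACnormZ normcX.
have : normc s ^+ 3 * ACnorm ev <= M ^+ 3 * d.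
  by apply: ler_pM; rewrite ?exprn_ge0 ?normc_ge0 ?ACnorm_ge0 // lerXn2r ?nnegrE ?normc_ge0.
by lra.
Qed.

Lemma cubic_error_lipschitz s1 s2 (eta1 eta2 ev : A * A) (M d e : R) :
  1 / 8 <= normc s1 -> 1 / 8 <= normc s2 -> normc s1 <= M -> normc s2 <= M ->
  0 <= d -> (64 + 3 * M ^+ 2) * d <= e -> ACnorm ev <= d ->
  ACnorm (eta1 - eta2) <= d * (normc (s1 - s2) / (normc s1 * normc s2)) ->
  ACnorm (eta1 + ACscale (s1 ^+ 3) ev - (eta2 + ACscale (s2 ^+ 3) ev)) <=
    e * normc (s1 - s2).
Proof.
move=> a1 a2 b1 b2 d0 de evd etad; rewrite opprD addrACA -ACscaleBl.
apply: le_trans (ACnormD _ _) _; rewrite ACnormZ.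
have ds0 := normc_ge0 (s1 - s2).
have h3 := normc_cube_diff b1 b2.
have h4 := ler_pM (normc_ge0 _) (ACnorm_ge0 _) h3 evd.
have h5 : normc (s1 - s2) / (normc s1 * normc s2) <= 64 * normc (s1 - s2).
  have p12 : 1 / 64 <= normc s1 * normc s2.
    rewrite (_ : 1 / 64 = 1 / 8 * (1 / 8)); last by field.
    by apply: ler_pM.
  rewrite ler_pdivrMr; last by apply: lt_le_trans p12; rewrite divr_gt0.
  by have := ler_wpM2l ds0 p12; lra.
have h6 := ler_wpM2l d0 h5.
by have := ler_wpM2r ds0 de; lra.
Qed.

(** For moderate s the cubic term is part of the error. If the eigenvalue
    1 + s^2 - 3 s is the small one at s0, the line is written with - s and - J0 in
    place of s and J0, which exchanges the eigenvalues. The bound on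
    [eta1 - eta2] is a Lipschitz condition in z = p + sigma / s: the quotient in it
    is the modulus of 1 / s1 - 1 / s2. *)
Lemma spike_inner_unique J0 (S : R) : pseudosphere A J0 -> 1 <= S ->
  exists e : R, 0 < e /\ forall J tau, 0 <= tau -> tau * ACnorm ((aone, J) : A * A) <= e ->
  forall s0, normc s0 <= S -> exists r : R, 0 < r /\
  forall I1 I2 s1 s2 eta1 eta2,
  normc (s1 - s0) < r -> normc (s2 - s0) < r ->
  ACnorm eta1 <= e -> ACnorm eta2 <= e -> s1 != 0 -> s2 != 0 ->
  ACnorm (eta1 - eta2) <= e * (normc (s1 - s2) / (normc s1 * normc s2)) ->
  ACmul (plus_i I1) (creal aone + spike J0 J tau s1 + eta1) = 0 ->
  ACmul (plus_i I2) (creal aone + spike J0 J tau s2 + eta2) = 0 ->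
  I1 = I2 /\ s1 = s2.
Proof.
move=> hJ S1.
have S20 : 0 <= S + 2 by lra.
have [e1 [e10 u1]] := quadratic_zero_unique hJ S20.
have [e2 [e20 u2]] := quadratic_zero_unique (pseudosphereN hJ) S20.
pose e := Num.min e1 e2; have e0 : 0 < e by rewrite lt_min e10.
have [ee1 ee2] : e <= e1 /\ e <= e2 by rewrite !ge_min !lexx orbT.
pose B := 64 + (S + 2) ^+ 3 + 3 * (S + 2) ^+ 2.
have [p3 p2] : 0 <= (S + 2) ^+ 3 /\ 0 <= (S + 2) ^+ 2 by rewrite !exprn_ge0.
have B0 : 0 < B by rewrite /B; lra.
have eB0 : 0 < e / B by rewrite divr_gt0.
have below_e c : c <= B -> c * (e / B) <= e.
  by move=> cB; rewrite mulrA ler_pdivrMr // mulrC ler_pM2l.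
have de1 : (1 + (S + 2) ^+ 3) * (e / B) <= e by apply: below_e; rewrite /B; lra.
have de2 : (64 + 3 * (S + 2) ^+ 2) * (e / B) <= e by apply: below_e; rewrite /B; lra.
exists (e / B); split=> // J tau tau0 tauJ s0 s0S.
pose r := 1 / (10 * (2 * S + 10)).
have r0 : 0 < r by rewrite divr_gt0 // mulr_gt0 //; lra.
have rS : r * (2 * S + 10) = 1 / 10 by rewrite /r; field; rewrite gt_eqF //; lra.
have r100 : r <= 1 / 100 by rewrite ler_pdivrMr ?mulr_gt0 //; lra.
exists r; split=> // I1 I2 s1 s2 eta1 eta2 n1 n2 he1 he2 s10 s20 de z1 z2.
move: z1 z2; rewrite !spike_inner.
set ev := ACscale tau%:C (aone, J).
have evn : ACnorm ev <= e / B.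
  by rewrite /ev ACnormZ normc_real ger0_norm.
have tot s eta sM etad := @cubic_error_small s eta ev (S + 2) (e / B) e sM de1 etad evn.
have dtot a1 a2 b1 b2 :=
  @cubic_error_lipschitz s1 s2 eta1 eta2 ev (S + 2) (e / B) e a1 a2 b1 b2 (ltW eB0) de2 evn de.
have ds : normc (s1 - s2) <= 1 / 2.
  by have := normc_dist_le s1 s0 s2; rewrite (normc_sub s0); lra.
have n3 : normc (3 : R[i]) = 3 by rewrite normc_nat.
have n3' : normc (- 3 : R[i]) = 3 by rewrite normc_opp.
have lower (a : R) c : 3 / 10 <= a -> a - 1 / 10 <= c -> 1 / 5 <= c by lra.
case: (eigenvalue_dichotomy s0) => big z1 z2.
  have [S1' l1] := eigenvalue_near n3' s0S n1 r100 rS.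
  have [S2' l2] := eigenvalue_near n3' s0S n2 r100 rS.
  rewrite !mulNr in l1 l2.
  apply: (u1 _ _ _ _ _ _ z1 z2 (le_trans (tot _ _ S1' he1) ee1)
    (le_trans (tot _ _ S2' he2) ee1) S1' S2' ds (lower _ _ big l1) (lower _ _ big l2)) => a1 a2.
  by apply: le_trans (dtot a1 a2 S1' S2') _; rewrite ler_wpM2r ?normc_ge0.
have [S1' l1] := eigenvalue_near n3 s0S n1 r100 rS.
have [S2' l2] := eigenvalue_near n3 s0S n2 r100 rS.
have flip s : cline (1 + s ^+ 2) (3 * 'i%C * s) J0 =
    cline (1 + (- s) ^+ 2) (3 * 'i%C * (- s)) (- J0).
  by rewrite sqrrN mulrN -clineN.
have dsN : normc (- s1 - - s2) = normc (s1 - s2) by rewrite -opprD normc_opp.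
rewrite !flip in z1 z2.
have P := u2 _ _ _ _ _ _ z1 z2 (le_trans (tot _ _ S1' he1) ee2)
  (le_trans (tot _ _ S2' he2) ee2).
rewrite !normc_opp dsN !sqrrN !mulrN !opprK in P.
have [|-> /oppr_inj //] := P S1' S2' ds (lower _ _ big l1) (lower _ _ big l2).
move=> a1 a2; apply: le_trans (dtot a1 a2 S1' S2') _.
by rewrite ler_wpM2r ?normc_ge0.
Qed.

(** For large s the equation is divided by s^2: the constant and linear terms
    become an error of order 1 / |s|. The radius S, chosen independently of J, makes
    it small enough to exclude zeros as long as tau |s| is below a constant g. From
    there on 1 / |s| <= tau / g, so that the error is below the threshold of the
    unit J as soon as tau is small. *)
Lemma spike_outer_unique J0 : exists S : R, 1 <= S /\
  forall J, pseudosphere A J -> exists2 t0 : R, 0 < t0 & forall tau, 0 < tau -> tau <= t0 ->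
  (forall I s eta, S < normc s -> ACnorm eta <= 1 ->
    ACmul (plus_i I) (creal aone + spike J0 J tau s + eta) = 0 -> normc s * tau <= 1) /\
  (forall I1 I2 s1 s2 eta1 eta2,
  S < normc s1 -> S < normc s2 ->
  ACnorm eta1 <= 1 -> ACnorm eta2 <= 1 ->
  ACnorm (eta1 - eta2) <= normc (s1 - s2) / (normc s1 * normc s2) ->
  ACmul (plus_i I1) (creal aone + spike J0 J tau s1 + eta1) = 0 ->
  ACmul (plus_i I2) (creal aone + spike J0 J tau s2 + eta2) = 0 ->
  I1 = I2 /\ s1 = s2).
Proof.
pose n1 := ACnorm (creal (aone : A)); pose q := ACnorm (creal J0).
have [n10 q0] : 0 <= n1 /\ 0 <= q by split; exact: ACnorm_ge0.
have mu0 : 0 < mu by exact: lt_le_trans mu_ge1.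
pose A0 := n1 + 1 + 3 * q; have A00 : 0 < A0 by rewrite /A0; lra.
pose S := 1 + 4 * mu * A0.
have muA : 0 < 4 * mu * A0 by rewrite !mulr_gt0.
have S1 : 1 <= S by rewrite /S; lra.
exists S; split=> // J hJ.
have [e [e0 lin]] := linear_zero_unique hJ.
pose N := ACnorm ((aone, J) : A * A); have N0 : 0 < N := ACnorm_one_i_gt0 J.
pose g := 1 / (4 * mu * N); have g0 : 0 < g by rewrite divr_gt0 // !mulr_gt0.
pose A1 := 2 * n1 + 3 * q + 3.
have A10 : 0 < A1 by rewrite /A1; lra.
pose t0 := Num.min (g * e / A0) (g ^+ 2 * e / A1).
exists t0.
  by rewrite lt_min; apply/andP; split; apply: divr_gt0 => //; apply: mulr_gt0 => //; exact: exprn_gt0.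
move=> tau tau0; rewrite le_min => /andP[ta tb].
have n3i : normc (3 * 'i%C : R[i]) = 3 by rewrite Normc.normcM normc_nat normc_i mulr1.
have nt : normc (tau%:C) = tau by rewrite normc_real gtr0_norm.
have [lin1 lin2] := lin _ tau0.
pose hat s eta : A * A := ACscale (s^-1 ^+ 2) (creal aone + eta) +
  ACscale s^-1 (ACscale (3 * 'i%C) (creal J0)).
have Sne s : S < normc s -> s != 0 by move=> h; rewrite -normc_gt0; lra.
have hat_le s eta : S < normc s -> ACnorm eta <= 1 -> ACnorm (hat s eta) <= A0 / normc s.
  move=> sS he; have s0 : 0 < normc s by lra.
  apply: le_trans (ACnormD _ _) _; rewrite !ACnormZ n3i normcX Normc.normcV -/q.
  have i0 : 0 < (normc s)^-1 by rewrite invr_gt0.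
  have i1 : (normc s)^-1 <= 1 by rewrite invf_le1 //; lra.
  have : (normc s)^-1 ^+ 2 * ACnorm (creal aone + eta) <= (normc s)^-1 * (n1 + 1).
    apply: ler_pM; rewrite ?exprn_ge0 ?ACnorm_ge0 ?(ltW i0) //.
      by rewrite expr2 ler_piMr // ltW.
    by apply: le_trans (ACnormD _ _) _; rewrite lerD2l.
  by rewrite /A0; lra.
have zero_scaled I s eta : S < normc s ->
    ACmul (plus_i I) (creal aone + spike J0 J tau s + eta) = 0 ->
    ACmul (plus_i I) (cline (1 + tau%:C * s) ('i%C * (tau%:C * s)) J + hat s eta) = 0.
  move=> sS; rewrite spike_outer ?Sne // ACmulZr.
  by apply: ACscale_eq0; rewrite expf_neq0 ?Sne.
have far I s eta : S < normc s -> ACnorm eta <= 1 ->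
    ACmul (plus_i I) (creal aone + spike J0 J tau s + eta) = 0 -> g <= tau * normc s.
  move=> sS he /(zero_scaled _ _ _ sS) z; rewrite leNgt; apply/negP => lt.
  have s0 : 0 < normc s by lra.
  pose w : A * A := ACscale (tau%:C * s) (aone, J) + hat s eta.
  apply: (near_one_no_zero mu_mul (I := I) (w := w)); last first.
    rewrite -z; congr ACmul; rewrite /w one_iE /cline ACscaleDr !ACscaleA ACscaleDl !ACscale1.
    by rewrite mulr1 [_ * 'i%C]mulrC !addrA.
  have : mu * ACnorm (ACscale (tau%:C * s) (aone, J)) <= 1 / 4.
    rewrite ACnormZ Normc.normcM nt -/N.
    have := ler_wpM2r (mulr_ge0 (ltW mu0) (ltW N0)) (ltW lt).
    by rewrite (_ : g * (mu * N) = 1 / 4) /g; [lra | field; rewrite !gt_eqF].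
  have : mu * ACnorm (hat s eta) <= 1 / 4.
    have := ler_wpM2l (ltW mu0) (hat_le _ _ sS he).
    have : mu * (A0 / normc s) <= 1 / 4; last by lra.
    by rewrite mulrA ler_pdivrMr //; move: sS; rewrite /S; lra.
  have := ler_wpM2l (ltW mu0) (ACnormD (ACscale (tau%:C * s) (aone, J)) (hat s eta)).
  by rewrite -/w; lra.
have inv_le s : 0 < normc s -> g <= tau * normc s -> (normc s)^-1 <= tau / g.
  by move=> s0 gs; rewrite ler_pdivlMr // mulrC ler_pdivrMr.
have hat_small s eta : S < normc s -> ACnorm eta <= 1 -> g <= tau * normc s ->
    ACnorm (hat s eta) <= e.
  move=> sS he gs; have s0 : 0 < normc s by lra.
  apply: le_trans (hat_le _ _ sS he) _.
  have := ler_wpM2l (ltW A00) (inv_le _ s0 gs).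
  have : A0 * (tau / g) <= e; last by lra.
  by rewrite mulrA ler_pdivrMr // mulrC -ler_pdivlMr // [e * g]mulrC.
split=> [I s eta sS he z|].
  apply: lin1 (zero_scaled _ _ _ sS z) _; apply: hat_small => //; exact: far z.
move=> I1 I2 s1 s2 eta1 eta2 S1' S2' he1 he2 de z1 z2.
have g1 := far _ _ _ S1' he1 z1; have g2 := far _ _ _ S2' he2 z2.
have [p1 p2] : 0 < normc s1 /\ 0 < normc s2 by lra.
have [p1' p2'] : s1 != 0 /\ s2 != 0 by rewrite !Sne.
apply: (lin2 _ _ _ _ _ _ (zero_scaled _ _ _ S1' z1) (zero_scaled _ _ _ S2' z2)).
- exact: hat_small.
- exact: hat_small.
have x0 := normc_ge0 (s1 - s2).
pose x := normc (s1 - s2) / (normc s1 * normc s2).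
have xx : 0 <= x by rewrite divr_ge0 // mulr_ge0 // ltW.
have dinv : normc (s1^-1 - s2^-1) = x.
  have -> : s1^-1 - s2^-1 = - ((s1 - s2) * (s1 * s2)^-1) by field; rewrite p1' p2'.
  by rewrite normc_opp Normc.normcM Normc.normcV Normc.normcM.
have dinv2 : normc (s1^-1 ^+ 2 - s2^-1 ^+ 2) <= 2 * x.
  rewrite subr_sqr Normc.normcM dinv mulrC ler_wpM2r //.
  apply: le_trans (normcD_le _ _) _; rewrite !Normc.normcV.
  have : (normc s1)^-1 <= 1 by rewrite invf_le1 //; lra.
  have : (normc s2)^-1 <= 1 by rewrite invf_le1 //; lra.
  by lra.
have hatE : hat s1 eta1 - hat s2 eta2 =
    ACscale (s1^-1 ^+ 2 - s2^-1 ^+ 2) (creal aone + eta1) +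
    ACscale (s2^-1 ^+ 2) (eta1 - eta2) +
    ACscale (s1^-1 - s2^-1) (ACscale (3 * 'i%C) (creal J0)).
  by apply: ccoord_ext => i; rewrite /hat !(ccoordD, ccoordZ, ccoordN); ring.
have dhat : ACnorm (hat s1 eta1 - hat s2 eta2) <= A1 * x.
  rewrite hatE; apply: le_trans (ACnormD _ _) _; rewrite ACnormZ dinv ACnormZ n3i -/q.
  apply: (@le_trans _ _ (2 * x * (n1 + 1) + x + x * (3 * q))); last first.
    by rewrite /A1; lra.
  rewrite lerD2r; apply: le_trans (ACnormD _ _) _; rewrite !ACnormZ; apply: lerD.
    apply: ler_pM; rewrite ?normc_ge0 ?ACnorm_ge0 //.
    by apply: le_trans (ACnormD _ _) _; rewrite lerD2l.
  apply: le_trans _ de; rewrite ler_piMl ?ACnorm_ge0 //.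
  rewrite normcX Normc.normcV; have i1 : (normc s2)^-1 <= 1 by rewrite invf_le1 //; lra.
  by rewrite exprn_ile1 // invr_ge0 ltW.
apply: le_trans dhat _.
have xle : x <= (tau / g) ^+ 2 * normc (s1 - s2).
  rewrite /x mulrC ler_wpM2r // invfM expr2.
  by apply: ler_pM; rewrite ?invr_ge0 ?(ltW p1) ?(ltW p2) ?inv_le.
apply: le_trans (ler_wpM2l (ltW A10) xle) _.
rewrite [leLHS]mulrA [leRHS]mulrA ler_wpM2r //.
have -> : A1 * (tau / g) ^+ 2 = tau * (A1 * tau / g ^+ 2) by field; rewrite gt_eqF.
rewrite [e * tau]mulrC ler_pM2l // ler_pdivrMr ?exprn_gt0 //.
by rewrite mulrC -ler_pdivlMr // [e * _]mulrC.
Qed.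

(** What a spike has to satisfy for all errors bounded by k: no zeros for large
    s, and local uniqueness of the pair formed by s and the unit. *)
Definition spike_ok (J0 J : A) (k tau : R) :=
  (exists T : R, forall I s eta, T < normc s -> ACnorm eta <= k ->
    ACmul (plus_i I) (creal aone + spike J0 J tau s + eta) <> 0) /\
  (forall s0, exists r : R, 0 < r /\ forall I1 I2 s1 s2 eta1 eta2,
    normc (s1 - s0) < r -> normc (s2 - s0) < r -> s1 != 0 -> s2 != 0 ->
    ACnorm eta1 <= k -> ACnorm eta2 <= k ->
    ACnorm (eta1 - eta2) <= k * (normc (s1 - s2) / (normc s1 * normc s2)) ->
    ACmul (plus_i I1) (creal aone + spike J0 J tau s1 + eta1) = 0 ->
    ACmul (plus_i I2) (creal aone + spike J0 J tau s2 + eta2) = 0 ->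
    I1 = I2 /\ s1 = s2).

(** The bound k depends on J0 only, so that one bound for the errors serves all
    the prescribed zeros; only tau depends on the unit J. *)
Lemma spike_model J0 : pseudosphere A J0 -> exists k : R, 0 < k /\ k <= 1 /\
  forall J, pseudosphere A J -> exists2 tau : R, 0 < tau &
    tau * ACnorm ((aone, J) : A * A) <= 1 /\ spike_ok J0 J k tau.
Proof.
move=> hJ0; have [S [S1 outer]] := spike_outer_unique J0.
have S11 : 1 <= S + 1 by lra.
have [e [e0 inner]] := spike_inner_unique hJ0 S11.
pose k := Num.min 1 e.
have k0 : 0 < k by rewrite lt_min ltr01.
have [k1 ke] : k <= 1 /\ k <= e by rewrite !ge_min !lexx orbT.
exists k; do 2!split=> //; move=> J hJ.
have [t0 t00 out] := outer J hJ; have N0 := ACnorm_one_i_gt0 J.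
pose N := ACnorm ((aone, J) : A * A); rewrite -/N in N0.
pose tau := Num.min t0 (k / N).
have tau0 : 0 < tau by rewrite lt_min t00 divr_gt0.
have tauk : tau * N <= k by rewrite -ler_pdivlMr // ge_min lexx orbT.
have tau1 : tau <= t0 by rewrite ge_min lexx.
exists tau => //; split; first exact: le_trans tauk k1.
have [out1 out2] := out _ tau0 tau1.
split.
  exists (S + tau^-1) => I s eta sT he z.
  have ti : 0 < tau^-1 by rewrite invr_gt0.
  have sS : S < normc s by lra.
  have := out1 _ _ _ sS (le_trans he k1) z.
  by rewrite -ler_pdivlMr // mul1r; lra.
move=> s0; have [s0S|s0S] := leP (normc s0) (S + 1).
  have [r [r0 hr]] := inner J tau (ltW tau0) (le_trans tauk ke) s0 s0S.
  exists r; split=> // I1 I2 s1 s2 eta1 eta2 n1 n2 z1 z2 e1 e2 de.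
  apply: (hr _ _ _ _ _ _ n1 n2 (le_trans e1 ke) (le_trans e2 ke) z1 z2).
  apply: le_trans de _; rewrite ler_wpM2r // divr_ge0 ?normc_ge0 //.
  by rewrite mulr_ge0 ?normc_ge0.
exists 1; split=> // I1 I2 s1 s2 eta1 eta2 n1 n2 z1 z2 e1 e2 de.
have far s : normc (s - s0) < 1 -> S < normc s.
  by move=> h; have := normcB_ge s0 (s0 - s); rewrite subKr normc_sub; lra.
apply: (out2 _ _ _ _ _ _ (far _ n1) (far _ n2) (le_trans e1 k1) (le_trans e2 k1)).
apply: le_trans de _; rewrite ler_piMl // divr_ge0 ?normc_ge0 //.
by rewrite mulr_ge0 ?normc_ge0.
Qed.

End LocalModel.

(** * Partial stem functions *)

Section Product.
Variables (R : realType) (A : altStarAlgType R).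
Variables (b p : nat -> R[i]) (J : nat -> A) (J0 : A) (sigma tau : nat -> R).

Definition pole n (z : R[i]) : scalars R := (z - b n)^-1.

(** The quotient (z - p) / (z - b), written as 1 plus a quantity that is
    visibly small when p is close to b. *)
Definition root_factor n (z : R[i]) : scalars R := 1 - (p n - b n) * pole n z.

Definition conj_factor n (z : R[i]) : scalars R := conjc (root_factor n z^*).

Definition pair_factor n z : scalars R := root_factor n z * conj_factor n z.

(** The third power cancels the triple poles of the spike at p n and of its
    mirror image. *)
Definition factor n z : scalars R :=
  pair_factor n z * (pair_factor n z * pair_factor n z).

(** The product of [factor n] and the spike at p n with the poles cancelled
    ([half_bumpE]), so that it makes sense at p n too. *)
Definition half_bump n (z : R[i]) : vectors A :=
  ACscale (conj_factor n z * (conj_factor n z * conj_factor n z))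
   (ACscale (root_factor n z * root_factor n z)
      (ACscale (pole n z) (ACscale (3 * 'i%C * (sigma n)%:C) (creal J0))) +
    ACscale (root_factor n z)
      (ACscale (pole n z * pole n z) (ACscale ((sigma n)%:C ^+ 2) (creal aone))) +
    ACscale (pole n z * (pole n z * pole n z))
      (ACscale ((sigma n)%:C ^+ 3) (ACscale (tau n)%:C (aone, J n)))).

Definition bump n z : vectors A := half_bump n z + ACconj (half_bump n z^*).

Fixpoint scalar_part n z : scalars R :=
  if n is m.+1 then factor m z * scalar_part m z else 1.

(** This is [scalar_part] times 1 plus the sum of the spikes and their mirror
    images ([stem_factored]), in a recursion that remains meaningful at the poles
    of the spikes. *)
Fixpoint stem n z : vectors A :=
  if n is m.+1 then ACscale (factor m z) (stem m z) +
    ACscale (scalar_part m z) (bump m z)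
  else creal aone.

Hypothesis p_b : forall n, normc (p n - b n) <= (2 ^+ n)^-1.
Hypothesis sigma_ge0 : forall n, 0 <= sigma n.
Hypothesis sigma_le : forall n, sigma n <= (2 ^+ n)^-1.
Hypothesis tau_ge0 : forall n, 0 <= tau n.
Hypothesis tau_le : forall n, tau n * ACnorm ((aone, J n) : A * A) <= 1.

Section Bounds.
Variables (U : set R[i]) (rho : R).
Hypothesis rho_gt0 : 0 < rho.
Hypothesis U_away : forall z, U z -> forall n, rho <= normc (z - b n).

Lemma pole_bounded : bounded_family U pole.
Proof.
exists (rho^-1 + rho^-1 ^+ 2).
  by rewrite addr_ge0 ?exprn_ge0 ?invr_ge0 ?ltW.
by move=> n; apply: tame_inv => // z Uz; exact: U_away.
Qed.

Lemma root_factor_near1 : small_family U (fun n z => root_factor n z - 1).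
Proof.
have h : small_family U (fun n z => - (p n - b n) : scalars R).
  apply: (@small_family_cst R U (scalars R) _ 1) => n /=; rewrite mul1r normc_opp; exact: p_b.
have := small_family_actl h pole_bounded.
congr (small_family _ _); apply/funext => n; apply/funext => z.
by rewrite /root_factor /=; ring.
Qed.

End Bounds.

Lemma near1_bounded U (h : nat -> R[i] -> scalars R) :
  small_family U (fun n z => h n z - 1) -> bounded_family U h.
Proof.
move=> /small_bounded h1.
have := bounded_familyD h1 (bounded_family_cst U (1 : scalars R)).
congr (bounded_family _ _); apply/funext => n; apply/funext => z; exact: subrK.
Qed.

Lemma star_small U (V : cnormed R) (h : nat -> R[i] -> V) :
  small_family [set z | U z^*] h -> small_family U (fun n z => cconj (h n z^*)).
Proof. by move=> [C C0 hC]; exists C => // n; exact: tame_star. Qed.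

Lemma sigma_scaled_small U (V : cnormed R) (v : nat -> V) (B : R) m :
  (forall n, cnorm (v n) <= B) -> 
  small_family U (fun n z => cact ((sigma n)%:C ^+ m.+1) (v n)).
Proof.
move=> vB; apply: (@small_family_cst R U V _ B) => n.
rewrite cnorm_act normcX normc_real ger0_norm // mulrC.
apply: ler_pM; rewrite ?cnorm_ge0 ?exprn_ge0 //.
apply: le_trans (sigma_le n); rewrite exprS ler_piMr // exprn_ile1 //.
apply: le_trans (sigma_le n) _; rewrite invf_le1 ?exprn_gt0 //.
by rewrite exprn_ege1 // ler1n.
Qed.

Section BothBounds.
Variables (U : set R[i]) (rho : R).
Hypothesis rho_gt0 : 0 < rho.
Hypothesis U_away : forall z, U z -> forall n, rho <= normc (z - b n).
Hypothesis U_away' : forall z, U z^* -> forall n, rho <= normc (z - b n).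

Lemma conj_factor_near1 : small_family U (fun n z => conj_factor n z - 1).
Proof.
have := star_small (root_factor_near1 rho_gt0 (U := [set z | U z^*]) U_away').
congr (small_family _ _); apply/funext => n; apply/funext => z.
by rewrite /= rmorphB rmorph1.
Qed.

Lemma factor_near1 : small_family U (fun n z => factor n z - 1).
Proof.
have h1 := root_factor_near1 rho_gt0 U_away.
have h2 := small_family_mul_near1 h1 conj_factor_near1.
exact: small_family_mul_near1 h2 (small_family_mul_near1 h2 h2).
Qed.

Lemma half_bump_small : small_family U half_bump.
Proof.
have hr := near1_bounded (root_factor_near1 rho_gt0 U_away).
have hc := near1_bounded conj_factor_near1.
have hp := pole_bounded rho_gt0 U_away.
have bmul (h1 h2 : nat -> R[i] -> scalars R) : bounded_family U h1 ->
  bounded_family U h2 -> bounded_family U (fun n z => h1 n z * h2 n z : scalars R).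
  exact: (@bounded_family_act R U (scalars R)).
apply: (@small_family_actr R U (vectors A)); first exact: (bmul _ _ hc (bmul _ _ hc hc)).
apply: (@small_familyD R U (vectors A)); last first.
  apply: (@small_family_actr R U (vectors A)); first exact: (bmul _ _ hp (bmul _ _ hp hp)).
  apply: (@sigma_scaled_small U (vectors A) (fun n => ACscale (tau n)%:C (aone, J n)) 1 2).
  by move=> n /=; rewrite ACnormZ normc_real ger0_norm.
apply: (@small_familyD R U (vectors A)).
  apply: (@small_family_actr R U (vectors A)); first exact: (bmul _ _ hr hr).
  apply: (@small_family_actr R U (vectors A)); first exact: hp.
  have := @sigma_scaled_small U (vectors A) (fun n => ACscale (3 * 'i%C) (creal J0)) _ 0
    (fun n => lexx _).
  congr (small_family _ _); apply/funext => n; apply/funext => z.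
  by rewrite /= ACscaleA expr1 [in RHS]mulrC.
apply: (@small_family_actr R U (vectors A)); first exact: hr.
apply: (@small_family_actr R U (vectors A)); first exact: (bmul _ _ hp hp).
exact: (@sigma_scaled_small U (vectors A) (fun n => creal aone) _ 1 (fun n => lexx _)).
Qed.

End BothBounds.

Section Convergence.
Variables (U : set R[i]) (rho : R).
Hypothesis rho_gt0 : 0 < rho.
Hypothesis U_away : forall z, U z -> forall n, rho <= normc (z - b n).
Hypothesis U_away' : forall z, U z^* -> forall n, rho <= normc (z - b n).

Lemma bump_small : small_family U bump.
Proof.
apply: (@small_familyD R U (vectors A)); first exact: half_bump_small U_away U_away'.
apply: (@star_small U (vectors A)).
apply: (half_bump_small rho_gt0) => [z|z] /=; first exact: U_away'.
by rewrite conjcK; exact: U_away.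
Qed.

(** Step n multiplies the bound by 1 + O(2^-n); the exponential of the partial
    geometric sum absorbs these factors. *)
Lemma partial_bounded : exists2 P : R, 0 <= P &
  forall n, tame U P (scalar_part n) /\ tame U P (stem n).
Proof.
have [C C0 hC] := factor_near1 rho_gt0 U_away U_away'.
have [E E0 hE] := bump_small.
pose B := Num.max C E.
have B0 : 0 <= B by rewrite le_max C0.
pose P0 := 1 + ACnorm (creal aone : A * A).
have P00 : 0 <= P0 by rewrite addr_ge0 ?ACnorm_ge0.
pose P n := P0 * expR (8 * B * (1 - (2 ^+ n)^-1)).
have Ppos n : 0 <= P n by rewrite mulr_ge0 // expR_ge0.
have step n : P n * (1 + 4 * (B / 2 ^+ n)) <= P n.+1.
  rewrite /P -mulrA ler_wpM2l //.
  have -> : 8 * B * (1 - (2 ^+ n.+1)^-1) =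
      8 * B * (1 - (2 ^+ n)^-1) + 4 * (B / 2 ^+ n).
    by rewrite exprS; field; rewrite expf_neq0.
  by rewrite expRD ler_wpM2l ?expR_ge0 // expR_ge1Dx.
have main n : tame U (P n) (scalar_part n) /\ tame U (P n) (stem n).
  elim: n => [|n [IH1 IH2]].
    have P1 : P 0%N = P0 by rewrite /P expr0 invr1 subrr mulr0 expR0 mulr1.
    rewrite P1; split.
      have n1 : cnorm (1 : scalars R) = 1 := Normc.normc1 _.
      by apply: (tame_le _ (tame_cst U (1 : scalars R))); rewrite n1 lerDl ACnorm_ge0.
    by apply: (tame_le _ (tame_cst U (creal aone : vectors A))); rewrite /= lerDr.
  have x0 : 0 <= B / 2 ^+ n by rewrite divr_ge0 ?exprn_ge0.
  have hCn : tame U (B / 2 ^+ n) (fun z => factor n z - 1 : scalars R).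
    by apply: tame_le (hC n); rewrite ler_wpM2r ?invr_ge0 ?exprn_ge0 // le_max lexx.
  have hEn : tame U (B / 2 ^+ n) (bump n).
    by apply: tame_le (hE n); rewrite ler_wpM2r ?invr_ge0 ?exprn_ge0 // le_max lexx orbT.
  have t1 := tame_act x0 (Ppos n) hCn IH1.
  have t2 := tame_act x0 (Ppos n) hCn IH2.
  have t3 := tame_act (Ppos n) x0 IH1 hEn.
  have px : 0 <= P n * (B / 2 ^+ n) by rewrite mulr_ge0.
  split.
    have -> : scalar_part n.+1 = fun z => cact (factor n z - 1 : scalars R) (scalar_part n z)
        + scalar_part n z.
      by apply/funext => z /=; ring.
    by apply: tame_le (tameD t1 IH1); apply: le_trans (step n); lra.
  have -> : stem n.+1 = fun z => (cact (factor n z - 1 : scalars R) (stem n z) + stem n z)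
      + cact (scalar_part n z) (bump n z).
    by apply/funext => z /=; rewrite ACscaleBl ACscale1 subrK.
  by apply: tame_le (tameD (tameD t2 IH2) t3); apply: le_trans (step n); lra.
exists (P0 * expR (8 * B)); first by rewrite mulr_ge0 ?expR_ge0.
move=> n; have Pn : P n <= P0 * expR (8 * B).
  by rewrite ler_wpM2l // ler_expR ler_piMr ?mulr_ge0 // gerBl invr_ge0.
by have [h1 h2] := main n; split; [exact: tame_le Pn h1|exact: tame_le Pn h2].
Qed.

Lemma stem_diff_small : exists2 C : R, 0 <= C &
  forall n, tame U (C / 2 ^+ n) (fun z => stem n.+1 z - stem n z : vectors A).
Proof.
have [P P0 hP] := partial_bounded.
have h1 := factor_near1 rho_gt0 U_away U_away'.
have hF : bounded_family U stem by exists P => // n; have [] := hP n.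
have hs : bounded_family U scalar_part by exists P => // n; have [] := hP n.
have [C C0 hC] := small_familyD (small_family_actl h1 hF) (small_family_actr hs bump_small).
exists C => // n; have := hC n; congr (tame _ _ _); apply/funext => z /=.
by rewrite ACscaleBl ACscale1 addrAC.
Qed.

End Convergence.
End Product.

(** * Holomorphy of the limit *)

Section Differentiability.
Variable R : realType.

Definition cdiff (V : cnormed R) (h : R[i] -> V) z := exists L, cderivable h z L.

Lemma cdiff_cst (V : cnormed R) (v : V) z : cdiff (fun=> v) z.
Proof. by exists 0; exact: cderivable_cst. Qed.

Lemma cdiffD (V : cnormed R) (h1 h2 : R[i] -> V) z :
  cdiff h1 z -> cdiff h2 z -> cdiff (fun z => h1 z + h2 z) z.
Proof. by move=> [L1 d1] [L2 d2]; exists (L1 + L2); exact: cderivableD. Qed.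

Lemma cdiff_act (V : cnormed R) (c : R[i] -> scalars R) (h : R[i] -> V) z :
  cdiff c z -> cdiff h z -> cdiff (fun z => cact (c z) (h z)) z.
Proof.
by move=> [c' dc] [L dh]; exists (cact (c z) L + cact c' (h z)); exact: cderivable_act.
Qed.

Lemma cdiff_star (V : cnormed R) (h : R[i] -> V) z :
  cdiff h z^* -> cdiff (fun z => cconj (h z^*)) z.
Proof. by move=> [L dh]; exists (cconj L); exact: cderivable_star. Qed.

Lemma nbhs_normc (z : R[i]) (P : set R[i]) :
  nbhs z P <-> exists2 d : R, 0 < d & forall z', normc (z' - z) < d -> P z'.
Proof.
split=> [/nbhs_normP[e /= e0 eP]|[d d0 dP]].
  have [er e00] : e = (complex.Re e)%:C /\ 0 < complex.Re e.
    by case: e e0 {eP} => a c; rewrite ltcE /= => /andP[/eqP -> ?].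
  exists (complex.Re e) => // z' zz'; apply: eP.
  by rewrite /ball_ /= er distrC cnormE ltcR.
apply/nbhs_normP; exists (d%:C); first by rewrite /= ltcR.
by move=> z'; rewrite /ball_ /= distrC cnormE ltcR; exact: dP.
Qed.

Lemma open_normc (G : set R[i]) : open G <->
  forall z, G z -> exists2 d : R, 0 < d & forall z', normc (z' - z) < d -> G z'.
Proof.
rewrite openE; split=> h z Gz; first by apply/nbhs_normc; exact: h.
by rewrite /interior; apply/nbhs_normc; exact: h.
Qed.

Lemma cderivable_complex_derivable (A : altStarAlgType R)
  (F : R[i] -> vectors A) z L : cderivable F z L -> complex_derivable F z.
Proof.
move=> dF; exists L.
have [C [C0 hC]] := @norm_le_ACnorm R A.
have leC (v : A * A) : `|v| <= C * ACnorm v.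
  rewrite prod_normE ge_max; apply/andP; split.
    by apply: le_trans (hC _) _; rewrite ler_pM2l // ACnorm_creal1.
  by apply: le_trans (hC _) _; rewrite ler_pM2l // ACnorm_creal2.
apply/cvgrPdist_le => e e0.
have eC : 0 < e / C by rewrite divr_gt0.
have [d d0 hd] := dF _ eC.
apply/nbhs_normc; exists d => // h; rewrite subr0 => hlt h0.
rewrite distrC; apply: le_trans (leC _) _.
rewrite mulrC -ler_pdivlMr //.
have -> : ACscale h^-1 (F (z + h) - F z) - L =
    ACscale h^-1 (F (z + h) - F z - ACscale h L).
  by rewrite [in RHS]ACscaleBr [in RHS]ACscaleA mulVf // ACscale1.
rewrite ACnormZ Normc.normcV mulrC ler_pdivrMr ?normc_gt0 //.
exact: hd.
Qed.

End Differentiability.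

Section StemLimit.
Variables (R : realType) (A : altStarAlgType R).
Variables (b p : nat -> R[i]) (J : nat -> A) (J0 : A) (sigma tau : nat -> R).
Variable G : set R[i].
Hypothesis p_b : forall n, normc (p n - b n) <= (2 ^+ n)^-1.
Hypothesis sigma_ge0 : forall n, 0 <= sigma n.
Hypothesis sigma_le : forall n, sigma n <= (2 ^+ n)^-1.
Hypothesis tau_ge0 : forall n, 0 <= tau n.
Hypothesis tau_le : forall n, tau n * ACnorm ((aone, J n) : A * A) <= 1.
Hypothesis G_sym : forall z, G z <-> G z^*.
Hypothesis G_open : forall z, G z ->
  exists2 d : R, 0 < d & forall z', normc (z' - z) < d -> G z'.
Hypothesis b_out : forall n, ~ G (b n).

Lemma G_neighborhood z : G z -> exists2 r : R, 0 < r &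
  [/\ forall z', normc (z' - z) < r -> G z',
      forall z', normc (z' - z) < r -> forall n, r <= normc (z' - b n) &
      forall z', normc (z'^* - z) < r -> forall n, r <= normc (z' - b n)].
Proof.
move=> Gz; have [d d0 dG] := G_open Gz.
have d2 : 0 < d / 2 by rewrite divr_gt0.
exists (d / 2) => //; split=> [z' h|z' h n|z' h n].
- by apply: dG; lra.
- rewrite leNgt; apply/negP => lt; apply: (b_out (n := n)); apply: dG.
  have := normc_dist_le (b n) z' z; rewrite (normc_sub (b n) z'); lra.
- rewrite leNgt; apply/negP => lt; apply: (b_out (n := n)); apply/G_sym; apply: dG.
  have := normc_dist_le (b n)^* z'^* z.
  rewrite -rmorphB normc_conj (normc_sub (b n) z'); lra.
Qed.

Let psi := scalar_part b p.
Let Fn := stem b p J J0 sigma tau.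

Lemma pole_diff n z : G z -> cdiff (pole b n) z.
Proof.
move=> Gz; exists (- ((z - b n)^-1 ^+ 2)); apply: cderivable_inv.
by apply/eqP => zb; apply: (b_out (n := n)); rewrite -zb.
Qed.

Lemma root_factor_diff n z : G z -> cdiff (root_factor b p n) z.
Proof.
move=> Gz; have h := cdiffD (cdiff_cst (1 : scalars R) z)
  (cdiff_act (cdiff_cst (- (p n - b n) : scalars R) z) (pole_diff n Gz)).
move: h; congr cdiff; apply/funext => z'; by rewrite /root_factor /= mulNr.
Qed.

Lemma conj_factor_diff n z : G z -> cdiff (conj_factor b p n) z.
Proof.
by move=> /G_sym Gz; exact: (@cdiff_star R (scalars R) _ _ (root_factor_diff n Gz)).
Qed.

Lemma cdiff_mul (h1 h2 : R[i] -> scalars R) z : cdiff h1 z -> cdiff h2 z ->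
  cdiff (fun z => h1 z * h2 z : scalars R) z.
Proof. exact: (@cdiff_act R (scalars R)). Qed.

Lemma factor_diff n z : G z -> cdiff (factor b p n) z.
Proof.
move=> Gz; have h := cdiff_mul (root_factor_diff n Gz) (conj_factor_diff n Gz).
exact: (cdiff_mul h (cdiff_mul h h)).
Qed.

Lemma half_bump_diff n z : G z -> cdiff (half_bump b p J J0 sigma tau n) z.
Proof.
move=> Gz; have hr := root_factor_diff n Gz; have hc := conj_factor_diff n Gz.
have hp := pole_diff n Gz.
apply: (@cdiff_act R (vectors A)); first exact: (cdiff_mul hc (cdiff_mul hc hc)).
apply: (@cdiffD R (vectors A)); last first.
  by apply: (@cdiff_act R (vectors A)); [exact: (cdiff_mul hp (cdiff_mul hp hp))|exact: cdiff_cst].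
apply: (@cdiffD R (vectors A)).
  apply: (@cdiff_act R (vectors A)); first exact: (cdiff_mul hr hr).
  by apply: (@cdiff_act R (vectors A)) => //; exact: cdiff_cst.
apply: (@cdiff_act R (vectors A)) => //.
by apply: (@cdiff_act R (vectors A)); [exact: (cdiff_mul hp hp)|exact: cdiff_cst].
Qed.

Lemma partial_diff n z : G z -> cdiff (psi n) z /\ cdiff (Fn n) z.
Proof.
move=> Gz; elim: n => [|n [h1 h2]]; first by split; exact: cdiff_cst.
have hf := factor_diff n Gz; split; first exact: (cdiff_mul hf h1).
have Gz' := (G_sym z).1 Gz.
have hb : cdiff (bump b p J J0 sigma tau n) z.
  exact: (cdiffD (half_bump_diff n Gz) (cdiff_star (half_bump_diff n Gz'))).
exact: (cdiffD (cdiff_act hf h2) (cdiff_act h1 hb)).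
Qed.

(** Around each point of G the partial stems form a sequence with tame
    geometric increments, because the poles b n lie outside G. *)
Lemma stem_limit_exists : exists F : R[i] -> vectors A, forall z, G z ->
  (exists K : R, forall n, ACnorm (F z - Fn n z) <= K / 2 ^+ n) /\
  complex_derivable F z.
Proof.
have lim z : exists l : A * A, G z ->
    exists K : R, forall n, ACnorm (l - Fn n z) <= K / 2 ^+ n.
  have [Gz|nGz] := pselect (G z); last by exists 0.
  have [r r0 [rG ra ra']] := G_neighborhood Gz.
  have [C C0 hC] := stem_diff_small J0 p_b sigma_ge0 sigma_le tau_ge0 tau_le r0
    (U := [set z' | normc (z' - z) < r]) ra ra'.
  have [l hl] := @geometric_cvg R A (fun n => Fn n z) C
    (fun n => (hC n).1 z ltac:(by rewrite /= subrr Normc.normc0)).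
  by exists l => _; exists (2 * C).
have [F hF] := choice lim; exists F => z Gz; split; first exact: hF.
have [r r0 [rG ra ra']] := G_neighborhood Gz.
have [C C0 hC] := stem_diff_small J0 p_b sigma_ge0 sigma_le tau_ge0 tau_le r0
  (U := [set z' | normc (z' - z) < r]) ra ra'.
have kx z' : exists K : R, normc (z' - z) < r ->
    forall n, ACnorm (F z' - Fn n z') <= K / 2 ^+ n.
  have [h|h] := pselect (normc (z' - z) < r); last by exists 0.
  by have [K hK] := hF _ (rG _ h); exists K.
have [K hK] := choice kx.
have [L dL] := cderivable_limit r0 (fun z' h => h) hC hK
  (fun n => (partial_diff n Gz).2).
exact: cderivable_complex_derivable dL.
Qed.

Lemma factor_conj n z : factor b p n z^* = conjc (factor b p n z).
Proof.
rewrite /factor /pair_factor /conj_factor conjcK !rmorphM /= !conjcK.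
by rewrite [root_factor b p n z^* * _]mulrC.
Qed.

Lemma scalar_part_conj n z : psi n z^* = conjc (psi n z).
Proof.
elim: n => [|n IH]; first by rewrite rmorph1.
rewrite (_ : psi n.+1 z^* = factor b p n z^* * psi n z^*) // IH factor_conj.
exact: (esym (rmorphM (@conjc R) (factor b p n z) (psi n z))).
Qed.

Lemma stem_conj n z : Fn n z^* = ACconj (Fn n z).
Proof.
elim: n => [|n IH]; first by apply: (@AC_eqE R A) => //=; rewrite oppr0.
have FS x : Fn n.+1 x = ACscale (factor b p n x) (Fn n x) +
  ACscale (psi n x) (bump b p J J0 sigma tau n x) by [].
rewrite !FS IH ACconjD !ACconjZ factor_conj scalar_part_conj; congr (_ + ACscale _ _).
by rewrite /bump conjcK ACconjD ACconjK addrC.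
Qed.

Lemma limit_unique (u : nat -> A * A) (l1 l2 : A * A) (K1 K2 : R) :
  (forall n, ACnorm (l1 - u n) <= K1 / 2 ^+ n) ->
  (forall n, ACnorm (l2 - u n) <= K2 / 2 ^+ n) -> l1 = l2.
Proof.
move=> h1 h2; apply/eqP; rewrite -subr_eq0; apply/eqP/ACnorm_eq0/eqP.
rewrite eq_le ACnorm_ge0 andbT leNgt; apply/negP => lt.
have [n hn] := geometric_small (K1 + K2) lt.
have := ACnorm_dist l1 (u n) l2; rewrite (ACnorm_sub (u n)).
by have := h1 n; have := h2 n; rewrite mulrDl in hn; lra.
Qed.

Lemma stem_limit_conj (F : R[i] -> vectors A) z : G z ->
  (forall z, G z -> exists K : R, forall n, ACnorm (F z - Fn n z) <= K / 2 ^+ n) ->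
  F z^* = ACconj (F z).
Proof.
move=> Gz hF; have [K1 h1] := hF _ Gz; have [K2 h2] := hF _ ((G_sym z).1 Gz).
apply: (@limit_unique (fun n => Fn n z^*) _ _ K2 K1 h2) => n.
rewrite stem_conj; have := h1 n; rewrite -(ACnorm_conj (_ - _)) ACconjD.
by congr (ACnorm (_ + _) <= _); apply: AC_eqE; rewrite //= opprK.
Qed.

End StemLimit.

(** * The stem function in product form *)

(** Beyond an index M with small tail sum of |c n - 1| the products stay within
    half the modulus of [q M]; the finitely many earlier ones are nonzero. *)
Lemma product_lower_bound (R : realType) (c q : nat -> R[i]) (C : R) N :
  (forall n, normc (c n - 1) <= C / 2 ^+ n) ->
  (forall n, (N <= n)%N -> c n != 0) -> q N != 0 ->
  (forall n, (N <= n)%N -> q n.+1 = c n * q n) ->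
  exists2 c0 : R, 0 < c0 & forall n, (N <= n)%N -> c0 <= normc (q n).
Proof.
move=> cC c0 qN qS.
have q0 n : (N <= n)%N -> q n != 0.
  move=> /subnK <-; elim: (n - N)%N => [|m IH] //.
  by rewrite addSn qS ?leq_addl // mulf_neq0 // c0 // leq_addl.
have C0 : 0 <= C by have := le_trans (normc_ge0 _) (cC 0%N); rewrite expr0 divr1.
have [m hm] := geometric_small (2 * C) (e := 1 / 4) ltac:(by rewrite divr_gt0).
pose M := (N + m)%N; have NM : (N <= M)%N by exact: leq_addr.
have hM : 2 * C / 2 ^+ M <= 1 / 4.
  apply: le_trans (ltW hm); rewrite ler_wpM2l ?mulr_ge0 //.
  by rewrite lef_pV2 ?posrE ?exprn_gt0 // ler_eXn2l ?leq_addl // ltr1n.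
have pM n : 0 <= 2 * C / 2 ^+ n by rewrite divr_ge0 ?exprn_ge0 ?mulr_ge0.
have qM0 : 0 < normc (q M) by rewrite normc_gt0 q0.
have tail n : normc (q (n + M)%N - q M) <=
    2 * (2 * C / 2 ^+ M - 2 * C / 2 ^+ (n + M)) * normc (q M).
  elim: n => [|n IH]; first by rewrite add0n !subrr Normc.normc0 mulr0 mul0r.
  rewrite addSn qS; last by rewrite (leq_trans NM) // leq_addl.
  have -> : c (n + M)%N * q (n + M)%N - q M =
     (c (n + M)%N - 1) * q (n + M)%N + (q (n + M)%N - q M) by ring.
  apply: le_trans (normcD_le _ _) _; rewrite Normc.normcM.
  have q2 : normc (q (n + M)%N) <= 2 * normc (q M).
    have := normcD_le (q (n + M)%N - q M) (q M); rewrite subrK.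
    by have := pM (n + M)%N; nra.
  have := ler_pM (normc_ge0 _) (normc_ge0 _) (cC (n + M)%N) q2.
  have -> : 2 * C / 2 ^+ (n + M).+1 = C / 2 ^+ (n + M).
    by rewrite exprS; field; rewrite expf_neq0.
  lra.
have far n : (M <= n)%N -> normc (q M) / 2 <= normc (q n).
  move=> /subnK nM; have := tail (n - M)%N; rewrite nM => h.
  have := normcB_ge (q M) (q M - q n); rewrite subKr (normc_sub (q M)).
  by have := pM n; nra.
have near : exists2 c1 : R, 0 < c1 & forall n, (N <= n)%N -> (n <= M)%N -> c1 <= normc (q n).
  move: (M) => M'; elim: M' => [|M' [c1 c10 h]].
    case: N q0 {qN qS NM c0 pM hM qM0 tail far M} => [|N'] q0.
      by exists (normc (q 0%N)) => [|[|n]]; rewrite ?normc_gt0 ?q0.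
    by exists 1 => // n h; rewrite leqn0 => /eqP n0; rewrite n0 in h.
  have [NM'|NM'] := leqP N M'.+1; last first.
    exists 1 => // n Nn nM'; have := leq_trans Nn nM'; by rewrite leqNgt NM'.
  exists (Num.min c1 (normc (q M'.+1))); first by rewrite lt_min c10 normc_gt0 q0.
  move=> n Nn; rewrite leq_eqVlt => /orP[/eqP ->|nM']; first by rewrite ge_min lexx orbT.
  by rewrite ge_min h.
have [c1 c10 h] := near.
exists (Num.min c1 (normc (q M) / 2)); first by rewrite lt_min c10 divr_gt0.
move=> n Nn; have [nM|nM] := leqP n M; first by rewrite ge_min h.
by rewrite ge_min far ?orbT // ltnW.
Qed.

Section Values.
Variables (R : realType) (A : altStarAlgType R).
Variables (b p : nat -> R[i]) (J : nat -> A) (J0 : A) (sigma tau : nat -> R).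

Let psi := scalar_part b p.
Let Fn := stem b p J J0 sigma tau.

Definition spike_at n (z : R[i]) : A * A :=
  spike J0 (J n) (tau n) ((sigma n)%:C * (z - p n)^-1).

Definition mirror_at n (z : R[i]) : A * A := ACconj (spike_at n z^*).

(** The sum of the first n spikes and mirror images, with the spike at p k left
    out: near p k it is the small error added to that spike. *)
Fixpoint rest k n (z : R[i]) : vectors A :=
  if n is m.+1 then
    rest k m z + ((if m == k then 0 else spike_at m z) + mirror_at m z)
  else 0.

Lemma root_factorE n z : z != b n -> root_factor b p n z = (z - p n) * pole b n z.
Proof.
by move=> zb; rewrite /root_factor /pole; field; rewrite subr_eq0.
Qed.

Lemma half_bumpE n z : z != b n -> z != p n ->
  half_bump b p J J0 sigma tau n z = ACscale (factor b p n z) (spike_at n z).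
Proof.
move=> zb zp; rewrite /half_bump /factor /pair_factor /spike_at /spike.
rewrite root_factorE // /pole; move: (conj_factor b p n z) => c.
apply: ccoord_ext => i; rewrite !(ccoordD, ccoordZ).
by field; rewrite !subr_eq0 zb zp.
Qed.

Lemma bumpE n z : z != b n -> z^* != b n -> z != p n -> z^* != p n ->
  bump b p J J0 sigma tau n z =
  ACscale (factor b p n z) (spike_at n z + mirror_at n z).
Proof.
move=> zb zb' zp zp'; rewrite /bump !half_bumpE // ACconjZ factor_conj conjcK.
by rewrite ACscaleDr.
Qed.

Lemma factor_neq0 n z : z != b n -> z^* != b n -> z != p n -> z^* != p n ->
  factor b p n z != 0.
Proof.
move=> zb zb' zp zp'.
have h x : x != b n -> x != p n -> root_factor b p n x != 0.
  by move=> xb xp; rewrite root_factorE // mulf_neq0 ?invr_neq0 // subr_eq0.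
by rewrite /factor /pair_factor /conj_factor !mulf_neq0 ?conjc_eq0 ?h.
Qed.

Lemma stem_factored k n z : (forall j, z != b j) -> (forall j, z^* != b j) ->
  (forall j, z != p j) -> (forall j, z^* != p j) ->
  Fn n z = ACscale (psi n z)
    (creal aone + (if (k < n)%N then spike_at k z else 0) + rest k n z).
Proof.
move=> zb zb' zp zp'; elim: n => [|n IH].
  by rewrite /psi /= ACscale1 !addr0.
rewrite (_ : Fn n.+1 z = ACscale (factor b p n z) (Fn n z) +
  ACscale (psi n z) (bump b p J J0 sigma tau n z)) //.
rewrite (_ : psi n.+1 z = factor b p n z * psi n z) //.
rewrite IH bumpE // !ACscaleA [psi n z * _]mulrC -ACscaleDr; congr ACscale.
rewrite [rest k n.+1 z]/=.
have hk : n = k -> spike_at n z = spike_at k z by move=> ->.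
move: (spike_at k z) (spike_at n z) hk (rest k n z) (mirror_at n z) => u u' hk v w.
have [nk|nk] := eqVneq n k.
  by rewrite hk // nk ltnSn ltnn add0r addr0 -!addrA (addrCA v).
have -> : (k < n.+1)%N = (k < n)%N by rewrite ltnS leq_eqVlt eq_sym (negbTE nk).
by rewrite -!addrA.
Qed.

End Values.

(** * Linear equations in the limit *)

Section ZeroTransfer.
Variables (R : realType) (A : altStarAlgType R).
Variables (b p : nat -> R[i]) (J : nat -> A) (J0 : A) (sigma tau : nat -> R).
Variable G : set R[i].
Hypothesis p_b : forall n, normc (p n - b n) <= (2 ^+ n)^-1.
Hypothesis sigma_ge0 : forall n, 0 <= sigma n.
Hypothesis sigma_le : forall n, sigma n <= (2 ^+ n)^-1.
Hypothesis tau_ge0 : forall n, 0 <= tau n.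
Hypothesis tau_le : forall n, tau n * ACnorm ((aone, J n) : A * A) <= 1.
Hypothesis G_sym : forall z, G z <-> G z^*.
Hypothesis G_open : forall z, G z ->
  exists2 d : R, 0 < d & forall z', normc (z' - z) < d -> G z'.
Hypothesis b_out : forall n, ~ G (b n).
Variables (delta : nat -> R) (kappa : R).
Hypothesis delta_gt0 : forall n, 0 < delta n.
Hypotheses (kappa_gt0 : 0 < kappa) (kappa_le1 : kappa <= 1).
Hypothesis sigma_small : forall n,
  2 * sigma n * ((delta n)^-1 + (delta n)^-1 ^+ 2) *
    (6 * ACnorm (creal J0) + 4 * ACnorm (creal (aone : A)) + 8) <= kappa / 2 ^+ n.+1.

Let psi := scalar_part b p.
Let Fn := stem b p J J0 sigma tau.
Let sp := spike_at p J J0 sigma tau.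
Let rs := rest p J J0 sigma tau.

Lemma spike_tame n (U : set R[i]) : (forall z, U z -> delta n <= normc (z - p n)) ->
  tame U (kappa / 2 ^+ n.+1) (sp n : R[i] -> vectors A).
Proof.
move=> hU.
pose q := ACnorm (creal J0); pose n1 := ACnorm (creal (aone : A)).
have [q0 n10] : 0 <= q /\ 0 <= n1 by split; exact: ACnorm_ge0.
pose B := (delta n)^-1 + (delta n)^-1 ^+ 2; pose t := 2 * sigma n * B.
have B0 : 0 <= B by rewrite addr_ge0 ?exprn_ge0 // invr_ge0 ltW.
have t0 : 0 <= t by rewrite !mulr_ge0.
have small := sigma_small n; rewrite -/B -/t -/q -/n1 in small.
have k1 : kappa / 2 ^+ n.+1 <= 1.
  rewrite ler_pdivrMr ?exprn_gt0 // mul1r; apply: le_trans kappa_le1 _.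
  by rewrite exprn_ege1 // ler1n.
have t1 : t <= 1 by nra.
have ht : @tame R (scalars R) U t (fun z => (sigma n)%:C * (z - p n)^-1).
  have ns : normc ((sigma n)%:C) = sigma n by rewrite normc_real ger0_norm.
  have h1 := tame_cst U ((sigma n)%:C : scalars R).
  rewrite (_ : cnorm _ = sigma n) in h1; last exact: ns.
  exact: (tame_act (sigma_ge0 n) B0 h1 (tame_inv (delta_gt0 n) hU)).
pose s : R[i] -> scalars R := fun z => (sigma n)%:C * (z - p n)^-1.
have ht2 : tame U (2 * t * t) (fun z => s z * s z : scalars R).
  exact: (tame_act t0 t0 ht ht).
have t20 : 0 <= 2 * t * t by rewrite !mulr_ge0.
have ht3 : tame U (2 * t * (2 * t * t)) (fun z => s z * (s z * s z) : scalars R).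
  exact: (tame_act t0 t20 ht ht2).
have t30 : 0 <= 2 * t * (2 * t * t) by rewrite !mulr_ge0.
have c1 := tame_cst U (ACscale (3 * 'i%C) (creal J0) : vectors A).
have c2 := tame_cst U (creal aone : vectors A).
have c3 := tame_cst U (ACscale (tau n)%:C (aone, J n) : vectors A).
have e1 : ACnorm (ACscale (3 * 'i%C) (creal J0)) = 3 * q.
  by rewrite ACnormZ Normc.normcM normc_nat normc_i mulr1.
have e3 : ACnorm (ACscale (tau n)%:C (aone, J n)) <= 1.
  by rewrite ACnormZ normc_real ger0_norm.
have q3 : 0 <= 3 * q by rewrite mulr_ge0.
have d1 := tame_act t0 (cnorm_ge0 _) ht c1.
have d2 := tame_act t20 (cnorm_ge0 _) ht2 c2.
have d3 := tame_act t30 ler01 ht3 (tame_le e3 c3).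
have -> : sp n = fun z => cact (s z) (ACscale (3 * 'i%C) (creal J0) : vectors A) +
    cact (s z * s z) (creal aone : vectors A) +
    cact (s z * (s z * s z)) (ACscale (tau n)%:C (aone, J n) : vectors A).
  apply/funext => z; rewrite /sp /spike_at /spike /= -/(s z).
  by apply: ccoord_ext => i; rewrite !(ccoordD, ccoordZ); ring.
apply: tame_le (tameD (tameD d1 d2) d3).
rewrite (_ : cnorm _ = 3 * q) // (_ : cnorm _ = n1) //.
have tt : t * t <= t by rewrite ler_piMr.
have := ler_wpM2r n10 tt.
have : t * (t * t) <= t by apply: le_trans tt; rewrite ler_wpM2l // ler_piMl.
by lra.
Qed.

Definition away_region k : set R[i] := [set z |
  (forall j, j != k -> delta j <= normc (z - p j)) /\
  (forall j, delta j <= normc (z^* - p j))].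

Lemma rest_tame k n : tame (away_region k) (kappa / 2 ^+ n)
  (fun z => rs k n.+1 z - rs k n z : vectors A).
Proof.
have hm : tame (away_region k) (kappa / 2 ^+ n.+1)
    (mirror_at p J J0 sigma tau n : R[i] -> vectors A).
  apply: (@tame_star R (vectors A) _ _ (sp n)); apply: spike_tame => z [_ h].
  exact: (eq_ind _ (fun x => delta n <= normc (x - p n)) (h n) _ (conjcK z)).
have hs : tame (away_region k) (kappa / 2 ^+ n.+1)
    (fun z => (if n == k then 0 else sp n z) : vectors A).
  have [_|nk] := eqVneq n k; last by apply: spike_tame => z [h _]; exact: h.
  apply: tame_le (tame_cst _ (0 : vectors A)); rewrite (_ : cnorm _ = 0); last exact: ACnorm0.
  by rewrite divr_ge0 ?exprn_ge0 // ltW.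
have -> : kappa / 2 ^+ n = kappa / 2 ^+ n.+1 + kappa / 2 ^+ n.+1.
  by rewrite exprS; field; rewrite expf_neq0.
have := tameD hs hm; congr (tame _ _ _); apply/funext => z.
by rewrite /rs /= [in RHS]addrC addKr.
Qed.

Lemma rest_limit k : exists eta : R[i] -> vectors A,
  tame (away_region k) (2 * kappa) eta /\
  forall z, away_region k z -> forall n, ACnorm (eta z - rs k n z) <= 2 * kappa / 2 ^+ n.
Proof.
have lim z : exists l : A * A, away_region k z ->
    forall n, ACnorm (l - rs k n z) <= 2 * kappa / 2 ^+ n.
  have [Uz|nUz] := pselect (away_region k z); last by exists 0.
  have [l hl] := @geometric_cvg R A (fun n => rs k n z) kappa
    (fun n => (rest_tame k n).1 z Uz).
  by exists l.
have [eta heta] := choice lim; exists eta; split=> //.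
have := tame_limit_diff (rest_tame k) (K := fun=> 2 * kappa) heta 0%N.
rewrite expr0 divr1; congr (tame _ _ _); apply/funext => z; exact: subr0.
Qed.

Lemma factor_near1_at z : G z -> exists C : R, forall n,
  normc (factor b p n z - 1) <= C / 2 ^+ n.
Proof.
move=> Gz; have [r r0 [rG ra ra']] := G_neighborhood G_sym G_open b_out Gz.
have [C _ hC] := factor_near1 p_b r0 (U := [set z' | normc (z' - z) < r]) ra ra'.
by exists C => n; apply: (hC n).1; rewrite /= subrr Normc.normc0.
Qed.

Lemma b_neq z : G z -> forall j, z != b j.
Proof. by move=> Gz j; apply/eqP => zb; apply: (b_out (n := j)); rewrite -zb. Qed.

Lemma b_neq_conj z : G z -> forall j, z^* != b j.
Proof. by move=> /G_sym; exact: b_neq. Qed.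

Variable F : R[i] -> vectors A.
Hypothesis F_lim : forall z, G z ->
  exists K : R, forall n, ACnorm (F z - Fn n z) <= K / 2 ^+ n.

(** The scalar parts stay away from 0, so that a linear equation T (F z) = 0 can
    be divided by them in the limit. Both left multiplication by I + i, for the
    zeros, and right multiplication by a fixed element, for invertibility, occur as
    T. *)
Lemma zero_transfer (T : A * A -> A * A) (B : R) k eta z :
  (forall v w, T (v + w) = T v + T w) -> (forall c v, T (ACscale c v) = ACscale c (T v)) ->
  (forall v, ACnorm (T v) <= B * ACnorm v) ->
  G z -> (forall j, z != p j) -> (forall j, z^* != p j) ->
  (forall n, ACnorm (eta - rs k n z) <= 2 * kappa / 2 ^+ n) ->
  T (F z) = 0 -> T (creal aone + sp k z + eta) = 0.
Proof.
move=> TD TZ TB Gz zp zp' heta TF.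
have [K hK] := F_lim Gz; have [C hC] := factor_near1_at Gz.
have fac0 n : factor b p n z != 0.
  by apply: factor_neq0 => //; [exact: b_neq|exact: b_neq_conj].
have [c0 c00 hc0] := product_lower_bound (q := fun n => psi n z) (N := 0%N) hC
  (fun n _ => fac0 n) (oner_neq0 _) (fun n _ => erefl).
have T0 : T 0 = 0 by rewrite -(ACscale0 0) TZ !ACscale0.
have TN v : T (- v) = - T v := opp_of_scale v TZ.
have B0 : 0 <= B := bound_ge0 TB.
set v := creal aone + sp k z + eta.
apply/ACnorm_eq0/eqP; rewrite eq_le ACnorm_ge0 andbT leNgt; apply/negP => lt.
have [m hm] := geometric_small (B * K / c0 + 2 * kappa * B) lt.
pose n := (k + m.+1)%N; have kn : (k < n)%N by rewrite /n addnS ltnS leq_addr.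
pose vn : A * A := creal aone + sp k z + rs k n z.
have FE : Fn n z = ACscale (psi n z) vn.
  have := @stem_factored R A b p J J0 sigma tau k n z (b_neq Gz) (b_neq_conj Gz) zp zp'.
  by rewrite kn.
have K0 : 0 <= K by have := le_trans (ACnorm_ge0 _) (hK 0%N); rewrite expr0 divr1.
have mn : (2 ^+ n)^-1 <= (2 ^+ m)^-1 :> R.
  rewrite lef_pV2 ?posrE ?exprn_gt0 // ler_eXn2l ?ltr1n //.
  by rewrite /n addnS ltnW // ltnS leq_addl.
have b1 : c0 * ACnorm (T vn) <= B * K / 2 ^+ m.
  apply: (@le_trans _ _ (ACnorm (T (Fn n z)))).
    by rewrite FE TZ ACnormZ ler_wpM2r ?ACnorm_ge0 // hc0.
  have -> : T (Fn n z) = - T (F z - Fn n z) by rewrite TD TN TF add0r opprK.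
  rewrite ACnormN; apply: le_trans (TB _) _; rewrite -mulrA ler_wpM2l //.
  by apply: le_trans (hK n) _; rewrite ler_wpM2l.
have b2 : ACnorm (T (v - vn)) <= 2 * kappa * B / 2 ^+ m.
  have -> : v - vn = eta - rs k n z by rewrite /v /vn opprD addrACA subrr add0r.
  apply: le_trans (TB _) _; rewrite [_ * B]mulrC -mulrA ler_wpM2l //.
  by apply: le_trans (heta n) _; rewrite ler_wpM2l // mulr_ge0 // ltW.
have : ACnorm (T v) <= ACnorm (T (v - vn)) + ACnorm (T vn).
  by have := ACnormD (T (v - vn)) (T vn); rewrite -TD subrK.
have : ACnorm (T vn) <= B * K / c0 / 2 ^+ m.
  by rewrite mulrAC ler_pdivlMr // [ACnorm _ * _]mulrC.
by move: hm; rewrite mulrDl; lra.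
Qed.

Lemma ACmul_linear_bounded mu (X : A * A) :
  (forall v w : A * A, ACnorm (ACmul v w) <= mu * ACnorm v * ACnorm w) ->
  [/\ forall v w, ACmul X (v + w) = ACmul X v + ACmul X w,
      forall c v, ACmul X (ACscale c v) = ACscale c (ACmul X v) &
      forall v, ACnorm (ACmul X v) <= mu * ACnorm X * ACnorm v].
Proof.
by move=> hmu; split=> *; rewrite ?ACmulDr ?ACmulZr.
Qed.

End ZeroTransfer.

(** * Zeros of the stem function *)

Section Zeros.
Variables (R : realType) (A : altStarAlgType R).
Variables (b p : nat -> R[i]) (J : nat -> A) (J0 : A) (sigma tau : nat -> R).
Variable G : set R[i].
Variables (eps rad : nat -> R) (kappa k0 mu : R).
Hypothesis mu_ge1 : 1 <= mu.
Hypothesis mu_mul : forall v w : A * A,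
  ACnorm (ACmul v w) <= mu * ACnorm v * ACnorm w.
Hypothesis G_sym : forall z, G z <-> G z^*.
Hypothesis G_open : forall z, G z ->
  exists2 d : R, 0 < d & forall z', normc (z' - z) < d -> G z'.
Hypothesis b_out : forall n, ~ G (b n).
Hypothesis p_b : forall n, normc (p n - b n) < eps n.
Hypothesis eps_le : forall n, eps n <= (2 ^+ n)^-1.
Hypothesis eps_rad : forall n, eps n.+1 <= rad n / 2.
Hypothesis rad_gt0 : forall n, 0 < rad n.
Hypothesis rad_G : forall n z, normc (z - p n) < rad n -> G z.
Hypothesis rad_Im : forall n, rad n <= complex.Im (p n).
Hypothesis sigma_gt0 : forall n, 0 < sigma n.
Hypothesis sigma_le : forall n, sigma n <= (2 ^+ n)^-1.
Hypothesis tau_gt0 : forall n, 0 < tau n.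
Hypothesis tau_le : forall n, tau n * ACnorm ((aone, J n) : A * A) <= 1.
Hypotheses (kappa_gt0 : 0 < kappa) (kappa_le1 : kappa <= 1).
Let delta n := rad n / 16.
Hypothesis sigma_small : forall n,
  2 * sigma n * ((delta n)^-1 + (delta n)^-1 ^+ 2) *
    (6 * ACnorm (creal J0) + 4 * ACnorm (creal (aone : A)) + 8) <= kappa / 2 ^+ n.+1.
Hypothesis J_unit : forall n, pseudosphere A (J n).
Hypothesis spikes_ok : forall n, spike_ok J0 (J n) k0 (tau n).
Hypothesis kappa_k0 : 2 * kappa <= k0.
Hypothesis kappa_mu : mu * (3 * kappa) < 1.
Variable F : R[i] -> vectors A.
Hypothesis F_lim : forall z, G z ->
  exists K : R, forall n, ACnorm (F z - stem b p J J0 sigma tau n z) <= K / 2 ^+ n.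

Let psi := scalar_part b p.
Let Fn := stem b p J J0 sigma tau.
Let sp := spike_at p J J0 sigma tau.
Let sigma_ge0 n : 0 <= sigma n. Proof. exact: ltW. Qed.
Let tau_ge0 n : 0 <= tau n. Proof. exact: ltW. Qed.
Let delta_gt0 n : 0 < delta n. Proof. by rewrite divr_gt0. Qed.
Let p_b_le n : normc (p n - b n) <= (2 ^+ n)^-1.
Proof. exact: le_trans (ltW (p_b n)) (eps_le n). Qed.
Let G_p n : G (p n). Proof. by have := @rad_G n (p n); rewrite subrr Normc.normc0; apply. Qed.

(** The disc of radius [rad n] about p n lies in G, hence contains no b j; later
    p j are so close to b j that they stay outside the disc of half that radius. *)
Lemma rad_le_dist n j : rad n <= normc (p n - b j).
Proof.
rewrite leNgt; apply/negP => lt; apply: (b_out (n := j)); apply: (@rad_G n).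
by rewrite normc_sub.
Qed.

Lemma rad_lt_eps n : rad n < eps n.
Proof. exact: le_lt_trans (rad_le_dist n n) (p_b n). Qed.

Lemma eps_rad_lt n j : (n < j)%N -> eps j <= rad n / 2.
Proof.
elim: j => // j IH; rewrite ltnS leq_eqVlt => /orP[/eqP <- //|nj].
apply: le_trans (eps_rad j) _; have := IH nj; have := rad_lt_eps j; have := rad_gt0 j.
lra.
Qed.

Lemma rad_decr n j : (n <= j)%N -> rad j <= rad n.
Proof.
rewrite leq_eqVlt => /orP[/eqP <- //|nj].
have := eps_rad_lt nj; have := rad_lt_eps j; have := rad_gt0 n; lra.
Qed.

Lemma p_separated n j : (n < j)%N -> rad n / 2 <= normc (p n - p j).
Proof.
move=> nj; have := normc_dist_le (p n) (p j) (b j); have := p_b j.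
have := eps_rad_lt nj; have := rad_le_dist n j; lra.
Qed.

(** The other discs are far by the separation of the p j, and their mirror
    images because they lie in the lower half plane at distance at least [rad j]
    from the real axis. *)
Lemma close_away k z : 0 <= complex.Im z -> normc (z - p k) < rad k / 4 ->
  away_region p delta k z.
Proof.
move=> Iz zk; split=> j; last first.
  have : `|complex.Im (z^* - p j)| <= normc (z^* - p j) by exact: Im_le_normc.
  have -> : complex.Im (z^* - p j) = - (complex.Im z + complex.Im (p j)).
    by case: (z) => x y; case: (p j) => x' y' /=; rewrite opprD.
  rewrite normrN ger0_norm; have := rad_Im j; have := rad_gt0 j; rewrite /delta; lra.
move=> jk; have := normc_dist_le (p j) z (p k); rewrite (normc_sub (p j) z) => h.
have [kj|jk'|e] := ltngtP k j; last by rewrite e eqxx in jk.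
  have := p_separated kj; rewrite (normc_sub (p k)); have := eps_rad_lt kj.
  have := rad_lt_eps j; have := rad_gt0 j; rewrite /delta; lra.
have := p_separated jk'; have := eps_rad_lt jk'; have := rad_lt_eps k.
by have := rad_gt0 k; have := rad_gt0 j; rewrite /delta; lra.
Qed.

Lemma away_neq k z : away_region p delta k z -> z != p k ->
  (forall j, z != p j) /\ (forall j, z^* != p j).
Proof.
move=> [h1 h2] zk; split=> j; rewrite -subr_eq0 -normc_gt0.
  have [->|jk] := eqVneq j k; first by rewrite normc_gt0 subr_eq0.
  by apply: lt_le_trans (h1 j jk).
by apply: lt_le_trans (h2 j).
Qed.

(** No factor vanishes at p k except the k-th one. Step k of the recursion
    leaves only the cubic term of the spike, as the other terms carry the factor
    z - p k, and later steps multiply the result by nonzero factors close to 1. *)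
Lemma stem_at_root k : exists be : nat -> R[i], exists2 c0 : R, 0 < c0 &
  forall n, (k < n)%N -> Fn n (p k) = ACscale (be n) (aone, J k) /\ c0 <= normc (be n).
Proof.
have aw : away_region p delta k (p k).
  apply: close_away; first by apply: le_trans (rad_Im k); exact: ltW.
  by rewrite subrr Normc.normc0 divr_gt0.
have [h1 h2] := aw.
have pp j : j != k -> p k != p j.
  by move=> jk; rewrite -subr_eq0 -normc_gt0; apply: lt_le_trans (h1 j jk).
have pp' j : (p k)^* != p j.
  by rewrite -subr_eq0 -normc_gt0; apply: lt_le_trans (h2 j).
have zb := b_neq b_out (G_p k); have zb' := b_neq_conj G_sym b_out (G_p k).
have fac0 n : n != k -> factor b p n (p k) != 0.
  by move=> nk; apply: factor_neq0 => //; exact: pp.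
have rk : root_factor b p k (p k) = 0 by rewrite root_factorE // subrr mul0r.
have fk : factor b p k (p k) = 0 by rewrite /factor /pair_factor rk !mul0r.
have psi0 n : (k < n)%N -> psi n (p k) = 0.
  elim: n => // n IH; rewrite ltnS leq_eqVlt => /orP[/eqP <-|/IH h].
    by rewrite /psi /= fk mul0r.
  by rewrite (_ : psi n.+1 (p k) = factor b p n (p k) * psi n (p k)) // h mulr0.
have psik : psi k (p k) != 0.
  suff h n : (n <= k)%N -> psi n (p k) != 0 by exact: h.
  elim: n => [_|n IH nk]; first exact: oner_neq0.
  rewrite (_ : psi n.+1 (p k) = factor b p n (p k) * psi n (p k)) //.
  by rewrite mulf_neq0 ?IH ?(ltnW nk) // fac0 // neq_ltn nk.
pose cf := conj_factor b p k (p k); pose pl := pole b k (p k).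
pose g : R[i] := cf * (cf * cf) * (pl * (pl * pl)) * ((sigma k)%:C ^+ 3 * (tau k)%:C).
have g0 : g != 0.
  have cf0 : cf != 0.
    by rewrite /cf /conj_factor conjc_eq0 root_factorE // mulf_neq0 ?invr_neq0 // subr_eq0.
  have pl0 : pl != 0 by rewrite invr_neq0 // subr_eq0.
  have s0 : (sigma k)%:C != 0 :> R[i] by rewrite -normc_gt0 normc_real gtr0_norm.
  have t0 : (tau k)%:C != 0 :> R[i] by rewrite -normc_gt0 normc_real gtr0_norm.
  by rewrite /g !mulf_neq0 // expf_neq0.
have bk : bump b p J J0 sigma tau k (p k) = ACscale g (aone, J k).
  rewrite /bump /half_bump -/cf -/pl rk mul0r !ACscale0 !add0r.
  rewrite {1}/conj_factor conjcK rk conjc0 mul0r ACscale0.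
  have -> : ACconj (0 : A * A) = 0 by apply: AC_eqE; rewrite //= oppr0.
  by rewrite addr0 !ACscaleA /g -!mulrA.
pose be := fix be m := if m is m'.+1 then
  factor b p (k + m) (p k) * be m' else psi k (p k) * g.
have [C hC] := factor_near1_at p_b_le G_sym G_open b_out (G_p k).
have be0 : be 0%N != 0 by rewrite mulf_neq0.
have beS n : (k < n)%N -> Fn n (p k) = ACscale (be (n - k.+1)%N) (aone, J k).
  elim: n => // n IH; rewrite ltnS leq_eqVlt => /orP[/eqP kn|kn].
    rewrite -kn subnn (_ : Fn k.+1 (p k) = ACscale (factor b p k (p k)) (Fn k (p k)) +
      ACscale (psi k (p k)) (bump b p J J0 sigma tau k (p k))) //.
    by rewrite fk ACscale0 add0r bk ACscaleA.
  rewrite (_ : Fn n.+1 (p k) = ACscale (factor b p n (p k)) (Fn n (p k)) +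
    ACscale (psi n (p k)) (bump b p J J0 sigma tau n (p k))) //.
  rewrite psi0 // ACscale0 addr0 IH // ACscaleA subSn //=.
  by rewrite -addSnnS subnKC.
pose q n := be (n - k.+1)%N.
have [c0 c00 hc0] := product_lower_bound (c := fun n => factor b p n (p k)) (q := q)
  (N := k.+1) hC (fun n kn => fac0 n ltac:(by rewrite neq_ltn kn orbT))
  ltac:(by rewrite /q subnn) ltac:(by move=> n kn; rewrite /q subSn //= -addSnnS subnKC).
by exists q, c0 => // n kn; rewrite beS //; split=> //; exact: hc0.
Qed.

Lemma limit_zero_transfer (T : A * A -> A * A) (B : R) k :
  (forall v w, T (v + w) = T v + T w) -> (forall c v, T (ACscale c v) = ACscale c (T v)) ->
  (forall v, ACnorm (T v) <= B * ACnorm v) ->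
  T (F (p k)) = 0 <-> T (aone, J k) = 0.
Proof.
move=> TD TZ TB; have [K hK] := F_lim (G_p k).
have [be [c0 c00 hbe]] := stem_at_root k.
have TN v : T (- v) = - T v := opp_of_scale v TZ.
have B0 : 0 <= B := bound_ge0 TB.
have diff n : ACnorm (T (F (p k) - Fn n (p k))) <= B * K / 2 ^+ n.
  by apply: le_trans (TB _) _; rewrite -mulrA ler_wpM2l.
have K0 : 0 <= K by have := le_trans (ACnorm_ge0 _) (hK 0%N); rewrite expr0 divr1.
have pow m : (2 ^+ (k.+1 + m))^-1 <= (2 ^+ m)^-1 :> R.
  by rewrite lef_pV2 ?posrE ?exprn_gt0 // ler_eXn2l ?ltr1n // leq_addl.
have BK : 0 <= B * K by rewrite mulr_ge0.
split=> h; apply/ACnorm_eq0/eqP; rewrite eq_le ACnorm_ge0 andbT leNgt; apply/negP => lt.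
  have [m hm] := geometric_small (B * K) (mulr_gt0 c00 lt).
  have kn : (k < k.+1 + m)%N by rewrite addSn ltnS leq_addr.
  have [FE cb] := hbe _ kn.
  have := diff (k.+1 + m)%N; rewrite TD h add0r TN ACnormN FE TZ ACnormZ.
  have := ler_wpM2r (ltW lt) cb; have := ler_wpM2l BK (pow m); lra.
have [m hm] := geometric_small (B * K) lt.
have kn : (k < k.+1 + m)%N by rewrite addSn ltnS leq_addr.
have [FE cb] := hbe _ kn.
have := diff (k.+1 + m)%N; rewrite TD TN FE TZ h ACscalev0 subr0.
have := ler_wpM2l BK (pow m); lra.
Qed.

(** F (p k) is a nonzero multiple of 1 + i J, and (I + i) (1 + i J) has the real
    part I - J. *)
Lemma zero_at_root k I : pseudosphere A I ->
  ACmul (plus_i I) (F (p k)) = 0 <-> I = J k.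
Proof.
move=> hI; have [h1 h2 h3] := ACmul_linear_bounded (plus_i I) mu_mul.
rewrite (limit_zero_transfer k h1 h2 h3); split=> [/(congr1 fst)|->] /=.
  by rewrite amul1r amul1l => /eqP; rewrite subr_eq0 => /eqP.
apply: AC_eqE => /=; first by rewrite amul1r amul1l subrr.
by rewrite pseudosphere_sqr // amul1l addNr.
Qed.

Lemma model_equation k I z eta : away_region p delta k z -> G z -> z != p k ->
  (forall n, ACnorm (eta - rest p J J0 sigma tau k n z) <= 2 * kappa / 2 ^+ n) ->
  ACmul (plus_i I) (F z) = 0 ->
  ACmul (plus_i I) (creal aone + sp k z + eta) = 0.
Proof.
move=> aw Gz zk he; have [h1 h2 h3] := ACmul_linear_bounded (plus_i I) mu_mul.
have [zp zp'] := away_neq aw zk.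
exact: (zero_transfer p_b_le G_sym G_open b_out kappa_gt0 F_lim h1 h2 h3 Gz zp zp' he).
Qed.

Lemma rest_small k : exists eta : R[i] -> vectors A,
  tame (away_region p delta k) (2 * kappa) eta /\
  forall z, away_region p delta k z ->
    forall n, ACnorm (eta z - rest p J J0 sigma tau k n z) <= 2 * kappa / 2 ^+ n.
Proof.
exact: (rest_limit p sigma_ge0 tau_ge0 tau_le delta_gt0 kappa_gt0 kappa_le1 sigma_small).
Qed.

Lemma off_small z eta : away_region p delta 0 z -> delta 0 <= normc (z - p 0%N) ->
  ACnorm eta <= 2 * kappa -> mu * ACnorm (sp 0%N z + eta) < 1.
Proof.
move=> aw z0 he.
have h : tame [set z | delta 0 <= normc (z - p 0%N)] (kappa / 2 ^+ 1) (sp 0%N : R[i] -> vectors A).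
  exact: (spike_tame sigma_ge0 tau_ge0 tau_le delta_gt0 kappa_le1 sigma_small).
have := h.1 z z0; rewrite expr1 /= => h1.
apply: le_lt_trans kappa_mu; rewrite ler_wpM2l ?(le_trans ler01) //.
by apply: le_trans (ACnormD _ _) _; have := kappa_gt0; lra.
Qed.

Lemma off_no_zero z I : G z -> away_region p delta 0 z -> delta 0 <= normc (z - p 0%N) ->
  ACmul (plus_i I) (F z) <> 0.
Proof.
move=> Gz aw z0 h.
have [eta [teta heta]] := rest_small 0%N.
have zp : z != p 0%N by rewrite -subr_eq0 -normc_gt0; exact: lt_le_trans z0.
have := model_equation aw Gz zp (heta z aw) h; rewrite -addrA.
exact: (near_one_no_zero mu_mul (off_small aw z0 (teta.1 z aw))).
Qed.

(** The equation F z w = 0 becomes (1 + y) w = 0 with y so small that w = - y w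
    is possible for w = 0 only. *)
Lemma off_left_regular z w : G z -> away_region p delta 0 z ->
  delta 0 <= normc (z - p 0%N) -> ACmul (F z) w = 0 -> w = 0.
Proof.
move=> Gz aw z0 h.
have [eta [teta heta]] := rest_small 0%N.
have zp0 : z != p 0%N by rewrite -subr_eq0 -normc_gt0; exact: lt_le_trans z0.
have [zp zp'] := away_neq aw zp0.
have := zero_transfer p_b_le G_sym G_open b_out kappa_gt0 F_lim
  (T := fun v => ACmul v w) (B := mu * ACnorm w)
  (fun v1 v2 => ACmulDl v1 v2 w) (fun c v => ACmulZl c v w)
  (fun v => ltac:(by rewrite mulrAC)) Gz zp zp' (heta z aw) h.
rewrite -addrA ACmulDl ACmul1l => /eqP; rewrite addr_eq0 => /eqP hw.
apply/ACnorm_eq0/eqP; rewrite eq_le ACnorm_ge0 andbT leNgt; apply/negP => lt.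
have := mu_mul (sp 0%N z + eta z) w; rewrite -ACnormN -hw.
have := off_small aw z0 (teta.1 z aw); rewrite -/sp.
move: (mu * _) => x; nra.
Qed.

(** Near z0 only finitely many discs matter: the later p k are close to b k,
    which stay away from z0 because they lie outside G. *)
Lemma far_from_roots z0 : G z0 -> (forall k, 2 * delta k <= normc (z0 - p k)) ->
  exists2 r : R, 0 < r & forall z, normc (z - z0) < r ->
    forall k, delta k <= normc (z - p k).
Proof.
move=> Gz0 h0; have [d d0 dG] := G_open Gz0.
have [K hK] := geometric_small 1 (e := d / 4) ltac:(by rewrite divr_gt0).
exists (Num.min (d / 4) (delta K)); first by rewrite lt_min delta_gt0 divr_gt0.
move=> z; rewrite lt_min => /andP[zd zK] k.
have := normc_dist_le z0 z (p k); rewrite (normc_sub z0 z) => t1.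
have [Kk|kK] := leqP K k; last first.
  have := h0 k; have : delta K <= delta k.
    by rewrite /delta ler_pM2r ?invr_gt0 // rad_decr // ltnW.
  by lra.
have zb : d <= normc (z0 - b k).
  rewrite leNgt; apply/negP => lt; apply: (b_out (n := k)); apply: dG.
  by rewrite normc_sub.
have := normc_dist_le z0 (p k) (b k); have := p_b k => t2 t3.
have ek : eps k < d / 4.
  apply: le_lt_trans (eps_le k) _; apply: le_lt_trans hK; rewrite div1r.
  by rewrite lef_pV2 ?posrE ?exprn_gt0 // ler_eXn2l // ltr1n.
have := rad_lt_eps k; rewrite /delta; lra.
Qed.

(** In the disc about p k the equation for a zero is that of the local model at
    s = sigma k / (z - p k). Away from p k itself local uniqueness in s applies;
    near p k, where s is large, there are no zeros but p k, and [zero_at_root]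
    determines the unit there. *)
Lemma near_root_zeros_isolated k z0 : normc (z0 - p k) < 2 * delta k ->
  exists2 r : R, 0 < r & forall z1 z2 I1 I2,
    normc (z1 - z0) < r -> normc (z2 - z0) < r -> 
    0 <= complex.Im z1 -> 0 <= complex.Im z2 ->
    pseudosphere A I1 -> pseudosphere A I2 ->
    ACmul (plus_i I1) (F z1) = 0 -> ACmul (plus_i I2) (F z2) = 0 ->
    z1 = z2 /\ I1 = I2.
Proof.
move=> z0k; have dk := delta_gt0 k; have sk := sigma_gt0 k.
have [[T noz] uniq] := spikes_ok k.
have [eta [teta heta]] := rest_small k.
have closeG z : normc (z - z0) < delta k -> normc (z - p k) < rad k / 4.
  by move=> h; have := normc_dist_le z z0 (p k); have := rad_gt0 k; rewrite /delta in h z0k *; lra.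
have inG z : normc (z - z0) < delta k -> G z.
  move=> h; apply: (@rad_G k); apply: lt_trans (closeG _ h) _.
  by have := rad_gt0 k; lra.
have aw z : normc (z - z0) < delta k -> 0 <= complex.Im z -> away_region p delta k z.
  by move=> h Iz; apply: close_away => //; exact: closeG.
pose s z : R[i] := (sigma k)%:C * (z - p k)^-1.
have ns z : normc (s z) = sigma k / normc (z - p k).
  by rewrite /s Normc.normcM Normc.normcV normc_real gtr0_norm.
have eqn z I : normc (z - z0) < delta k -> 0 <= complex.Im z -> z != p k ->
    ACmul (plus_i I) (F z) = 0 ->
    ACmul (plus_i I) (creal aone + spike J0 (J k) (tau k) (s z) + eta z) = 0.
  move=> h Iz zk X0; have a := aw z h Iz.
  exact: (model_equation a (inG _ h) zk (heta z a) X0).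
have eta_le z : normc (z - z0) < delta k -> 0 <= complex.Im z -> ACnorm (eta z) <= k0.
  by move=> h Iz; apply: le_trans kappa_k0; apply: teta.1; exact: aw.
have [z0E|z0p] := eqVneq z0 (p k).
  pose r := Num.min (delta k) (sigma k / (1 + `|T|)).
  have T1 : 0 < 1 + `|T| by rewrite ltr_pwDl.
  exists r; first by rewrite lt_min dk divr_gt0.
  have only z I : normc (z - z0) < r -> 0 <= complex.Im z -> 
      ACmul (plus_i I) (F z) = 0 -> z = p k.
    rewrite lt_min => /andP[h1 h2] Iz X0; apply/eqP; apply/negP => /negP zk.
    have zk0 : 0 < normc (z - p k) by rewrite normc_gt0 subr_eq0.
    apply: (noz I (s z) (eta z)) (eqn _ _ h1 Iz zk X0); last exact: eta_le.
    rewrite ns ltr_pdivlMr //.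
    move: h2; rewrite z0E ltr_pdivlMr // mulrC; apply: le_lt_trans.
    by rewrite ler_wpM2r ?normc_ge0 //; have := ler_norm T; lra.
  move=> z1 z2 I1 I2 n1 n2 m1 m2 u1 u2 x1 x2.
  have e1 := only _ _ n1 m1 x1; have e2 := only _ _ n2 m2 x2.
  rewrite e1 in x1; rewrite e2 in x2; split; first by rewrite e1 e2.
  by rewrite ((zero_at_root k u1).1 x1) ((zero_at_root k u2).1 x2).
have m0 : 0 < normc (z0 - p k) by rewrite normc_gt0 subr_eq0.
set m := normc (z0 - p k) in m0 *.
have [rs [rs0 hrs]] := uniq (s z0).
pose r := Num.min (Num.min (delta k) (m / 2)) (rs * m ^+ 2 / (2 * sigma k)).
exists r.
  rewrite !lt_min dk divr_gt0 //=.
  by rewrite divr_gt0 // mulr_gt0 // exprn_gt0.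
have zfar z : normc (z - z0) < m / 2 -> m / 2 < normc (z - p k).
  by move=> h; have := normc_dist_le z0 z (p k); rewrite (normc_sub z0 z) -/m; lra.
have zne z : normc (z - z0) < m / 2 -> z - p k != 0.
  move=> /zfar h; rewrite -normc_gt0; apply: lt_trans h; by rewrite divr_gt0.
have ds x y : x - p k != 0 -> y - p k != 0 ->
    normc (s x - s y) = sigma k * normc (x - y) / (normc (x - p k) * normc (y - p k)).
  move=> xp yp; have -> : s x - s y = - ((sigma k)%:C * (x - y)) * ((x - p k) * (y - p k))^-1.
    by rewrite /s; field; rewrite xp yp.
  by rewrite Normc.normcM normc_opp Normc.normcV !Normc.normcM normc_real gtr0_norm.
have z0p' : z0 - p k != 0 by rewrite subr_eq0.
have snear z : normc (z - z0) < r -> normc (s z - s z0) < rs.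
  rewrite !lt_min => /andP[/andP[_ h1] h2].
  rewrite (ds _ _ (zne _ h1) z0p') -/m ltr_pdivrMr; last first.
    by rewrite mulr_gt0 // normc_gt0 zne.
  move: h2; rewrite ltr_pdivlMr ?mulr_gt0 // => h2.
  have h3 := ltr_pM2r m0 (m / 2) (normc (z - p k)).
  have := zfar _ h1; rewrite -h3 => h4.
  have := ltr_pM2l rs0 (m / 2 * m) (normc (z - p k) * m); rewrite h4 => h5.
  rewrite expr2 in h2; lra.
move=> z1 z2 I1 I2 n1 n2 m1 m2 u1 u2 x1 x2.
have [s1 s2] := (snear _ n1, snear _ n2).
move: n1 n2; rewrite !lt_min => /andP[/andP[d1 h1] _] /andP[/andP[d2 h2] _].
have [ne1 ne2] := (zne _ h1, zne _ h2).
have p1 : z1 != p k by rewrite -subr_eq0.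
have p2 : z2 != p k by rewrite -subr_eq0.
have sC0 : (sigma k)%:C != 0 :> R[i] by rewrite -normc_gt0 normc_real gtr0_norm.
have sn1 : s z1 != 0 by rewrite mulf_neq0 ?invr_neq0.
have sn2 : s z2 != 0 by rewrite mulf_neq0 ?invr_neq0.
have [|-> se] := hrs _ _ _ _ _ _ s1 s2 sn1 sn2 (eta_le _ d1 m1) (eta_le _ d2 m2) _
  (eqn _ _ d1 m1 p1 x1) (eqn _ _ d2 m2 p2 x2).
  apply: le_trans (teta.2 _ _ (aw _ d1 m1) (aw _ d2 m2)) _.
  have q1 : normc (z1 - p k) != 0 by rewrite normc_eq0.
  have q2 : normc (z2 - p k) != 0 by rewrite normc_eq0.
  have -> : normc (s z1 - s z2) / (normc (s z1) * normc (s z2)) = normc (z1 - z2) / sigma k.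
    by rewrite ds // !ns; field; rewrite q1 q2 gt_eqF.
  apply: ler_pM; rewrite ?normc_ge0 ?mulr_ge0 ?(ltW kappa_gt0) //.
  rewrite ler_pdivlMr // ler_piMr ?normc_ge0 //.
  apply: le_trans (sigma_le k) _; rewrite invf_le1 ?exprn_gt0 //.
  by rewrite exprn_ege1 // ler1n.
split=> //; apply/eqP; rewrite -subr_eq0.
move/eqP: se; rewrite -subr_eq0 -normc_eq0 ds // !mulf_eq0 (gt_eqF sk) /=.
by rewrite invr_eq0 mulf_eq0 !normc_eq0 (negbTE ne1) (negbTE ne2) /= orbF.
Qed.

Lemma far_away z : 0 <= complex.Im z -> (forall k, delta k <= normc (z - p k)) ->
  away_region p delta 0 z /\ delta 0 <= normc (z - p 0%N).
Proof.
move=> Iz h; split=> //; split=> [j _|j] //.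
have : `|complex.Im (z^* - p j)| <= normc (z^* - p j) by exact: Im_le_normc.
have -> : complex.Im (z^* - p j) = - (complex.Im z + complex.Im (p j)).
  by case: (z) => x y; case: (p j) => x' y' /=; rewrite opprD.
rewrite normrN ger0_norm; have := rad_Im j; have := rad_gt0 j; rewrite /delta; lra.
Qed.

Lemma zeros_isolated z0 : G z0 -> exists2 r : R, 0 < r & forall z1 z2 I1 I2,
    G z1 -> G z2 -> normc (z1 - z0) < r -> normc (z2 - z0) < r ->
    0 <= complex.Im z1 -> 0 <= complex.Im z2 ->
    pseudosphere A I1 -> pseudosphere A I2 ->
    ACmul (plus_i I1) (F z1) = 0 -> ACmul (plus_i I2) (F z2) = 0 ->
    z1 = z2 /\ I1 = I2.
Proof.
move=> Gz0; have [[k hk]|no] := pselect (exists k, normc (z0 - p k) < 2 * delta k).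
  have [r r0 hr] := near_root_zeros_isolated hk; exists r => // z1 z2 I1 I2 _ _.
  exact: hr.
have [|r r0 hr] := far_from_roots Gz0.
  by move=> k; rewrite leNgt; apply/negP => lt; apply: no; exists k.
exists r => // z1 z2 I1 I2 G1 G2 n1 n2 m1 m2 u1 u2 x1 _.
have [aw z10] := far_away m1 (hr _ n1).
by case: (off_no_zero G1 aw z10 x1).
Qed.

(** The point is chosen just outside the disc about p 0, at the same height. *)
Lemma left_regular_point : exists z, G z /\ forall w, ACmul (F z) w = 0 -> w = 0.
Proof.
pose z := p 0%N + (2 * delta 0)%:C.
have d0 := delta_gt0 0%N; have r0 := rad_gt0 0%N.
have zp : normc (z - p 0%N) = 2 * delta 0.
  by rewrite /z addrC addKr normc_real ger0_norm // mulr_ge0 // ltW.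
have zc : normc (z - p 0%N) < rad 0%N / 4 by rewrite zp /delta; lra.
have Iz : 0 <= complex.Im z.
  have -> : complex.Im z = complex.Im (p 0%N) by rewrite /z; case: (p 0%N) => x y /=; rewrite addr0.
  by apply: le_trans (rad_Im 0%N); exact: ltW.
have Gz : G z by apply: (@rad_G 0%N); apply: lt_trans zc _; lra.
exists z; split=> // w; apply: off_left_regular => //; first exact: close_away.
by rewrite zp; lra.
Qed.

End Zeros.

(** * Choice of the zeros *)

Lemma injective_unbounded (g : nat -> nat) : injective g -> forall N, exists j, (N <= g j)%N.
Proof.
move=> gi N; have [[j hj]|no] := pselect (exists j, (N <= g j)%N); first by exists j.
have lt j : (g j < N)%N by rewrite ltnNge; apply/negP => h; apply: no; exists j.
have := @uniq_leq_size _ (map g (iota 0 N.+1)) (iota 0 N).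
rewrite map_inj_uniq // iota_uniq size_map !size_iota => /(_ isT).
rewrite ltnn => h; suff : false by []; apply: h => _ /mapP[j _ ->].
by rewrite mem_iota lt.
Qed.

Section DenseSequence.
Variables (R : realType) (A : altStarAlgType R).

Lemma rat_approx (x r : R) : 0 < r -> exists q : rat, `|ratr q - x| < r.
Proof.
move=> r0; have [|q] := @rat_in_itvoo R (x - r) (x + r); first by lra.
by rewrite in_itv /= => /andP[h1 h2]; exists q; rewrite ltr_norml; lra.
Qed.

(** For every radius 1 / (k + 1) and every pair with rational coordinates, a
    point of E is picked within that radius of the pair if there is one; the
    triples of a radius, a pair and an idle index are then enumerated. *)
Lemma dense_sequence (E : set (R[i] * A)) : E !=set0 ->
  exists b : nat -> R[i], exists J : nat -> A, (forall n, E (b n, J n)) /\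
  forall z I, E (z, I) -> forall (r : R) N, 0 < r -> exists n, [/\ (N <= n)%N,
    normc (b n - z) < r & ACnorm (creal (J n - I)) < r].
Proof.
move=> [[z0 I0] E0]; pose a := \dim (@fullv R A).
pose e (i : 'I_a) : A := (vbasis (@fullv R A))`_i.
(* the second index is idle: it makes every choice occur infinitely often *)
pose T : countType := (nat * nat * (rat * rat) * {ffun 'I_a -> rat})%type.
pose near (t : T) (p : R[i] * A) := E p /\
  normc (p.1 - ((ratr t.1.2.1 : R) +i* (ratr t.1.2.2 : R))) < (t.1.1.1.+1%:R)^-1 /\
  ACnorm (creal (p.2 - \sum_i (ratr (t.2 i) : R) *: e i)) < (t.1.1.1.+1%:R)^-1.
have ex (o : option T) : exists p, E p /\
    (forall t, o = Some t -> (exists p', near t p') -> near t p).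
  case: o => [t|]; last by exists (z0, I0).
  have [[p hp]|no] := pselect (exists p, near t p).
    by exists p; split=> [|_ [<-]]; first by case: hp.
  by exists (z0, I0); split=> // _ [<-].
have [f hf] := choice ex.
exists (fun n => (f (unpickle n)).1), (fun n => (f (unpickle n)).2); split=> [n|].
  by have [+ _] := hf (unpickle n); case: (f _).
move=> z I EzI r N r0.
have [k hk] : exists k : nat, (k.+1%:R)^-1 < r / 2.
  have r2 : 0 < (r / 2)^-1 by rewrite invr_gt0 divr_gt0.
  exists (Num.bound (r / 2)^-1).
  rewrite invf_plt ?posrE ?divr_gt0 //.
  by apply: lt_trans (archi_boundP (ltW r2)) _; rewrite ltr_nat.
pose d : R := (k.+1%:R)^-1; have d0 : 0 < d by rewrite invr_gt0.
have d2 : 0 < d / 2 by rewrite divr_gt0.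
have [q1 hq1] := rat_approx (complex.Re z) d2.
have [q2 hq2] := rat_approx (complex.Im z) d2.
have a0 : 0 < d / (1 + a%:R) by rewrite divr_gt0 // ltr_pwDl.
have [g hg] := choice (fun i : 'I_a => rat_approx (coordA i I) a0).
pose t j : T := (k, j, (q1, q2), [ffun i => g i]).
have nz : normc (z - (ratr q1 +i* ratr q2)) < d.
  apply: le_lt_trans (normc_le_ReIm _) _; case: (z) hq1 hq2 => x y /=.
  by rewrite (distrC x) (distrC y); lra.
have nI : ACnorm (creal (I - \sum_i (ratr ([ffun i => g i] i) : R) *: e i)) < d.
  rewrite ACnorm_creal.
  apply: (@le_lt_trans _ _ (\sum_(i < a) (d / (1 + a%:R)))).
    apply: ler_sum => i _; apply/ltW; rewrite coordA_D coordA_N.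
    rewrite [X in _ - X](_ : _ = ratr (g i)); first by rewrite distrC.
    rewrite /coordA coord_sum_free ?(basis_free (vbasisP _)) //.
    by rewrite ffunE.
  rewrite sumr_const card_ord -[_ *+ a]mulr_natl mulrCA gtr_pMr //.
  by rewrite ltr_pdivrMr ?ltr_pwDl // mul1r ltrDr.
have inj : injective (fun j => pickle (t j)).
  by move=> j j' /(pcan_inj (@pickleK T)) [].
have [j hj] := injective_unbounded inj N.
exists (pickle (t j)); rewrite pickleK.
have [_ /(_ (t j) erefl)] := hf (Some (t j)).
move=> /(_ (ex_intro _ (z, I) (conj EzI (conj nz nI)))) [_ [n1 n2]].
split=> //.
  apply: le_lt_trans (normc_dist_le _ (ratr q1 +i* ratr q2) _) _.
  have n1' : normc ((f (Some (t j))).1 - (ratr q1 +i* ratr q2)) < d := n1.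
  by rewrite (normc_sub (ratr q1 +i* ratr q2) z); rewrite -/d in hk; lra.
set c := \sum_i _ in nI n2.
have := ACnorm_crealD ((f (Some (t j))).2 - c) (c - I); rewrite addrA subrK.
have -> : ACnorm (creal (c - I)) = ACnorm (creal (I - c)).
  by rewrite -ACnormN; congr ACnorm; apply: AC_eqE; rewrite /= ?opprB ?oppr0.
move=> h; apply: le_lt_trans h _.
by have n2' : ACnorm (creal ((f (Some (t j))).2 - c)) < d := n2; rewrite -/d in hk; lra.
Qed.

(** The distance from p n.+1 to b n.+1 is chosen after the radius of the disc
    about p n, which is what keeps the discs apart. *)
Lemma approximating_sequence (G : set R[i]) (b : nat -> R[i]) :
  (forall n (e : R), 0 < e -> exists z (r : R), [/\ 0 < r, r <= complex.Im z,
     normc (z - b n) < e & forall z', normc (z' - z) < r -> G z']) ->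
  exists (p : nat -> R[i]) (eps rad : nat -> R), [/\
    forall n, normc (p n - b n) < eps n,
    forall n, eps n <= (2 ^+ n)^-1,
    forall n, eps n.+1 <= rad n / 2,
    forall n, 0 < rad n /\ rad n <= complex.Im (p n) &
    forall n z, normc (z - p n) < rad n -> G z].
Proof.
move=> h; pose S := (nat * {e : R | 0 < e})%type.
have ex (s : S) : exists zr : R[i] * R, [/\ 0 < zr.2, zr.2 <= complex.Im zr.1,
    normc (zr.1 - b s.1) < sval s.2 & forall z', normc (z' - zr.1) < zr.2 -> G z'].
  by case: s => n [e e0]; have [z [r hr]] := h n e e0; exists (z, r).
have [f hf] := choice ex.
have next_pos (n : nat) (e : {e : R | 0 < e}) : 0 < Num.min (sval e / 2) ((f (n, e)).2 / 2).
  by rewrite lt_min !divr_gt0 ?(svalP e) //; have [] := hf (n, e).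
pose epsS := fix E n : {e : R | 0 < e} :=
  if n is m.+1 then exist (fun e : R => is_true (0 < e)) _ (next_pos m (E m))
  else exist (fun e : R => is_true (0 < e)) 1 ltr01.
pose eps n := sval (epsS n).
exists (fun n => (f (n, epsS n)).1), eps, (fun n => (f (n, epsS n)).2).
split=> [n|n|n|n|n].
- by have [] := hf (n, epsS n).
- elim: n => [|n IH]; first by rewrite expr0 invr1.
  rewrite /eps /= ge_min; apply/orP; left.
  by rewrite exprS invfM [2^-1 * _]mulrC ler_wpM2r.
- by rewrite /eps /= ge_min lexx orbT.
- by have [] := hf (n, epsS n).
- by have [] := hf (n, epsS n).
Qed.

End DenseSequence.

(** * Coordinates on the quadratic cone *)

Section Cone.
Variables (R : realType) (A : altStarAlgType R).
Implicit Types (x y : R) (I J q w : A).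

Let nA (x : A) : R := ACnorm (creal x).

Lemma areal_inj : injective (@areal R A).
Proof.
move=> x y /eqP; rewrite /areal -subr_eq0 -scalerBl scaler_eq0 (negbTE (@aone_neq0 _ A)).
by rewrite orbF subr_eq0 => /eqP.
Qed.

Lemma star_slice x y I : pseudosphere A I ->
  star (slice_point x y I) = slice_point x (- y) I.
Proof.
by move=> hI; rewrite /slice_point starD star_real starZ pseudosphere_star // scalerN scaleNr.
Qed.

Lemma slice_trace x y I : pseudosphere A I ->
  slice_point x y I + star (slice_point x y I) = areal A (2 * x).
Proof.
move=> hI; rewrite star_slice // /slice_point scaleNr addrACA subrr addr0 /areal.
by rewrite -scalerDl mulr2n mulrDl !mul1r.
Qed.

Lemma slice_norm x y I : pseudosphere A I ->
  slice_point x y I ** star (slice_point x y I) = areal A (x ^+ 2 + y ^+ 2).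
Proof.
move=> hI; rewrite star_slice // /slice_point /areal.
rewrite amulDl !amulDr !amulZl !amulZr !amul1l !amul1r pseudosphere_sqr //.
by apply: coord_ext => i; rewrite !(coordA_D, coordA_Z, coordA_N); ring.
Qed.

Lemma slice_inj x y I x' y' I' : pseudosphere A I -> pseudosphere A I' ->
  slice_point x y I = slice_point x' y' I' ->
  [/\ x = x', y ^+ 2 = y' ^+ 2 & y *: I = y' *: I'].
Proof.
move=> hI hI' e; have := slice_trace x y hI; have := slice_norm x y hI.
rewrite e slice_trace // slice_norm // => /areal_inj n /areal_inj t.
have xx : x = x' by lra.
split=> //; first by rewrite xx in n; lra.
by move: e; rewrite /slice_point xx => /addrI.
Qed.

Lemma slice_flip x y I : slice_point x y I = slice_point x (- y) (- I).
Proof. by rewrite /slice_point scalerN scaleNr opprK. Qed.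

Lemma slice_point_cone x y I : pseudosphere A I -> quadratic_cone A (slice_point x y I).
Proof.
move=> hI; have [->|y0] := eqVneq y 0.
  by left; exists x => //; rewrite /slice_point scale0r addr0.
right; exists (2 * x), (x ^+ 2 + y ^+ 2); split; first exact: slice_trace.
  exact: slice_norm.
have : 0 < y ^+ 2 by rewrite exprn_even_gt0.
lra.
Qed.

(** With trace t and norm n of q, the element q - t / 2 squares to
    (t / 2)^2 - n < 0, hence is a positive multiple of an imaginary unit. *)
Lemma cone_slice J0 q : pseudosphere A J0 -> quadratic_cone A q ->
  exists x y I, [/\ 0 <= y, pseudosphere A I & q = slice_point x y I].
Proof.
move=> hJ0 [[x _ <-]|[t [n [tr nr tn]]]].
  by exists x, 0, J0; split=> //; rewrite /slice_point scale0r addr0.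
pose y := Num.sqrt (n - (t / 2) ^+ 2).
have y2 : y ^+ 2 = n - (t / 2) ^+ 2 by rewrite sqr_sqrtr //; lra.
have y0 : 0 < y by rewrite sqrtr_gt0; lra.
have sq : star q = areal A t - q by rewrite -tr addrC addKr.
exists (t / 2), y, (y^-1 *: (q - areal A (t / 2))); split; first exact: ltW.
  have sI : star (y^-1 *: (q - areal A (t / 2))) = - (y^-1 *: (q - areal A (t / 2))).
    rewrite starZ starD starN star_real sq /areal.
    by apply: coord_ext => i; rewrite !(coordA_D, coordA_Z, coordA_N); field; rewrite gt_eqF.
  split; first by rewrite sI subrr.
  rewrite sI amulNr amulZl amulZr.
  have qq : q ** q = t *: q - n *: aone.
    by rewrite -[n *: _]nr sq amulBr /areal amulZr amul1r subKr.
  rewrite /areal amulBl !amulBr !amulZl !amulZr !amul1l !amul1r qq.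
  have ny : n = y ^+ 2 + (t / 2) ^+ 2 by rewrite y2 subrK.
  apply: coord_ext => i; rewrite !(coordA_D, coordA_Z, coordA_N) ny.
  by field; rewrite gt_eqF.
by rewrite /slice_point scalerA divff ?gt_eqF // scale1r addrC subrK.
Qed.

Lemma star_bounded : exists2 C : R, 0 < C & forall w, nA (star w) <= C * nA w.
Proof.
have [C1 [C10 h1]] := @norm_le_ACnorm R A.
pose e (i : 'I_(\dim (@fullv R A))) : A := (vbasis (@fullv R A))`_i.
pose S := \sum_i nA (star (e i)).
have S0 : 0 <= S by apply: sumr_ge0 => i _; exact: ACnorm_ge0.
exists (1 + S); first by rewrite ltr_pwDl.
move=> w.
have nAD (a b : A) : nA (a + b) <= nA a + nA b by exact: ACnorm_crealD.
have nAZ a (b : A) : nA (a *: b) = `|a| * nA b by exact: ACnorm_crealZ.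
have nA0 : nA 0 = 0 by rewrite -(scale0r (0 : A)) nAZ normr0 mul0r.
have step (s : seq 'I_(\dim (@fullv R A))) :
   nA (star (\sum_(i <- s) coordA i w *: e i)) <= \sum_(i <- s) `|coordA i w| * nA (star (e i)).
  elim: s => [|i s IH]; first by rewrite !big_nil star0 nA0.
  rewrite !big_cons starD starZ; apply: le_trans (nAD _ _) _.
  by rewrite nAZ lerD2l.
rewrite {1}(coordA_sumE w); apply: le_trans (step _) _.
apply: (@le_trans _ _ (\sum_i (nA w * nA (star (e i))))).
  apply: ler_sum => i _; rewrite ler_wpM2r ?ACnorm_ge0 //.
  by rewrite /nA ACnorm_creal (bigD1 i) //= lerDl sumr_ge0.
rewrite -mulr_sumr -/S mulrC ler_wpM2r ?ACnorm_ge0 // lerDr //.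
Qed.

(** The trace 2 x and the norm x^2 + y^2 are continuous on the cone, and they
    determine x and y when 0 <= y. The unit is not controlled: it is undetermined
    at real points. *)
Lemma slice_coordinates_continuous x y I (e : R) : 0 <= y -> pseudosphere A I -> 0 < e ->
  exists2 d : R, 0 < d & forall x' y' I', 0 <= y' -> pseudosphere A I' ->
    nA (slice_point x' y' I' - slice_point x y I) < d ->
    normc ((x' +i* y') - (x +i* y)) < e.
Proof.
move=> y0 hI e0; have [mu [mu1 hmu]] := @ACmul_bounded R A.
have [C C0 hC] := star_bounded.
pose q := slice_point x y I; pose n1 := nA aone.
have n10 : 0 < n1 := ACnorm_one_gt0 A.
have nAD (a b : A) : nA (a + b) <= nA a + nA b by exact: ACnorm_crealD.
have nAM (a b : A) : nA (a ** b) <= mu * nA a * nA b.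
  have := hmu (creal a) (creal b); rewrite (_ : ACmul _ _ = creal (a ** b)) //.
  by apply: AC_eqE; rewrite /= ?amul0l ?amul0r ?subr0 ?addr0.
have nAr a : nA (areal A a) = `|a| * n1 by exact: ACnorm_crealZ.
have starB (a b : A) : star (a - b) = star a - star b by rewrite starD starN.
pose M := 1 + nA q; have M1 : 0 < M by rewrite ltr_pwDl ?ACnorm_ge0.
have mu0 : 0 < mu by exact: lt_le_trans mu1.
pose K1 := (1 + C) / n1; pose X := K1 * M.
pose K3 := 2 * mu * C * M / n1 + K1 * (2 * X).
have K10 : 0 < K1 by rewrite divr_gt0 // addr_gt0.
have X0 : 0 < X by rewrite mulr_gt0.
have K30 : 0 < K3.
  apply: addr_gt0; last by apply: mulr_gt0 K10 _; apply: mulr_gt0.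
  by apply: divr_gt0 => //; do 3!apply: mulr_gt0 => //.
have e2 : 0 < e / 2 by rewrite divr_gt0.
pose d := Num.min 1 (Num.min ((e / 2) / K1) ((e / 2) ^+ 2 / K3)).
exists d.
  rewrite !lt_min ltr01 /=; apply/andP; split; apply: divr_gt0 => //.
  exact: exprn_gt0.
move=> x' y' I' y'0 hI'; set q' := slice_point x' y' I'; rewrite -/q.
set D := nA (q' - q); rewrite !lt_min => /andP[D1 /andP[Da Db]].
have D0 : 0 <= D by exact: ACnorm_ge0.
have q'M : nA q' <= M by have := nAD (q' - q) q; rewrite subrK -/D /M; lra.
have qM : nA q <= M by rewrite /M; lra.
have re u v I0 : pseudosphere A I0 -> nA (slice_point u v I0) <= M -> `|u| <= X.
  move=> hI0 hM; have := nAD (slice_point u v I0) (star (slice_point u v I0)).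
  rewrite slice_trace // nAr normrM ger0_norm // => h.
  have := hC (slice_point u v I0) => h2.
  have h3 := ler_wpM2l (ltW C0) hM.
  rewrite /X /K1 mulrAC ler_pdivlMr //; have := normr_ge0 u; nra.
have xX : `|x| <= X by exact: (re _ _ _ hI qM).
have x'X : `|x'| <= X by exact: (re _ _ _ hI' q'M).
have dx : `|x' - x| <= K1 * D.
  have := nAD (q' - q) (star (q' - q)).
  rewrite starB addrACA -opprD /q' /q !slice_trace // -/q -/q'.
  have -> : areal A (2 * x') - areal A (2 * x) = areal A (2 * (x' - x)).
    by rewrite /areal -scalerBl mulrBr.
  rewrite nAr normrM ger0_norm // -starB => h.
  have h2 := hC (q' - q); rewrite -/D in h h2.
  rewrite /K1 mulrAC ler_pdivlMr //; have := normr_ge0 (x' - x); nra.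
have dn : `|(x' ^+ 2 + y' ^+ 2) - (x ^+ 2 + y ^+ 2)| <= 2 * mu * C * M / n1 * D.
  have E : areal A ((x' ^+ 2 + y' ^+ 2) - (x ^+ 2 + y ^+ 2)) =
      (q' - q) ** star q' + q ** star (q' - q).
    rewrite starB amulBl amulBr /q' /q !slice_norm // -/q -/q' addrA subrK.
    by rewrite /areal -scalerBl.
  have := nAr ((x' ^+ 2 + y' ^+ 2) - (x ^+ 2 + y ^+ 2)); rewrite E => h.
  have h1 := nAM (q' - q) (star q'); have h2 := nAM q (star (q' - q)).
  have h3 := hC q'; have h4 := hC (q' - q); rewrite -/D in h1 h4.
  have h5 := nAD ((q' - q) ** star q') (q ** star (q' - q)).
  have muD : 0 <= mu * D by rewrite mulr_ge0 // ltW.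
  have muq : 0 <= mu * M by rewrite mulr_ge0 // ltW.
  have g1 : mu * D * nA (star q') <= mu * D * (C * M).
    by rewrite ler_wpM2l //; apply: le_trans h3 _; rewrite ler_pM2l.
  have g2 : mu * nA q * nA (star (q' - q)) <= mu * M * (C * D).
    apply: ler_pM; rewrite ?mulr_ge0 ?ACnorm_ge0 ?(ltW mu0) //.
    by rewrite ler_pM2l.
  by rewrite mulrAC ler_pdivlMr // -h; lra.
have dxx : `|x' ^+ 2 - x ^+ 2| <= K1 * (2 * X) * D.
  rewrite subr_sqr normrM.
  have : `|x' + x| <= 2 * X by apply: le_trans (ler_normD _ _) _; lra.
  by move=> h; rewrite mulrAC; apply: ler_pM.
have dyy : `|y' ^+ 2 - y ^+ 2| <= K3 * D.
  rewrite (_ : y' ^+ 2 - y ^+ 2 = ((x' ^+ 2 + y' ^+ 2) - (x ^+ 2 + y ^+ 2)) - (x' ^+ 2 - x ^+ 2));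
    last by ring.
  by apply: le_trans (ler_normB _ _) _; rewrite /K3 mulrDl lerD.
have dy : `|y' - y| < e / 2.
  rewrite ltNge; apply/negP => le.
  have h : `|y' - y| * `|y' - y| <= `|y' ^+ 2 - y ^+ 2|.
    rewrite subr_sqr normrM ler_wpM2l // [leRHS]ger0_norm ?addr_ge0 //.
    by rewrite ler_norml; lra.
  have h2 := ler_pM (ltW e2) (ltW e2) le le.
  move: Db; rewrite ltr_pdivlMr // mulrC expr2; lra.
have dxe : `|x' - x| < e / 2.
  by apply: le_lt_trans dx _; move: Da; rewrite ltr_pdivlMr // mulrC.
apply: le_lt_trans (normc_le_ReIm _) _ => /=; lra.
Qed.

End Cone.

(** * Existence of the stem function *)

Section Existence.
Variables (R : realType) (A : altStarAlgType R).

(** Injectivity is surjectivity in finite dimension, so that v w = 1 for some w;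
    then v (w v) = (v w) v = v by the flexible law, hence w v = 1. *)
Lemma left_regular_invertible (v : A * A) :
  (forall w, ACmul v w = 0 -> w = 0) -> ACinvertible v.
Proof.
move=> reg.
have lin : linear (ACmul v).
  move=> a x y; rewrite ACmulDr; congr (_ + _).
  by apply: AC_eqE; rewrite /= !amulZr ?scalerBr ?scalerDr.
pose L : {linear (A * A)%type -> (A * A)%type} := HB.pack (ACmul v) (GRing.isLinear.Build _ _ _ _ _ lin).
pose f := linfun L.
have fE w : f w = ACmul v w by rewrite lfunE.
have ker0 : lker f == 0%VS.
  by apply/lker0P => x y; rewrite !fE => e; apply/eqP; rewrite -subr_eq0; apply/eqP/reg;
     rewrite ACmulBr e subrr.
have img : limg f = fullv.
  apply/eqP; rewrite eqEdim subvf /= -(limg_ker_dim f fullv).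
  by rewrite (eqP ker0) capv0 dimv0 add0n.
have : creal aone \in limg f by rewrite img memvf.
move=> /memv_imgP[w _]; rewrite fE => vw; exists w; split; first by rewrite -vw.
apply/eqP; rewrite -subr_eq0; apply/eqP/reg.
by rewrite ACmulBr AC_flexible -vw ACmul1l ACmul1r subrr.
Qed.

Lemma stem_with_zeros (G : set R[i]) (b : nat -> R[i]) (J : nat -> A) :
  (forall z, G z <-> G z^*) ->
  (forall z, G z -> exists2 d : R, 0 < d & forall z', normc (z' - z) < d -> G z') ->
  (forall n, ~ G (b n)) -> (forall n, pseudosphere A (J n)) ->
  (forall n (e : R), 0 < e -> exists z, [/\ G z, 0 < complex.Im z & normc (z - b n) < e]) ->
  exists (F : R[i] -> A * A) (p : nat -> R[i]), [/\
    stem_function G F,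
    (forall n, [/\ G (p n), 0 < complex.Im (p n) & normc (p n - b n) <= (2 ^+ n)^-1]) /\
    (forall n, ACmul (plus_i (J n)) (F (p n)) = 0),
    forall z0, G z0 -> exists2 r : R, 0 < r & forall z1 z2 I1 I2,
      G z1 -> G z2 -> normc (z1 - z0) < r -> normc (z2 - z0) < r ->
      0 <= complex.Im z1 -> 0 <= complex.Im z2 ->
      pseudosphere A I1 -> pseudosphere A I2 ->
      ACmul (plus_i I1) (F z1) = 0 -> ACmul (plus_i I2) (F z2) = 0 ->
      z1 = z2 /\ I1 = I2 &
    exists z, G z /\ ACinvertible (F z)].
Proof.
move=> Gs Go bout hJ happ.
have [|p [eps [rad [pb epsle epsrad hrad radG]]]] := @approximating_sequence R G b.
  move=> n e e0; have [z [Gz Iz zb]] := happ n e e0; have [d d0 dG] := Go z Gz.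
  exists z, (Num.min d (complex.Im z)); split=> //.
  - by rewrite lt_min d0.
  - by rewrite ge_min lexx orbT.
  - by move=> z'; rewrite lt_min => /andP[h _]; exact: dG.
have rad0 n : 0 < rad n by have [] := hrad n.
have radI n : rad n <= complex.Im (p n) by have [] := hrad n.
have [mu [mu1 hmu]] := @ACmul_bounded R A.
have mu0 : 0 < mu by exact: lt_le_trans mu1.
pose J0 := J 0%N.
have [k0 [k00 [k01 spikes]]] := spike_model mu1 hmu (hJ 0%N).
have [tau htau] := choice (fun n => let: ex_intro2 t t0 ht := spikes (J n) (hJ n) in
  ex_intro (fun t => 0 < t /\ t * ACnorm ((aone, J n) : A * A) <= 1 /\ spike_ok J0 (J n) k0 t)
    t (conj t0 ht)).
pose kappa := Num.min (k0 / 2) (1 / (4 * mu)).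
have kappa0 : 0 < kappa by rewrite lt_min !divr_gt0 // mulr_gt0.
have kk : 2 * kappa <= k0 by rewrite mulrC -ler_pdivlMr // ge_min lexx.
have km : mu * (3 * kappa) < 1.
  have : kappa <= 1 / (4 * mu) by rewrite ge_min lexx orbT.
  by rewrite ler_pdivlMr ?mulr_gt0 //; lra.
pose delta n := rad n / 16.
have delta0 n : 0 < delta n by rewrite divr_gt0.
pose M0 := 6 * ACnorm (creal J0) + 4 * ACnorm (creal (aone : A)) + 8.
have M00 : 0 < M0.
  by rewrite ltr_wpDl // addr_ge0 // mulr_ge0 // ACnorm_ge0.
pose B n := (delta n)^-1 + (delta n)^-1 ^+ 2.
have B0 n : 0 < B n by rewrite addr_gt0 ?exprn_gt0 ?invr_gt0.
(* sigma is chosen last: its smallness depends on the radii and on kappa *)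
pose sigma n := Num.min (2 ^+ n)^-1 (kappa / 2 ^+ n.+1 / (2 * B n * M0)).
have D0 n : 0 < 2 * B n * M0 by rewrite !mulr_gt0.
have s0 n : 0 < sigma n.
  rewrite lt_min invr_gt0 exprn_gt0 //=; apply: divr_gt0 => //.
  by apply: divr_gt0 => //; exact: exprn_gt0.
have s1 n : sigma n <= (2 ^+ n)^-1 by rewrite ge_min lexx.
have s2 n : 2 * sigma n * B n * M0 <= kappa / 2 ^+ n.+1.
  have : sigma n <= kappa / 2 ^+ n.+1 / (2 * B n * M0) by rewrite ge_min lexx orbT.
  rewrite ler_pdivlMr //; apply: le_trans.
  by rewrite [2 * sigma n]mulrC !mulrA.
have t0 n : 0 < tau n by have [] := htau n.
have t1 n : tau n * ACnorm ((aone, J n) : A * A) <= 1 by have [_ []] := htau n.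
have ok n : spike_ok J0 (J n) k0 (tau n) by have [_ []] := htau n.
have pb' n : normc (p n - b n) <= (2 ^+ n)^-1 by exact: le_trans (ltW (pb n)) (epsle n).
have [F hF] := stem_limit_exists J0 pb' (fun n => ltW (s0 n)) s1 (fun n => ltW (t0 n)) t1
  Gs Go bout.
have Fl z : G z -> exists K : R, forall n,
  ACnorm (F z - stem b p J J0 sigma tau n z) <= K / 2 ^+ n by move=> /hF[].
have Gp n : G (p n) by have := @radG n (p n); rewrite subrr Normc.normc0; apply.
have kappa1 : kappa <= 1 by lra.
exists F, p; split.
- split=> z Gz; first by have [] := hF z Gz.
  exact: (stem_limit_conj Gs Gz Fl).
- split=> n; first by split=> //; exact: lt_le_trans (rad0 n) (radI n).
  exact: (zero_at_root hmu Gs Go bout pb epsle epsrad rad0 radG radI s0 t0 hJ Fl n (hJ n)).2.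
- exact: (zeros_isolated mu1 hmu Gs Go bout pb epsle epsrad rad0 radG radI s0 s1 t0 t1
    kappa0 kappa1 s2 hJ ok kk km Fl).
have [z [Gz hz]] : exists z, G z /\ forall w, ACmul (F z) w = 0 -> w = 0.
  exact: (left_regular_point mu1 hmu Gs Go bout pb epsle epsrad rad0 radG radI s0 t0 t1
    kappa0 kappa1 s2 km Fl).
exists z; split=> //; exact: left_regular_invertible.
Qed.

End Existence.

(** * The topology of the cone *)

Section ConeTopology.
Variables (R : realType) (A : altStarAlgType R).
Implicit Types (x y : R) (I J q w : A) (U : set (cone_space A)).

Let nA (x : A) : R := ACnorm (creal x).

Lemma nbhs_cone q U : quadratic_cone A q ->
  nbhs (q : cone_space A) U <-> exists2 r : R, 0 < r &
    forall w, quadratic_cone A w -> nA (w - q) < r -> U w.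
Proof.
move=> cq; have [C1 [C10 h1]] := @norm_le_ACnorm R A.
have [C2 [C20 h2]] := @ACnorm_le_norm R A.
have -> : nbhs (q : cone_space A) = within (quadratic_cone A) (nbhs q).
  by rewrite (nbhs_subspace_in cq).
split=> [/nbhs_normP[e /= e0 eU]|[r r0 rU]].
  exists (e / C1) => [|w cw wq]; first by rewrite divr_gt0.
  apply: eU => //; rewrite /ball_ /= distrC; apply: le_lt_trans (h1 _) _.
  by rewrite mulrC -ltr_pdivlMr.
apply/nbhs_normP; exists (r / C2) => /=; first by rewrite divr_gt0.
move=> w; rewrite /ball_ /= distrC => wq cw; apply: rU => //.
by apply: le_lt_trans (h2 _) _; rewrite mulrC -ltr_pdivlMr.
Qed.

Lemma nbhs_off_cone q U : ~ quadratic_cone A q -> U q -> nbhs (q : cone_space A) U.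
Proof.
move=> cq Uq; have -> : nbhs (q : cone_space A) = globally [set q].
  by rewrite (nbhs_subspace_out cq).
by move=> _ ->.
Qed.

Variables (G : set R[i]).
Hypothesis G_sym : forall z, G z <-> G z^*.
Hypothesis G_open : forall z, G z ->
  exists2 d : R, 0 < d & forall z', normc (z' - z) < d -> G z'.

Let Omega : set (cone_space A) := axially_symmetric_domain A G.

Lemma Omega_cone q : Omega q -> quadratic_cone A q.
Proof. by move=> [x [y [I [_ hI ->]]]]; exact: slice_point_cone. Qed.

Lemma Omega_upper q : Omega q -> exists x y I,
  [/\ 0 <= y, pseudosphere A I, G (x +i* y) & q = slice_point x y I].
Proof.
move=> [x [y [I [Gz hI qE]]]]; have [y0|y0] := leP 0 y; first by exists x, y, I.
exists x, (- y), (- I); split=> //; last by rewrite -slice_flip.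
- by rewrite oppr_ge0 ltW.
- exact: pseudosphereN.
by move/G_sym: Gz.
Qed.

(** The condition on a point of the cone only concerns its coordinates, which are
    continuous. *)
Lemma Omega_nbhs J0 q : pseudosphere A J0 -> Omega q -> nbhs (q : cone_space A) Omega.
Proof.
move=> hJ0 Oq; apply/nbhs_cone; first exact: Omega_cone.
have [x [y [I [y0 hI Gz qE]]]] := Omega_upper Oq.
have [d d0 dG] := G_open Gz.
have [r r0 hr] := slice_coordinates_continuous x y0 hI d0.
exists r => // w cw; rewrite qE.
have [x' [y' [I' [y'0 hI' ->]]]] := cone_slice hJ0 cw.
move=> /(hr _ _ _ y'0 hI') /dG Gz'.
by exists x', y', I'.
Qed.

(** Coordinates of points of Omega near q are points of G near those of q; as G
    is open, they can be raised into the open upper half plane. *)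
Lemma boundary_points q : boundary Omega q -> exists x y I,
  [/\ 0 <= y, pseudosphere A I, q = slice_point x y I, ~ G (x +i* y) &
      forall e : R, 0 < e -> exists z, [/\ G z, 0 < complex.Im z & normc (z - (x +i* y)) < e]].
Proof.
move=> [clq niq].
have cq : quadratic_cone A q.
  have [//|ncq] := pselect (quadratic_cone A q).
  have [w [Ow wq]] := clq [set q] (nbhs_off_cone ncq erefl).
  by rewrite -[q]wq; exact: Omega_cone.
have [_ [[x0 [y0 [J0 [_ hJ0 _]]]] _]] := clq setT filterT.
have [x [y [I [yge hI qE]]]] := cone_slice hJ0 cq.
exists x, y, I; split=> // [Gz|e e0].
  by apply: niq; apply: (Omega_nbhs hJ0); exists x, y, I.
have e2 : 0 < e / 2 by rewrite divr_gt0.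
have [r r0 hr] := slice_coordinates_continuous x yge hI e2.
have nq : nbhs (q : cone_space A) [set w | quadratic_cone A w /\ nA (w - q) < r].
  by apply/nbhs_cone => //; exists r.
have [w [Ow [cw wq]]] := clq _ nq.
have [x' [y' [I' [y'0 hI' Gz' wE]]]] := Omega_upper Ow.
have := hr x' y' I' y'0 hI'; rewrite -wE -qE => /(_ wq) near.
have [d d0 dG] := G_open Gz'.
pose m := Num.min (d / 2) (e / 2); have m0 : 0 < m by rewrite lt_min !divr_gt0.
have md : m <= d / 2 by rewrite ge_min lexx.
have me : m <= e / 2 by rewrite ge_min lexx orbT.
pose z : R[i] := x' +i* (y' + m).
have zm : normc (z - (x' +i* y')) = m.
  rewrite (_ : z - _ = m%:C * 'i%C).
    by rewrite Normc.normcM normc_i mulr1 normc_real gtr0_norm.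
  by apply: complex_eqE; rewrite /z /=; ring.
exists z; split; first by apply: dG; rewrite zm; lra.
  by rewrite /z /=; lra.
by have := normc_dist_le z (x' +i* y') (x +i* y); lra.
Qed.

Lemma slice_point_continuous x y I (e : R) : 0 < e -> exists2 d : R, 0 < d &
  forall x' y' I', normc ((x' +i* y') - (x +i* y)) < d -> nA (I' - I) < d ->
    nA (slice_point x' y' I' - slice_point x y I) < e.
Proof.
move=> e0; pose n1 := nA aone; pose n2 := nA I.
have [n10 n20] : 0 <= n1 /\ 0 <= n2 by split; exact: ACnorm_ge0.
have nAD (a b : A) : nA (a + b) <= nA a + nA b by exact: ACnorm_crealD.
have nAZ a (b : A) : nA (a *: b) = `|a| * nA b by exact: ACnorm_crealZ.
pose K := n1 + n2 + 1 + `|y| + 1.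
have y0 := normr_ge0 y; have K0 : 0 < K by rewrite /K; lra.
exists (Num.min 1 (e / K)); first by rewrite lt_min ltr01 divr_gt0.
move=> x' y' I'; set d := Num.min 1 (e / K) => zd Id.
have d1 : d <= 1 by rewrite ge_min lexx.
have dK : d * K <= e by rewrite -ler_pdivlMr // ge_min lexx orbT.
have dx : `|x' - x| < d by apply: le_lt_trans zd; exact: (Re_le_normc ((x' +i* y') - (x +i* y))).
have dy : `|y' - y| < d by apply: le_lt_trans zd; exact: (Im_le_normc ((x' +i* y') - (x +i* y))).
have -> : slice_point x' y' I' - slice_point x y I =
    (x' - x) *: aone + ((y' - y) *: I' + y *: (I' - I)).
  apply: coord_ext => i; rewrite /slice_point /areal !(coordA_D, coordA_Z, coordA_N); ring.
have I'n : nA I' <= n2 + 1 by have := nAD (I' - I) I; rewrite subrK -/n2; lra.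
have := nAD ((x' - x) *: aone) ((y' - y) *: I' + y *: (I' - I)).
have := nAD ((y' - y) *: I') (y *: (I' - I)); rewrite !nAZ -/n1.
have a1 : `|x' - x| * n1 <= d * n1 by rewrite ler_wpM2r // ltW.
have a2 : `|y' - y| * nA I' <= d * (n2 + 1).
  by apply: ler_pM; rewrite ?ACnorm_ge0 // ltW.
have a3 : `|y| * nA (I' - I) <= `|y| * d by rewrite ler_wpM2l // ltW.
have d0 : 0 < d by apply: le_lt_trans dx; exact: normr_ge0.
by rewrite /K in dK; lra.
Qed.

End ConeTopology.

(** * The slice function *)

Section Induced.
Variables (R : realType) (A : altStarAlgType R).

(** The value at a point of the cone does not depend on its coordinates: for
    y <> 0 these are unique up to changing the signs of y and I together, which
    conjugates F, and for y = 0 conjugation symmetry gives F'' = 0. *)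
Lemma induced_exists (G : set R[i]) (F : R[i] -> A * A) :
  stem_function G F -> exists f : A -> A, induced_by G f F.
Proof.
move=> [_ Fc].
pose rel (q v : A) := exists x y I, [/\ G (x +i* y), pseudosphere A I,
  q = slice_point x y I & v = (F (x +i* y)).1 + I ** (F (x +i* y)).2].
have ex q : exists v, (exists v', rel q v') -> rel q v.
  have [[v hv]|no] := pselect (exists v', rel q v'); first by exists v.
  by exists 0.
have [f hf] := choice ex; exists f => x y I Gz hI.
have [|x' [y' [I' [Gz' hI' e ->]]]] := hf (slice_point x y I).
  by exists ((F (x +i* y)).1 + I ** (F (x +i* y)).2), x, y, I.
have [xE /eqP yE yI] := slice_inj hI hI' e; rewrite -xE in Gz' *.
have cF u v : G (u +i* v) -> F (u +i* - v) = ACconj (F (u +i* v)) by move=> /Fc.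
have [y0|y0] := eqVneq y 0.
  rewrite y0 in Gz yE *; move: yE; rewrite expr0n eq_sym sqrf_eq0 => /eqP ->.
  have := cF x 0 Gz; rewrite oppr0 => /(congr1 snd) /= h.
  have -> : (F (x +i* 0)).2 = 0.
    apply: coord_ext => i; have := congr1 (coordA i) h.
    by rewrite coordA_N coordA_0; lra.
  by rewrite !amul0r.
move: yE; rewrite eqf_sqr => /orP[/eqP yy|/eqP yy].
  rewrite -yy in yI *; congr (_ + _ ** _).
  by have := congr1 (fun v : A => y^-1 *: v) yI; rewrite !scalerA mulVf // !scale1r.
have y'E : y' = - y by rewrite yy opprK.
rewrite y'E in yI *; rewrite cF //= amulNr -amulNl; congr (_ + _ ** _).
have := congr1 (fun v : A => y^-1 *: v) yI.
by rewrite !scalerA mulrN mulVf // scaleN1r scale1r.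
Qed.

Lemma empty_boundary_case (G : set R[i]) : symmetric_domain G ->
  boundary (axially_symmetric_domain A G : set (cone_space A)) = set0 ->
  exists (f : A -> A) (F : R[i] -> A * A),
    let Omega : set (cone_space A) := axially_symmetric_domain A G in
    let D : set (cone_space A) := [set q | Omega q /\ f q = 0] in
    [/\ stem_function G F, induced_by G f F, Omega `&` limit_point D = set0,
        closure D = D `|` boundary Omega /\ boundary Omega `<=` limit_point D
      & exists z, G z /\ ACinvertible (F z)].
Proof.
move=> [G0 _ _ _] b0; exists (fun=> aone), (fun=> (aone, 0)) => Omega D.
have D0 : D = set0.
  by apply/seteqP; split=> // q [_ /eqP]; rewrite (negbTE (@aone_neq0 _ A)).
split.
- split=> z _; last by apply: AC_eqE; rewrite //= oppr0.
  apply: (@cderivable_complex_derivable R A (fun=> (aone, 0)) z 0).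
  exact: (@cderivable_cst R (vectors A)).
- by move=> x y I _ _ /=; rewrite amul0r addr0.
- rewrite D0; apply/seteqP; split=> // q [_ /(_ setT filterT)] [w [_ []]].
- by rewrite D0 b0 setU0 closure0; split=> // ?.
have [z Gz] := G0; exists z; split=> //; exists (aone, 0).
by split; apply: AC_eqE; rewrite /= ?amul1l ?amul0l ?amul0r ?subr0 ?addr0.
Qed.

End Induced.

Theorem theorem18p1 (R : realType) (A : altStarAlgType R) (G : set R[i])
    (hG : symmetric_domain G) :
  exists (f : A -> A) (F : R[i] -> A * A),
    let Omega : set (cone_space A) := axially_symmetric_domain A G in
    let D : set (cone_space A) := [set q | Omega q /\ f q = 0] in
    [/\ stem_function G F,
        induced_by G f F,
        Omega `&` limit_point D = set0,
        closure D = D `|` boundary Omega /\ boundary Omega `<=` limit_point D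
      & exists z, G z /\ ACinvertible (F z)].
Proof.
have [_ oG Gs _] := hG; have Go := (open_normc G).1 oG.
(* the pairs of a point b outside G, approached from the upper part of G, and a unit *)
pose E : set (R[i] * A) := [set bI | [/\ ~ G bI.1, pseudosphere A bI.2 &
  forall e : R, 0 < e -> exists z, [/\ G z, 0 < complex.Im z & normc (z - bI.1) < e]]].
have bE q : boundary (axially_symmetric_domain A G : set (cone_space A)) q ->
    exists x y I, [/\ pseudosphere A I, q = slice_point x y I & E (x +i* y, I)].
  move=> /(boundary_points Gs Go)[x [y [I [_ hI qE nG app]]]].
  by exists x, y, I.
have [E0|noE] := pselect (E !=set0); last first.
  apply: empty_boundary_case => //; apply/seteqP; split=> // q /bE[x [y [I [_ _ EI]]]].
  by apply: noE; exists (x +i* y, I).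
have [b [J [bJ dense]]] := dense_sequence E0.
have nGb n : ~ G (b n) by have [] := bJ n.
have hJ n : pseudosphere A (J n) by have [] := bJ n.
have happ n e : 0 < e -> exists z, [/\ G z, 0 < complex.Im z & normc (z - b n) < e].
  by have [_ _] := bJ n; exact.
have [F [p [stemF [hp zp] iso inv]]] := stem_with_zeros Gs Go nGb hJ happ.
have [f indf] := induced_exists stemF.
have hJ0 := hJ 0%N.
exists f, F => Omega D.
have f0 x y I : G (x +i* y) -> pseudosphere A I ->
    f (slice_point x y I) = 0 <-> ACmul (plus_i I) (F (x +i* y)) = 0.
  by move=> Gz hI; rewrite indf // plus_i_mul_eq0.
have DO : D `<=` Omega by move=> q [].
(* two distinct zeros of f near q would give two equal pairs of z and I *)
have isolated q : Omega q -> ~ limit_point D q.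
  move=> Oq lq; have cq := Omega_cone Oq.
  have [x [y [I [y0 hI Gz qE]]]] := Omega_upper Gs Oq.
  have [r r0 hr] := iso _ Gz.
  have [d d0 hd] := slice_coordinates_continuous x y0 hI r0.
  have near w : D w -> ACnorm (creal (w - q)) < d -> exists x' y' I', [/\ 0 <= y',
      pseudosphere A I', G (x' +i* y') & [/\ w = slice_point x' y' I',
      normc ((x' +i* y') - (x +i* y)) < r & ACmul (plus_i I') (F (x' +i* y')) = 0]].
    move=> [Ow fw] wq; have [x' [y' [I' [y'0 hI' Gz' wE]]]] := Omega_upper Gs Ow.
    exists x', y', I'; split=> //; split=> //; last by apply/f0; rewrite // -wE.
    by apply: (hd _ _ I') => //; rewrite -wE -qE.
  have pos w : w != q -> 0 < ACnorm (creal (w - q)).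
    move=> wq; apply: ACnorm_gt0; apply/eqP => -[/eqP].
    by rewrite subr_eq0 (negbTE wq).
  have nb e : 0 < e -> nbhs (q : cone_space A)
      [set w : cone_space A | ACnorm (creal ((w : A) - q)) < e].
    by move=> e0; apply/nbhs_cone => //; exists e.
  have [w1 [w1q Dw1 n1]] := lq _ (nb d d0).
  have [w2 [w2q Dw2 n2]] := lq _ (nb _ (pos w1 w1q)).
  have [x1 [y1 [I1 [y10 hI1 G1 [e1 m1 z1]]]]] := near _ Dw1 n1.
  have [x2 [y2 [I2 [y20 hI2 G2 [e2 m2 z2]]]]] := near _ Dw2 (lt_trans n2 n1).
  have [[xx yy] II] := hr _ _ _ _ G1 G2 m1 m2 y10 y20 hI1 hI2 z1 z2.
  by move: n2; rewrite /= e2 e1 xx yy II ltxx.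
(* E contains the coordinates and the unit of q, and b n, J n are dense in E *)
have accum : boundary Omega `<=` limit_point D.
  move=> q bq U nU; have [x [y [I [hI qE EI]]]] := bE q bq.
  have nOq : ~ Omega q.
    by move=> Oq; have [_] := bq; apply; apply: (Omega_nbhs Gs Go hJ0 Oq).
  have cq : quadratic_cone A q by rewrite qE; exact: slice_point_cone.
  have [r r0 rU] := (nbhs_cone U cq).1 nU.
  have [d d0 hd] := slice_point_continuous x y I r0.
  have d2 : 0 < d / 2 by rewrite divr_gt0.
  have [N hN] := geometric_small 1 d2.
  have [n [Nn nb nJ]] := dense _ _ EI (d / 2) N d2.
  have [Gp Ip pb] := hp n.
  pose w := slice_point (complex.Re (p n)) (complex.Im (p n)) (J n).
  have pE : complex.Complex (complex.Re (p n)) (complex.Im (p n)) = p n by case: (p n).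
  have Dw : D w.
    have Gq : G (complex.Complex (complex.Re (p n)) (complex.Im (p n))) by rewrite pE.
    split; first by exists (complex.Re (p n)), (complex.Im (p n)), (J n).
    by apply/f0; rewrite ?pE.
  exists w; split=> //.
    by apply/eqP => wq; apply: nOq; rewrite -wq; exact: DO.
  apply: rU; first exact: slice_point_cone.
  rewrite qE; apply: hd; last by apply: lt_trans nJ _; lra.
  rewrite pE; apply: le_lt_trans (normc_dist_le _ (b n) _) _.
  have : (2 ^+ n)^-1 <= (2 ^+ N)^-1 :> R.
    by rewrite lef_pV2 ?posrE ?exprn_gt0 // ler_eXn2l // ltr1n.
  by move: hN; rewrite div1r; lra.
split=> //.
  by apply/seteqP; split=> // q [Oq lq]; case: (isolated q Oq).
split=> //; apply/seteqP; split=> q.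
  move=> cl; have [Dq|nDq] := pselect (D q); first by left.
  right; have clO : closure Omega q by exact: closure_subset DO _ cl.
  split=> // iO; apply: (isolated q (interior_subset iO)) => U nU.
  have [w [Dw Uw]] := cl U nU; exists w; split=> //.
  by apply/eqP => wq; apply: nDq; rewrite -wq.
move=> [Dq|bq]; first exact: subset_closure.
exact: subset_limit_point (accum _ bq).
Qed.
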